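(* Let $r\ge1$, $n\ge 0$, $S\ge0$ be integers. Let $q_1,q_2$ be nonzero complex numbers in the open unit disk with either $q_1=\overline{q_2}$ or $q_1,q_2\in(0,1)$. Let $\vec u=(u_1,\dots,u_r)\in\mathbb C^r$ satisfy $|q_i|\max_\alpha|u_\alpha|<\min_\alpha|u_\alpha|$ for $i=1,2$, and let $\vec p=(p_1,\dots,p_S)\in\mathbb C^S$. Assume that $$u_\alpha u_\beta^{-1}\ne q_1^xq_2^y\quad\text{for all }x,y\in\{-n,\dots,n\}\text{ and all }\alpha\ne\beta\in\{1,\dots,r\},$$ $$q_1^x\ne q_2^{y+1}\ \text{ and }\ q_1^{x+1}\ne q_2^y\quad\text{for all }x,y\in\{0,\dots,n-1\}.$$ Let $$\mathcal Z_n(\vec u;\vec p)=\frac1{n!}\Big(\frac{1-q_1q_2}{(1-q_1)(1-q_2)}\Big)^n\int_{C_\rho^n}\prod_{j=1}^n\frac{dz_j}{2\pi i z_j}\prod_{j=1}^n\prod_{m=1}^S(z_j-p_m)\prod_{j=1}^n\prod_{\alpha=1}^r\frac{-u_\alpha z_j}{(z_j-u_\alpha)(q_1q_2z_j-u_\alpha)}\prod_{1\le j\ne k\le n}\frac{(z_j-z_k)(z_j-q_1q_2z_k)}{(z_j-q_1z_k)(z_j-q_2z_k)},$$ where $C_\rho$ is the positively oriented circle of radius $\rho$ centred at $0$ and $\rho>0$ is any number with $|u_\alpha|<\rho<|q_i|^{-1}|u_\alpha|$ for all $\alpha=1,\dots,r$ and $i=1,2$. Then $\mathcal Z_n(\vec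 u;\vec p)$ is given by a sum over $r$-tuples $\vec Y=(Y_1,\dots,Y_r)$ of partitions of total size $|\vec Y|=n$ in two equivalent ways: $$\mathcal Z_n(\vec u;\vec p)=\sum_{|\vec Y|=n}\frac{\prod_{\alpha=1}^r\prod_{b\in Y_\alpha}\prod_{m=1}^S(z_b^\alpha-p_m)}{\prod_{\alpha,\beta=1}^rN^{\vec Y}_{\alpha,\beta}}=\sum_{|\vec Y|=n}\frac{\prod_{\alpha=1}^r\prod_{b\in Y_\alpha}\prod_{m=1}^S(z_b^\alpha-p_m)}{\prod_{\alpha,\beta=1}^rM^{\vec Y}_{\alpha,\beta}},$$ where $z^\alpha_b=u_\alpha q_1^{x-1}q_2^{y-1}$ for $b=(x,y)\in Y_\alpha$, and $$N^{\vec Y}_{\alpha,\beta}=\prod_{b\in Y_\alpha}\Big(1-\frac{u_\alpha}{u_\beta}q_1^{l_{Y_\alpha}(b)+1}q_2^{-a_{Y_\beta}(b)}\Big)\prod_{b\in Y_\beta}\Big(1-\frac{u_\alpha}{u_\beta}q_1^{-l_{Y_\beta}(b)}q_2^{a_{Y_\alpha}(b)+1}\Big),$$ $$M^{\vec Y}_{\alpha,\beta}=\prod_{b\in Y_\alpha}\Big(1-\frac{u_\alpha}{u_\beta}q_1^{-l_{Y_\beta}(b)}q_2^{a_{Y_\alpha}(b)+1}\Big)\prod_{b\in Y_\beta}\Big(1-\frac{u_\alpha}{u_\beta}q_1^{l_{Y_\alpha}(b)+1}q_2^{-a_{Y_\beta}(b)}\Big).$$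
   Context: A partition $Y=(Y(1),\dots,Y(l))$ of length $l(Y)=l$ and size $|Y|=\sum_xY(x)$ is identified with its Young diagram $\{(x,y):1\le x\le l(Y),\ 1\le y\le Y(x)\}$, with the convention $Y(x)=0$ for $x>l(Y)$; $Y^T$ denotes the transposed partition. For any box $b=(x,y)$ of positive integers, not necessarily contained in $Y$, the arm length is $a_Y(b)=Y(x)-y$ and the leg length is $l_Y(b)=Y^T(y)-x$; both can be negative. For an $r$-tuple of partitions, $|\vec Y|=|Y_1|+\dots+|Y_r|$. The empty partition is allowed. *)

(* Defs.v *)
From HB Require Import structures.
From mathcomp Require Import all_boot all_order all_algebra.
From mathcomp Require Import all_classical all_reals all_analysis.
From mathcomp Require Export complex.

Set Implicit Arguments.
Unset Strict Implicit.
Unset Printing Implicit Defensive.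

Import Order.TTheory GRing.Theory Num.Theory.
Import ComplexField.Normc.

Local Open Scope classical_set_scope.
Local Open Scope ring_scope.
Local Open Scope complex_scope.

Record int_partition := IntPartition {
  parts :> seq nat;
  _ : sorted geq parts && (0%N \notin parts) }.

HB.instance Definition _ := [isSub for parts].
HB.instance Definition _ := [Countable of int_partition by <:].

Definition psize (Y : int_partition) : nat := sumn Y.

(* Y(x) for x >= 1, and 0 for x > l(Y); the argument x = 0 is never used. *)
Definition part (Y : int_partition) (x : nat) : nat := nth 0%N Y x.-1.

(* Boxes are 1-based: (x, y) with 1 <= x <= l(Y) and 1 <= y <= Y(x). *)
Definition diagram (Y : int_partition) : seq (nat * nat) :=
  [seq (x, y) | x <- iota 1 (size Y), y <- iota 1 (part Y x)].

Definition transpose_seq (s : seq nat) : seq nat :=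
  [seq count (leq y) s | y <- iota 1 (head 0%N s)].

Lemma transpose_subproof (Y : int_partition) :
  sorted geq (transpose_seq Y) && (0%N \notin transpose_seq Y).
Proof.
apply/andP; split.
  rewrite /transpose_seq; move: (head _ _) => m.
  apply: (homo_sorted (e := leq)); last exact: iota_sorted.
  by move=> y z /= yz; apply: sub_count => k /=; exact: leq_trans.
apply/mapP => -[y]; rewrite mem_iota add1n ltnS => /andP[y0 ley] /esym/eqP.
apply/negP; rewrite -lt0n -has_count.
by case: (parts Y) ley => [|k s] /= ley; [move: ley; rewrite leqNgt y0 | rewrite ley].
Qed.

Definition transpose (Y : int_partition) : int_partition :=
  IntPartition (transpose_subproof Y).

Lemma mem_diagram (Y : int_partition) (x y : nat) :
  ((x, y) \in diagram Y) = [&& 0 < x, 0 < y & y <= part Y x]%N.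
Proof.
apply/allpairsPdep/idP => [[x' [y' [+ + [-> ->]]]]|/and3P[x0 y0 yY]].
  by rewrite !mem_iota !add1n !ltnS => /andP[-> _].
exists x, y; split=> //; rewrite mem_iota add1n ltnS ?x0 ?y0 //=.
rewrite leqNgt; apply/negP => xY.
have := leq_trans y0 yY; rewrite /part nth_default //.
by rewrite -ltnS prednK.
Qed.

Lemma mem_diagram_transpose (Y : int_partition) (x y : nat) :
  ((y, x) \in diagram (transpose Y)) = ((x, y) \in diagram Y).
Proof.
rewrite !mem_diagram; case: y => [|y]; first by rewrite andbF.
case: x => [|x] //=; rewrite /part /=.
case: Y => s /= /andP[ss _].
have count0 k t : path geq k t -> (k <= y)%N -> count (leq y.+1) t = 0%N.
  move=> kt ky; apply/eqP; rewrite -leqn0 leqNgt -has_count.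
  apply/hasPn => z zt; rewrite /= -leqNgt; apply: leq_trans ky.
  have geq_trans : transitive geq by move=> a b c /= ba cb; exact: leq_trans ba.
  exact: (allP (order_path_min geq_trans kt)).
have E : (x < count (leq y.+1) s)%N = (y < nth 0%N s x)%N.
  elim: s ss x => [|k s IH] ss x; first by rewrite nth_nil.
  case: (ltnP y k) => ky.
    by case: x => [|x] /=; rewrite ky // add1n ltnS IH // (path_sorted ss).
  have yk : (y < k)%N = false by rewrite ltnNge ky.
  rewrite /= (count0 k) // yk /=.
  case: x => [|x] /=; first by rewrite yk.
  by rewrite -IH ?(path_sorted ss) // (count0 k).
have [ym|ym] := ltnP y (head 0%N s).
  by rewrite (nth_map 0%N) ?size_iota // nth_iota // add1n E.
rewrite nth_default ?size_map ?size_iota //= -E; apply/esym/negbTE.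
by case: s ss ym {E} => //= k s ks ky; rewrite [(y < k)%N]ltnNge ky /= (count0 k).
Qed.

Definition arm (Y : int_partition) (b : nat * nat) : int :=
  (part Y b.1)%:Z - b.2%:Z.

Definition leg (Y : int_partition) (b : nat * nat) : int :=
  (part (transpose Y) b.2)%:Z - b.1%:Z.

Definition tuples_of_size (r n : nat) : set {ffun 'I_r -> int_partition} :=
  [set Y | (\sum_(a < r) psize (Y a) = n)%N].
Arguments tuples_of_size : clear implicits.

(* Sums over [tuples_of_size r n] are finitely supported by this fact. *)
Lemma finite_tuples_of_size (r n : nat) : finite_set (tuples_of_size r n).
Proof.
pose g (F : {ffun 'I_r -> n.-bseq 'I_n.+1}) : {ffun 'I_r -> int_partition} :=
  [ffun a => insubd (IntPartition (erefl : sorted geq [::] && (0%N \notin [::])))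
                    [seq val i | i <- F a]].
apply: (@sub_finite_set _ _ (g @` setT)); last exact: finite_image.
move=> Y /= Yn.
have Ya a : (psize (Y a) <= n)%N.
  by rewrite -Yn (bigD1 a) //= leq_addr.
have szY a : (size (Y a) <= n)%N.
  apply: leq_trans (Ya a); rewrite /psize; case: (Y a) => s /= /andP[_].
  elim: s => //= k s IH; rewrite inE negb_or eq_sym -lt0n => /andP[k0 /IH].
  by move=> h; rewrite -add1n leq_add.
have leY a k : k \in parts (Y a) -> (k <= n)%N.
  move=> kY; apply: leq_trans (Ya a); rewrite /psize.
  elim: (parts (Y a)) kY => //= m s IH; rewrite inE => /orP[/eqP->|/IH h].
    exact: leq_addr.
  by rewrite (leq_trans h) ?leq_addl.
have szm a : (size [seq (inord k : 'I_n.+1) | k <- Y a] <= n)%N.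
  by rewrite size_map.
exists [ffun a => Bseq (szm a)] => //; apply/ffunP => a; rewrite !ffunE.
have -> : [seq val i | i <- Bseq (szm a)] = val (Y a).
  rewrite /= -map_comp -[RHS]map_id; apply/eq_in_map => k kY /=.
  by rewrite inordK // ltnS (leY a).
by rewrite valKd.
Qed.

Section Integral.
Variable R : realType.
Local Notation C := R[i].

Definition cintegral (a b : R) (g : R -> C) : C :=
  (\int[lebesgue_measure]_(t in `[a, b]) complex.Re (g t)) +i*
  (\int[lebesgue_measure]_(t in `[a, b]) complex.Im (g t)).

(* The integral of f(z) dz over z = rho e^{it}, 0 <= t <= 2 pi, for which
   dz = i z dt. *)
Definition circle_integral (rho : R) (f : C -> C) : C :=
  cintegral 0 (2 * pi) (fun t =>
    let z := rho%:C * (cos t +i* sin t) in f z * ('i * z)).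

(* The integral of f(z_1, ..., z_n) dz_1 ... dz_n over the n-th power of the
   circle, as an iterated integral. *)
Fixpoint torus_integral (rho : R) (n : nat) : (n.-tuple C -> C) -> C :=
  match n with
  | 0 => fun f => f [tuple]
  | m.+1 => fun f => circle_integral rho (fun z =>
      torus_integral rho (fun w : m.-tuple C => f [tuple of z :: w]))
  end.

End Integral.

Section Nekrasov.
Variables (R : realType) (r S : nat) (q1 q2 : R[i]).
Variables (u : 'I_r -> R[i]) (p : 'I_S -> R[i]).
Local Notation C := R[i].

Definition Z_integrand (n : nat) (z : n.-tuple C) : C :=
  let z_ j := tnth z j in
  (\prod_(j < n) (2 * pi%:C * 'i * z_ j)^-1)
  * (\prod_(j < n) \prod_(m < S) (z_ j - p m))
  * (\prod_(j < n) \prod_(a < r)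
       (- u a * z_ j / ((z_ j - u a) * (q1 * q2 * z_ j - u a))))
  * (\prod_(j < n) \prod_(k < n | j != k)
       ((z_ j - z_ k) * (z_ j - q1 * q2 * z_ k)
        / ((z_ j - q1 * z_ k) * (z_ j - q2 * z_ k)))).

Definition Zn (rho : R) (n : nat) : C :=
  (n`!)%:R^-1 * ((1 - q1 * q2) / ((1 - q1) * (1 - q2))) ^+ n
  * torus_integral rho (@Z_integrand n).

Implicit Type Y : {ffun 'I_r -> int_partition}.

Definition box_z (a : 'I_r) (b : nat * nat) : C :=
  u a * q1 ^+ b.1.-1 * q2 ^+ b.2.-1.

Definition numer Y : C :=
  \prod_(a < r) \prod_(b <- diagram (Y a)) \prod_(m < S) (box_z a b - p m).

Definition N_ Y (a c : 'I_r) : C :=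
  (\prod_(b <- diagram (Y a))
     (1 - u a / u c * q1 ^ (leg (Y a) b + 1) * q2 ^ (- arm (Y c) b)))
  * (\prod_(b <- diagram (Y c))
     (1 - u a / u c * q1 ^ (- leg (Y c) b) * q2 ^ (arm (Y a) b + 1))).

Definition M_ Y (a c : 'I_r) : C :=
  (\prod_(b <- diagram (Y a))
     (1 - u a / u c * q1 ^ (- leg (Y c) b) * q2 ^ (arm (Y a) b + 1)))
  * (\prod_(b <- diagram (Y c))
     (1 - u a / u c * q1 ^ (leg (Y a) b + 1) * q2 ^ (- arm (Y c) b))).

End Nekrasov.

(* Main.v *)
(* All circles are shrunk at the same time.  Put
     kap z w = (z-w)(z-q1q2w)(w-z)(w-q1q2z) / ((z-q1w)(z-q2w)(w-q1z)(w-q2z)),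
   so that the integrand is a product of one-body factors phi(z_j) and of
   kap z_j z_k over the pairs j < k.  When |q_i| r2 < r1 < r2, moving one variable
   from radius r2 to radius r1, with all other variables on one of these circles,
   meets only the poles of phi, and the residue at a pole z = chi leaves an
   integral of the same kind in one variable less, with phi(z) replaced by
   phi(z) kap(chi, z).  Starting from the vacuum, the poles collected in this way
   are the boxes u_a q1^x q2^y of an r-tuple Y of Young diagrams: after
   cancellation phi_Y has poles only at the row ends, and the residue vanishes
   unless the box can be added to Y; in that case it equals the ratio of the
   weights of the two tuples, by the increments of the multiset of arms and legs.
   The circles descend through a finite sequence of radii; once they lie below all
   poles the integral is 0, as one sees by letting the radius tend to 0.  A tuple of
   size n is met with multiplicity n!, the number of ways to assign variables to
   boxes.  Exchanging q1 and q2 and transposing the diagrams turns N into M.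

   Integrals are handled through uniform approximation by Laurent polynomials on
   tori, for which linearity, independence of the radius and exchange of variables
   are checked on monomials. *)
Require Import Defs.
From mathcomp Require Import all_boot all_order all_algebra.
From mathcomp Require Import all_classical all_reals all_analysis.
From mathcomp Require Import ring lra zify.
Import Order.TTheory GRing.Theory Num.Theory.
Import ComplexField.Normc.
Import numFieldNormedType.Exports.
Local Open Scope ring_scope.
Local Open Scope complex_scope.

Set Implicit Arguments.
Unset Strict Implicit.
Unset Printing Implicit Defensive.

(** * Circle integrals *)

Section ComplexNorm.
Local Open Scope classical_set_scope.
Local Open Scope ring_scope.
Local Open Scope complex_scope.
Variable R : realType.
Implicit Types x y : R[i].

(** The poles z = q_i w of the pair kernel move with the other variables, and a circle may shrink by
    a factor above max |q_i| without meeting them. Each step of the descent therefore uses a factor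
    between m = max |q_i| and (1 + m) / 2, and a radius that avoids the moduli of all lattice
    points. One move inside a diagram already multiplies the modulus by some |q_i|, so the boxes
    collected during one step are all addable to the tuple at its start. The variables may meet them
    in any order, and the count is a falling factorial. It is kept by an induction over states with
    a variables on the outer and b on the inner circle. Cauchy's theorem is used in one form only:
    if the same Laurent polynomials approximate a function on two tori, its integrals over both
    agree. The kernels multiplying a polar part enter through divided differences, for which this
    approximation is closed under products, differences and inverses. Residues are taken only while
    fewer than n boxes have been collected, so the row lengths stay below n; the genericity
    assumptions reach just far enough for this. *)

Lemma normc_ge0 x : 0 <= normc x.
Proof. by case: x => a b; rewrite /normc sqrtr_ge0. Qed.

Lemma normc_eq0 x : (normc x == 0) = (x == 0).
Proof.
by apply/eqP/eqP => [/eq0_normc|->]; rewrite ?normc0.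
Qed.

Lemma normc_gt0 x : (0 < normc x) = (x != 0).
Proof. by rewrite lt_def normc_ge0 normc_eq0 andbT. Qed.

Lemma normcX x n : normc (x ^+ n) = normc x ^+ n.
Proof. by elim: n => [|n IH]; rewrite ?expr0 ?normc1// !exprS normcM IH. Qed.

Lemma normcR (r : R) : normc r%:C = `|r|.
Proof. by rewrite /normc /= expr0n addr0 sqrtr_sqr. Qed.

Lemma normcB_sym x y : normc (x - y) = normc (y - x).
Proof. by rewrite -normcN opprB. Qed.

Lemma ler_normcB x y : normc x - normc y <= normc (x - y).
Proof. by rewrite lerBlDr (le_trans _ (le_normcD _ _))// subrK. Qed.

Lemma normc_Re x : `|complex.Re x| <= normc x.
Proof.
by case: x => a b; rewrite /normc /= -sqrtr_sqr ler_wsqrtr// lerDl sqr_ge0.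
Qed.

Lemma normc_Im x : `|complex.Im x| <= normc x.
Proof.
by case: x => a b; rewrite /normc /= -sqrtr_sqr ler_wsqrtr// lerDr sqr_ge0.
Qed.

Lemma normc_le_ReIm x : normc x <= `|complex.Re x| + `|complex.Im x|.
Proof.
case: x => a b; rewrite /normc /=.
have -> : `|a| + `|b| = Num.sqrt ((`|a| + `|b|) ^+ 2).
  by rewrite sqrtr_sqr [RHS]ger0_norm ?addr_ge0.
rewrite ler_wsqrtr// sqrrD !real_normK ?num_real// lerD2r lerDl.
by rewrite mulrn_wge0// mulr_ge0.
Qed.

End ComplexNorm.

Section CircleIntegral.
Local Open Scope classical_set_scope.
Local Open Scope ring_scope.
Local Open Scope complex_scope.
Variable R : realType.
Local Notation C := R[i].
Local Notation mu := (@lebesgue_measure R).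

(** Real and imaginary parts are treated separately because [cintegral] is a pair of real Lebesgue
    integrals. *)
Definition ccont (g : R -> C) :=
  continuous (fun t => complex.Re (g t) : R) /\
  continuous (fun t => complex.Im (g t) : R).

Lemma continuous_uniform_limit (f : R -> R) :
  (forall e, 0 < e -> exists2 g : R -> R, continuous g &
     forall t, `|f t - g t| <= e) -> continuous f.
Proof.
move=> H x; apply/cvgrPdist_le => e e0.
have e30 : 0 < e / 3 by rewrite divr_gt0.
have [g cg fg] := H _ e30.
have /cvgrPdist_le/(_ _ e30) := cg x.
apply: filterS => t gt.
have := fg t; have := fg x; move: gt; rewrite (distrC (f t)).
set a := f x; set b := f t; set c := g x; set d := g t => h1 h2 h3.
have -> : a - b = (a - c) + (c - d) + (d - b) by ring.
apply: (le_trans (ler_normD _ _)); apply: le_trans (lerD (ler_normD _ _) (lexx _)) _.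
lra.
Qed.

Lemma ccont_uniform_limit (f : R -> C) :
  (forall e, 0 < e -> exists2 g : R -> C, ccont g &
     forall t, normc (f t - g t) <= e) -> ccont f.
Proof.
move=> H; split; apply: continuous_uniform_limit => e /H[g [g1 g2] fg].
- exists (fun t => complex.Re (g t)) => // t.
  by apply: le_trans (fg t); rewrite -raddfB normc_Re.
- exists (fun t => complex.Im (g t)) => // t.
  by apply: le_trans (fg t); rewrite -raddfB normc_Im.
Qed.

Lemma ReM (x y : C) : complex.Re (x * y) =
  complex.Re x * complex.Re y - complex.Im x * complex.Im y.
Proof. by case: x; case: y. Qed.

Lemma ImM (x y : C) : complex.Im (x * y) =
  complex.Re x * complex.Im y + complex.Im x * complex.Re y.
Proof. by case: x; case: y. Qed.

Lemma ccontD f g : ccont f -> ccont g -> ccont (fun t => f t + g t).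
Proof.
move=> [f1 f2] [g1 g2]; split => t.
- have -> : (fun t => complex.Re (f t + g t)) =
    (fun t => complex.Re (f t)) \+ (fun t => complex.Re (g t)).
    by apply: funext => s /=; rewrite raddfD.
  by apply: cvgD; [exact: f1|exact: g1].
- have -> : (fun t => complex.Im (f t + g t)) =
    (fun t => complex.Im (f t)) \+ (fun t => complex.Im (g t)).
    by apply: funext => s /=; rewrite raddfD.
  by apply: cvgD; [exact: f2|exact: g2].
Qed.

Lemma ccontM f g : ccont f -> ccont g -> ccont (fun t => f t * g t).
Proof.
move=> [f1 f2] [g1 g2]; split => t.
- have -> : (fun t => complex.Re (f t * g t)) =
    ((fun t => complex.Re (f t)) \* (fun t => complex.Re (g t)))
    - ((fun t => complex.Im (f t)) \* (fun t => complex.Im (g t))).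
    by apply: funext => s /=; rewrite ReM.
  by apply: cvgB; apply: cvgM; [exact: f1|exact: g1|exact: f2|exact: g2].
- have -> : (fun t => complex.Im (f t * g t)) =
    ((fun t => complex.Re (f t)) \* (fun t => complex.Im (g t)))
    + ((fun t => complex.Im (f t)) \* (fun t => complex.Re (g t))).
    by apply: funext => s /=; rewrite ImM.
  by apply: cvgD; apply: cvgM; [exact: f1|exact: g2|exact: f2|exact: g1].
Qed.

Lemma ccont_cst (c : C) : ccont (fun _ => c).
Proof. by split => t; exact: cvg_cst. Qed.

Lemma ccont_sum (I : Type) (s : seq I) (F : I -> R -> C) :
  (forall i, ccont (F i)) -> ccont (fun t => \sum_(i <- s) F i t).
Proof.
move=> cF; elim: s => [|i s IH].
  have -> : (fun t => \sum_(i <- [::]) F i t) = (fun=> 0).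
    by apply: funext => t; rewrite big_nil.
  exact: ccont_cst.
have -> : (fun t => \sum_(j <- i :: s) F j t) =
  (fun t => F i t + \sum_(j <- s) F j t).
  by apply: funext => t; rewrite big_cons.
exact: ccontD.
Qed.

Definition cint (g : R -> C) : C := cintegral 0 (2 * pi) g.

Lemma twopi_gt0 : 0 < 2 * pi :> R.
Proof. by rewrite mulr_gt0// pi_gt0. Qed.

Lemma measure_0_2pi : fine (mu `[0, 2 * pi]) = 2 * pi.
Proof.
have -> : mu `[0, 2 * pi] = (2 * pi)%:E.
  by rewrite (lebesgue_measure_itv `[0, 2 * pi]) /= lte_fin twopi_gt0 oppr0 adde0.
by [].
Qed.

Lemma continuous_integrable (f : R -> R) : continuous f ->
  mu.-integrable `[0, 2 * pi] (EFin \o f).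
Proof.
move=> cf; apply: continuous_compact_integrable; first exact: segment_compact.
exact: continuous_subspaceT.
Qed.

Lemma cintD f g : ccont f -> ccont g ->
  cint (fun t => f t + g t) = cint f + cint g.
Proof.
move=> [f1 f2] [g1 g2]; rewrite /cint /cintegral.
under eq_Rintegral do rewrite raddfD.
rewrite RintegralD//; try exact: continuous_integrable.
under [X in _ +i* X]eq_Rintegral do rewrite raddfD.
by rewrite RintegralD//; exact: continuous_integrable.
Qed.

Lemma cintZ (c : C) f : ccont f -> cint (fun t => c * f t) = c * cint f.
Proof.
move=> [f1 f2]; rewrite /cint /cintegral.
have iZ a (h : R -> R) : continuous h ->
  mu.-integrable `[0, 2 * pi] (EFin \o (fun x => a * h x)).
  move=> ch; apply: continuous_integrable => t.
  by apply: cvgM; [exact: cvg_cst|exact: ch].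
under eq_Rintegral do rewrite ReM.
rewrite RintegralB ?RintegralZl//; try exact: continuous_integrable; try exact: iZ.
under [X in _ +i* X]eq_Rintegral do rewrite ImM.
rewrite RintegralD ?RintegralZl//; try exact: continuous_integrable; try exact: iZ.
by case: c => a b.
Qed.

Lemma Rint_bound (f : R -> R) (e : R) : continuous f ->
  (forall t, `|f t| <= e) ->
  `| \int[mu]_(t in `[0, 2 * pi]) f t | <= 2 * pi * e.
Proof.
move=> cf fe; apply: (le_trans (le_normr_Rintegral _ _)) => //.
  exact: continuous_integrable.
have -> : 2 * pi * e = \int[mu]_(t in `[0, 2 * pi]) e.
  by rewrite Rintegral_cst// measure_0_2pi mulrC.
apply: le_Rintegral => //.
  apply: continuous_integrable => t; apply: (@cvg_norm _ R); exact: cf.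
by apply: continuous_integrable => t; exact: cvg_cst.
Qed.

(** The two parts are bounded one by one, which gives 4 pi instead of 2 pi. The size of the constant
    is harmless, since it only ever multiplies an error tending to 0. *)
Lemma cint_bound (f : R -> C) (e : R) : ccont f ->
  (forall t, normc (f t) <= e) -> normc (cint f) <= 4 * pi * e.
Proof.
move=> [f1 f2] fe; apply: (le_trans (normc_le_ReIm _)).
have -> : 4 * pi * e = 2 * pi * e + 2 * pi * e :> R by ring.
by apply: lerD; apply: Rint_bound => // t; apply: le_trans (fe t);
  rewrite ?normc_Re ?normc_Im.
Qed.

Definition cis (t : R) : C := cos t +i* sin t.

Lemma cisD s t : cis (s + t) = cis s * cis t.
Proof. by rewrite /cis cosD sinD; congr (_ +i* _); rewrite addrC [in RHS]addrC; ring. Qed.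

Lemma cis0 : cis 0 = 1.
Proof. by rewrite /cis cos0 sin0. Qed.

Lemma normc_cis t : normc (cis t) = 1.
Proof. by rewrite /cis /normc cos2Dsin2 sqrtr1. Qed.

Lemma cis_neq0 t : cis t != 0.
Proof. by rewrite -normc_gt0 normc_cis. Qed.

Lemma cisN t : cis (- t) = (cis t)^-1.
Proof.
apply: (mulfI (cis_neq0 t)); rewrite -cisD subrr cis0 divff//; exact: cis_neq0.
Qed.

Lemma cisX t (k : int) : cis t ^ k = cis (k%:~R * t).
Proof.
have nat_case (n : nat) : cis t ^+ n = cis (n%:R * t).
  elim: n => [|n IH]; first by rewrite mul0r cis0.
  by rewrite exprS IH -cisD -natr1 mulrDl mul1r addrC.
case: k => n; first by rewrite -exprnP nat_case.
by rewrite NegzE -exprz_inv -exprnP exprVn nat_case -cisN mulrNz mulNr.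
Qed.

Lemma continuous_mulZ (k : R) : continuous (fun t : R => k * t).
Proof. by move=> t; apply: cvgM; [exact: cvg_cst|exact: cvg_id]. Qed.

Lemma ccont_cis (k : R) : ccont (fun t => cis (k * t)).
Proof.
split=> t /=.
- by apply: continuous_comp; [exact: continuous_mulZ|exact: continuous_cos].
- by apply: continuous_comp; [exact: continuous_mulZ|exact: continuous_sin].
Qed.

Lemma sin_int2pi (k : int) : sin (k%:~R * (2 * pi)) = 0 :> R /\
  cos (k%:~R * (2 * pi)) = 1 :> R.
Proof.
have -> : 2 * pi = pi *+ 2 :> R by rewrite mulr_natl.
have H : cis (pi *+ 2) = 1 by rewrite /cis cos2pi sin2pi.
have H' : cis (k%:~R * (pi *+ 2)) = 1 by rewrite -cisX H exp1rz.
by split; [have := congr1 (@complex.Im R) H'|have := congr1 (@complex.Re R) H'].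
Qed.

Lemma FTC_R (f F : R -> R) : continuous f ->
  (forall x : R, is_derive x 1 F (f x)) ->
  \int[mu]_(t in `[0, 2 * pi]) f t = F (2 * pi) - F 0.
Proof.
move=> cf dF; rewrite /Rintegral (@continuous_FTC2 _ f F)//.
- exact: twopi_gt0.
- exact: continuous_subspaceT.
- have cF : continuous F.
    by move=> x; apply/differentiable_continuous/derivable1_diffP; have [] := dF x.
  split => //.
  + by apply: cvg_at_right_filter; exact: cF.
  + by apply: cvg_at_left_filter; exact: cF.
- by move=> x _; rewrite derive1E; have [] := dF x.
Qed.

(** For k != 0 the antiderivatives sin(kt)/k and -cos(kt)/k take equal values at 0 and 2 pi. *)
Lemma cint_cis (k : int) : cint (fun t => cis (k%:~R * t)) =
  if k == 0 then (2 * pi)%:C else 0.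
Proof.
have [->|k0] := eqVneq k 0.
  rewrite /cint /cintegral.
  under eq_Rintegral do rewrite mul0r /= cos0.
  under [X in _ +i* X]eq_Rintegral do rewrite mul0r /= sin0.
  by rewrite !Rintegral_cst// measure_0_2pi mul0r mul1r.
have k0' : (k%:~R : R) != 0 by rewrite intr_eq0.
have [ck1 ck2] := ccont_cis (k%:~R).
have [sk ck] := sin_int2pi k.
rewrite /cint /cintegral /=.
have H1 (x : R) : is_derive x 1 (fun t : R => k%:~R^-1 * sin (k%:~R * t)) (cos (k%:~R * x)).
  have d1 : is_derive x 1 (fun t : R => k%:~R * t) k%:~R.
    by apply: is_derive_eq; rewrite /GRing.scale /= mulr1.
  have d2 := is_derive1_comp (f := sin) (g := fun t : R => k%:~R * t) (x := x)
    (is_derive_sin _) d1.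
  by apply: is_derive_eq; rewrite /GRing.scale /= mulrC mulfK.
have H2 (x : R) : is_derive x 1 (fun t : R => - k%:~R^-1 * cos (k%:~R * t)) (sin (k%:~R * x)).
  have d1 : is_derive x 1 (fun t : R => k%:~R * t) k%:~R.
    by apply: is_derive_eq; rewrite /GRing.scale /= mulr1.
  have d2 := is_derive1_comp (f := cos) (g := fun t : R => k%:~R * t) (x := x)
    (is_derive_cos _) d1.
  by apply: is_derive_eq; rewrite /GRing.scale /= mulNr mulNr mulrN opprK mulrC mulfK.
rewrite (FTC_R ck1 H1) (FTC_R ck2 H2) sk ck !mulr0 sin0 cos0.
by rewrite !mulr0 mulr1 !subrr.
Qed.

Lemma circle_point (r t : R) : r%:C * (cos t +i* sin t) = r%:C * cis t.
Proof. by []. Qed.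

End CircleIntegral.

(** * Iterated integrals and Laurent approximation *)

Section IteratedIntegral.
Local Open Scope classical_set_scope.
Local Open Scope ring_scope.
Local Open Scope complex_scope.
Variable R : realType.
Local Notation C := R[i].

Fixpoint mint (rs : seq R) (f : seq C -> C) : C :=
  match rs with
  | [::] => f [::]
  | r :: rs' => circle_integral r (fun z => mint rs' (fun w => f (z :: w)))
  end.

(** Exponents form a function on all of nat, of which only the first [size z] values are read;
    freezing or rotating variables is then a reindexing of this function. *)
Fixpoint mono (k : nat -> int) (z : seq C) : C :=
  match z with
  | [::] => 1
  | x :: w => x ^ (k 0%N) * mono (fun j => k j.+1) w
  end.

Definition leval (P : seq (C * (nat -> int))) (z : seq C) : C :=
  \sum_(t <- P) t.1 * mono t.2 z.

(** The exact iterated integral of P in m variables: a monomial contributes only if all its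
    exponents are -1. No radius occurs in it, and this is the source of independence of the
    radius. *)
Definition lres (m : nat) (P : seq (C * (nat -> int))) : C :=
  \sum_(t <- P) t.1 * \prod_(j < m) (if t.2 j == -1 then (2 * pi)%:C * 'i else 0).

Definition torus (rs : seq R) (z : seq C) : Prop := [seq normc x | x <- z] = rs.

Lemma torus_cons r rs z w : normc z = r -> torus rs w -> torus (r :: rs) (z :: w).
Proof. by rewrite /torus /= => -> ->. Qed.

(** A substitute for holomorphy. When D is a union of two tori, a single Laurent polynomial has to
    approximate f on both of them, which a pole lying between the tori prevents. Boundedness is
    recorded for the sake of products. *)
Definition good (D : seq C -> Prop) (f : seq C -> C) : Prop :=
  [/\ forall z, D z -> 0 \notin z,
      exists B : R, forall z, D z -> normc (f z) <= B &
      forall e : R, 0 < e ->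
        exists P, forall z, D z -> normc (f z - leval P z) <= e].

Definition freeze (z : C) (P : seq (C * (nat -> int))) : seq (C * (nat -> int)) :=
  [seq (t.1 * z ^ (t.2 0%N), fun j => t.2 j.+1) | t <- P].

Lemma leval_freeze z w P : leval P (z :: w) = leval (freeze z P) w.
Proof.
by rewrite /leval big_map; apply: eq_bigr => t _ /=; rewrite mulrA.
Qed.

Lemma good_freeze (r : R) rs f z : normc z = r -> good (torus (r :: rs)) f ->
  good (torus rs) (fun w => f (z :: w)).
Proof.
move=> zr [D0 [B fB] fP]; split.
- by move=> w wrs; have := D0 _ (torus_cons zr wrs); rewrite inE negb_or => /andP[].
- by exists B => w wrs; apply: fB; exact: torus_cons.
- move=> e /fP[P HP]; exists (freeze z P) => w wrs.
  by rewrite -leval_freeze; apply: HP; exact: torus_cons.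
Qed.

(** One factor per variable: 4 pi from [cint_bound], and r from |dz| = r dt. *)
Definition mconst (rs : seq R) : R := \prod_(r <- rs) (4 * pi * r).

Lemma mconst_ge0 (rs : seq R) : all (fun x : R => 0 < x) rs -> 0 <= mconst rs.
Proof.
rewrite /mconst; elim: rs => [|r rs IH] /=; first by rewrite big_nil.
move=> /andP[r0 /IH h]; rewrite big_cons mulr_ge0// mulr_ge0 ?(ltW r0)//.
by rewrite mulr_ge0// pi_ge0.
Qed.

Lemma ccont_circle (r : R) (k : int) : ccont (fun t => (r%:C * cis t) ^ k).
Proof.
have -> : (fun t => (r%:C * cis t) ^ k) =
  (fun t => r%:C ^ k * cis (k%:~R * t)).
  by apply: funext => t; rewrite expfzMl cisX.
by apply: ccontM; [exact: ccont_cst|exact: ccont_cis].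
Qed.

Lemma ccont_iz (r : R) : ccont (fun t => 'i * (r%:C * cis t)).
Proof.
apply: ccontM; first exact: ccont_cst.
exact: (ccont_circle r 1).
Qed.

Lemma cint_monomial (r : R) (k : int) : 0 < r ->
  cint (fun t => (r%:C * cis t) ^ k * ('i * (r%:C * cis t))) =
  if k == -1 then (2 * pi)%:C * 'i else 0.
Proof.
move=> r0.
have rC0 : r%:C != 0 by rewrite fmorph_eq0 gt_eqF.
have -> : (fun t => (r%:C * cis t) ^ k * ('i * (r%:C * cis t))) =
  (fun t => ('i * r%:C ^ (k + 1)) * cis ((k + 1)%:~R * t)).
  apply: funext => t.
  rewrite -cisX mulrCA -mulrA -expfzMl; congr (_ * _).
  by rewrite expfzDr// mulf_neq0// cis_neq0.
rewrite cintZ; last exact: ccont_cis.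
rewrite cint_cis addr_eq0; case: eqP => [->|]; last by rewrite mulr0.
by rewrite addNr expr0z mulr1 mulrC.
Qed.

Lemma cint_sum (I : Type) (s : seq I) (F : I -> R -> C) :
  (forall i, ccont (F i)) ->
  cint (fun t => \sum_(i <- s) F i t) = \sum_(i <- s) cint (F i).
Proof.
move=> cF; elim: s => [|i s IH].
  rewrite big_nil.
  have -> : (fun t => \sum_(i <- [::]) F i t) = (fun=> 0 * 0).
    by apply: funext => t; rewrite big_nil mulr0.
  by rewrite (cintZ 0 (@ccont_cst _ 0)) mul0r.
rewrite big_cons -IH -cintD//; last exact: ccont_sum.
by congr cint; apply: funext => t; rewrite big_cons.
Qed.

Lemma lres_cons m P z : lres m (freeze z P) =
  \sum_(t <- P) (t.1 * \prod_(j < m) (if t.2 j.+1 == -1 then (2 * pi)%:C * 'i else 0))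
     * z ^ (t.2 0%N).
Proof.
by rewrite /lres big_map; apply: eq_bigr => t _ /=; rewrite mulrAC.
Qed.

Lemma normc_i : normc ('i : C) = 1.
Proof. by rewrite /normc /= expr0n expr1n add0r sqrtr1. Qed.

Lemma normc_circle (r t : R) : 0 < r -> normc (r%:C * cis t) = r.
Proof. by move=> r0; rewrite normcM normcR normc_cis mulr1 gtr0_norm. Qed.

(** The induction gives more than the error bound: by the bound for the inner variables, the inner
    integral is a uniform limit of Laurent polynomials in the outer variable. It is therefore
    continuous, and the bound on the outer Lebesgue integral applies to it. *)
Lemma mint_approx (rs : seq R) : all (fun x : R => 0 < x) rs -> forall f, good (torus rs) f ->
  forall P (e : R), (forall z, torus rs z -> normc (f z - leval P z) <= e) ->
  normc (mint rs f - lres (size rs) P) <= mconst rs * e.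
Proof.
elim: rs => [_ f _ P e H|r rs IH /= /andP[r0 rs0] f gf P e H].
  rewrite /mconst big_nil mul1r /=; apply: le_trans (H [::] erefl).
  rewrite /lres /leval; under eq_bigr do rewrite big_ord0 mulr1.
  by under [X in _ <= normc (_ - X)]eq_bigr do rewrite mulr1.
pose g z := mint rs (fun w => f (z :: w)).
pose p (Q : seq (C * (nat -> int))) (z : C) : C := lres (size rs) (freeze z Q).
have gp Q (d : R) : (forall z, torus (r :: rs) z -> normc (f z - leval Q z) <= d) ->
  forall t, normc (g (r%:C * cis t) - p Q (r%:C * cis t)) <= mconst rs * d.
  move=> HQ t; have zr := normc_circle t r0.
  apply: IH => //; first exact: (good_freeze zr).
  move=> w wrs; rewrite -leval_freeze; apply: HQ.
  exact: torus_cons.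
pose J (h : C -> C) (t : R) : C := h (r%:C * cis t) * ('i * (r%:C * cis t)).
have Jn (h1 h2 : C -> C) (d : R) : (forall t, normc (h1 (r%:C * cis t) - h2 (r%:C * cis t)) <= d) ->
  forall t, normc (J h1 t - J h2 t) <= r * d.
  move=> hd t; rewrite /J -mulrBl normcM (normcM 'i) normc_i normc_circle//.
  by rewrite mul1r mulrC ler_wpM2l// ltW.
have cp Q : ccont (J (p Q)).
  apply: ccontM; last exact: ccont_iz.
  rewrite /p; under eq_fun do rewrite lres_cons.
  apply: ccont_sum => t; apply: ccontM; first exact: ccont_cst.
  exact: ccont_circle.
have cg : ccont (J g).
  apply: ccont_uniform_limit => d d0.
  (* The summand 1 only makes the divisor positive. *)
  pose c := r * mconst rs + 1.
  have c0 : 0 < c by rewrite ltr_wpDl// mulr_ge0 ?mconst_ge0// ltW.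
  have [_ _ fP] := gf.
  have [Q HQ] := fP (d / c) (divr_gt0 d0 c0).
  exists (J (p Q)); first exact: cp.
  move=> t; apply: (le_trans (Jn _ _ _ (gp _ _ HQ) t)).
  rewrite !mulrA ler_pdivrMr// [leRHS]mulrC ler_pM2r//.
  by rewrite /c lerDl.
have -> : circle_integral r g = cint (J g) by [].
have -> : lres (size rs).+1 P = cint (J (p P)).
  have -> : J (p P) = (fun t => \sum_(s <- P)
     (s.1 * \prod_(j < size rs) (if s.2 j.+1 == -1 then (2 * pi)%:C * 'i else 0))
     * ((r%:C * cis t) ^ (s.2 0%N) * ('i * (r%:C * cis t)))).
    apply: funext => t; rewrite /J /p lres_cons mulr_suml.
    by apply: eq_bigr => s _; rewrite [RHS]mulrA.
  rewrite cint_sum; last first.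
    move=> t; apply: ccontM; first exact: ccont_cst.
    by apply: ccontM; [exact: ccont_circle|exact: ccont_iz].
  apply: eq_bigr => t _; rewrite cintZ; last first.
    by apply: ccontM; [exact: ccont_circle|exact: ccont_iz].
  rewrite cint_monomial// big_ord_recl -!mulrA; congr (_ * _).
  by rewrite mulrC.
have -> : cint (J g) - cint (J (p P)) = cint (fun t => J g t + -1 * J (p P) t).
  rewrite cintD//; first by rewrite cintZ// mulN1r.
  by apply: ccontM => //; exact: ccont_cst.
rewrite /mconst big_cons -/(mconst rs) -!mulrA (mulrA 4).
apply: cint_bound.
  by apply: ccontD => //; apply: ccontM => //; exact: ccont_cst.
by move=> t; rewrite mulN1r; apply: Jn; exact: gp.
Qed.

End IteratedIntegral.

(** * Closure properties of approximable functions *)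

Section Good.
Local Open Scope classical_set_scope.
Local Open Scope ring_scope.
Local Open Scope complex_scope.
Variable R : realType.
Local Notation C := R[i].
Implicit Types (D : seq C -> Prop) (f g : seq C -> C) (rs : seq R).

Lemma good_sub D D' f : (forall z, D' z -> D z) -> good D f -> good D' f.
Proof.
move=> DD [D0 [B fB] fP]; split.
- by move=> z /DD/D0.
- by exists B => z /DD/fB.
- by move=> e /fP[P HP]; exists P => z /DD/HP.
Qed.

Lemma good_ext D f g : (forall z, D z -> f z = g z) -> good D f -> good D g.
Proof.
move=> fg [D0 [B fB] fP]; split => //.
- by exists B => z Dz; rewrite -fg//; exact: fB.
- by move=> e /fP[P HP]; exists P => z Dz; rewrite -fg//; exact: HP.
Qed.

Lemma good_mono D k (B : R) : (forall z, D z -> 0 \notin z) ->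
  (forall z, D z -> normc (mono k z) <= B) -> good D (mono k).
Proof.
move=> D0 kB; split => //; first by exists B.
move=> e e0; exists [:: (1, k)] => z Dz.
by rewrite /leval big_seq1 mul1r subrr normc0 ltW.
Qed.

Lemma mono0 (z : seq C) : mono (fun=> 0) z = 1.
Proof. by elim: z => //= x z ->; rewrite expr0z mulr1. Qed.

Lemma good_cst D (c : C) : (forall z, D z -> 0 \notin z) -> good D (fun=> c).
Proof.
move=> D0; split => //; first by exists (normc c).
move=> e e0; exists [:: (c, fun=> 0)] => z Dz.
by rewrite /leval big_seq1 mono0 mulr1 subrr normc0 ltW.
Qed.

Lemma goodD D f g : good D f -> good D g -> good D (fun z => f z + g z).
Proof.
move=> [D0 [Bf fB] fP] [_ [Bg gB] gP]; split => //.
  exists (Bf + Bg) => z Dz; apply: le_trans (le_normcD _ _) _.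
  by rewrite lerD ?fB ?gB.
move=> e e0; have e20 : 0 < e / 2 by rewrite divr_gt0.
have [P HP] := fP _ e20; have [Q HQ] := gP _ e20.
exists (P ++ Q) => z Dz; rewrite /leval big_cat /= opprD addrACA.
apply: le_trans (le_normcD _ _) _; rewrite [leRHS](splitr e).
by rewrite lerD ?HP ?HQ.
Qed.

Lemma monoD k l (z : seq C) : 0 \notin z ->
  mono (fun j => k j + l j) z = mono k z * mono l z.
Proof.
elim: z k l => [|x z IH] k l /=; first by rewrite mulr1.
rewrite inE negb_or eq_sym => /andP[x0 z0].
by rewrite IH// expfzDr// mulrACA.
Qed.

Definition lmul (P Q : seq (C * (nat -> int))) : seq (C * (nat -> int)) :=
  [seq (s.1 * t.1, fun j => s.2 j + t.2 j) | s <- P, t <- Q].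

Lemma leval_mul P Q (z : seq C) : 0 \notin z ->
  leval (lmul P Q) z = leval P z * leval Q z.
Proof.
move=> z0; rewrite /leval /lmul big_allpairs_dep big_distrlr /=.
by apply: eq_bigr => s _; apply: eq_bigr => t _; rewrite monoD// mulrACA.
Qed.

Lemma goodM D f g : good D f -> good D g -> good D (fun z => f z * g z).
Proof.
move=> [D0 [Bf fB] fP] [_ [Bg gB] gP]; split => //.
  exists (`|Bf| * `|Bg|) => z Dz; rewrite normcM ler_pM ?normc_ge0//.
  - by rewrite (le_trans (fB _ Dz))// ler_norm.
  - by rewrite (le_trans (gB _ Dz))// ler_norm.
move=> e e0.
pose b := `|Bf| + `|Bg| + 2.
have b0 : 0 < b by rewrite ltr_wpDl// addr_ge0.
(* The bound d <= 1 keeps the approximant of g below |Bg| + 1, and d b <= e absorbs the two error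
   terms |Bf| d and d (|Bg| + 1). *)
pose d := Num.min 1 (e / b).
have d0 : 0 < d by rewrite lt_min ltr01 divr_gt0.
have d1 : d <= 1 by rewrite ge_min lexx.
have de : d * b <= e by rewrite -ler_pdivlMr// ge_min lexx orbT.
have [P HP] := fP _ d0; have [Q HQ] := gP _ d0.
exists (lmul P Q) => z Dz; rewrite leval_mul ?D0//.
have -> : f z * g z - leval P z * leval Q z =
  f z * (g z - leval Q z) + (f z - leval P z) * (g z + - (g z - leval Q z)) by ring.
apply: le_trans (le_normcD _ _) _; rewrite !normcM.
have h1 := HP _ Dz; have h2 := HQ _ Dz.
have h3 : normc (f z) <= `|Bf| by rewrite (le_trans (fB _ Dz))// ler_norm.
have h4 : normc (g z) <= `|Bg| by rewrite (le_trans (gB _ Dz))// ler_norm.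
have h5 : normc (g z + - (g z - leval Q z)) <= `|Bg| + 1.
  by apply: le_trans (le_normcD _ _) _; rewrite normcN lerD// (le_trans h2).
apply: le_trans (_ : `|Bf| * d + d * (`|Bg| + 1) <= _).
  by apply: lerD; apply: ler_pM; rewrite ?normc_ge0.
by apply: le_trans de; rewrite /b; lra.
Qed.

Lemma goodZ D c f : good D f -> good D (fun z => c * f z).
Proof.
by move=> gf; have [D0 _ _] := gf; apply: goodM => //; exact: good_cst.
Qed.

Lemma goodN D f : good D f -> good D (fun z => - f z).
Proof.
by move=> /(goodZ (-1)); apply: good_ext => z _; rewrite mulN1r.
Qed.

Lemma goodB D f g : good D f -> good D g -> good D (fun z => f z - g z).
Proof. by move=> gf gg; apply: goodD => //; exact: goodN. Qed.

Lemma good_sum D (I : eqType) (s : seq I) (F : I -> seq C -> C) :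
  (forall z, D z -> 0 \notin z) -> {in s, forall i, good D (F i)} ->
  good D (fun z => \sum_(i <- s) F i z).
Proof.
move=> D0; elim: s => [_|i s IH Fg].
  by apply: good_ext (good_cst 0 D0) => z _; rewrite big_nil.
have gi : good D (F i) by apply: Fg; rewrite inE eqxx.
have gs : good D (fun z => \sum_(j <- s) F j z).
  by apply: IH => j js; apply: Fg; rewrite inE js orbT.
by apply: good_ext (goodD gi gs) => z _; rewrite big_cons.
Qed.

Lemma good_prod D (I : eqType) (s : seq I) (P : pred I) (F : I -> seq C -> C) :
  (forall z, D z -> 0 \notin z) -> {in s, forall i, P i -> good D (F i)} ->
  good D (fun z => \prod_(i <- s | P i) F i z).
Proof.
move=> D0; elim: s => [_|i s IH Fg].
  by apply: good_ext (good_cst 1 D0) => z _; rewrite big_nil.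
have gs : good D (fun z => \prod_(j <- s | P j) F j z).
  by apply: IH => j js; apply: Fg; rewrite inE js orbT.
have [Pi|Pi] := boolP (P i).
  have gi : good D (F i) by apply: Fg => //; rewrite inE eqxx.
  by apply: good_ext (goodM gi gs) => z _; rewrite big_cons Pi.
by apply: good_ext gs => z _; rewrite big_cons (negbTE Pi).
Qed.

Lemma goodX D f n : good D f -> good D (fun z => f z ^+ n).
Proof.
move=> gf; have [D0 _ _] := gf; elim: n => [|n IH].
  by apply: good_ext (good_cst 1 D0).
by apply: good_ext (goodM gf IH) => z _; rewrite exprS.
Qed.

Lemma good_limit D f : (forall z, D z -> 0 \notin z) ->
  (forall e : R, 0 < e ->
    exists2 g, good D g & forall z, D z -> normc (f z - g z) <= e) -> good D f.
Proof.
move=> D0 H; split => //.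
  have [g [_ [B gB] _] fg] := H 1 ltr01.
  exists (1 + B) => z Dz; rewrite -[f z](subrK (g z)).
  by apply: le_trans (le_normcD _ _) _; rewrite lerD ?fg ?gB.
move=> e e0; have e20 : 0 < e / 2 by rewrite divr_gt0.
have [g [_ _ gP] fg] := H _ e20; have [P HP] := gP _ e20.
exists P => z Dz; have -> : f z - leval P z = (f z - g z) + (g z - leval P z) by ring.
apply: le_trans (le_normcD _ _) _; rewrite [leRHS](splitr e).
by rewrite lerD ?HP ?fg.
Qed.

Lemma exists_expr_lt (th e : R) : 0 <= th < 1 -> 0 < e -> exists n, th ^+ n < e.
Proof.
move=> /andP[th0 th1] e0.
have : th ^+ n @[n --> \oo] --> (0 : R) by apply: cvg_expr; rewrite ger0_norm.
move=> /cvgrPdist_lt/(_ e e0)[n _ /(_ n (leqnn n))].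
by rewrite sub0r normrN ger0_norm ?exprn_ge0// => h; exists n.
Qed.

(** The partial sums of the geometric series converge uniformly, with error at most th^n / (1 -
    th). *)
Lemma good_geom D g (th : R) : th < 1 -> good D g ->
  (forall z, D z -> normc (g z) <= th) -> good D (fun z => (1 - g z)^-1).
Proof.
move=> th1 gg gth; have [D0 _ _] := gg.
(* A negative [th] forces D to be empty. *)
wlog th0 : / 0 <= th.
  move=> H; have [|thn] := leP 0 th; first exact: H.
  suff E z : D z -> False by split => //; [exists 0|move=> e _; exists [::]] => z /E.
  by move=> /gth h; have := le_lt_trans (le_trans (normc_ge0 _) h) thn; rewrite ltxx.
have th10 : 0 < 1 - th by rewrite subr_gt0.
apply: good_limit => // e e0.
have [||n Hn] := @exists_expr_lt th (e * (1 - th)); first by rewrite th0.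
  by rewrite mulr_gt0.
exists (fun z => \sum_(i < n) g z ^+ i).
  apply: good_sum => // i _; exact: goodX.
move=> z Dz.
have h1 : 1 - th <= normc (1 - g z).
  by apply: le_trans (ler_normcB _ _); rewrite normc1 lerD2l lerN2 gth.
have h2 : 0 < normc (1 - g z) by apply: lt_le_trans h1.
have h3 : 1 - g z != 0 by rewrite -normc_gt0.
have -> : (1 - g z)^-1 - \sum_(i < n) g z ^+ i = (1 - g z)^-1 * g z ^+ n.
  have E : (1 - g z) * \sum_(i < n) g z ^+ i = 1 - g z ^+ n.
    by rewrite -[RHS]opprB subrX1 -mulNr opprB.
  by apply: (mulfI h3); rewrite mulrBr mulfV// mulVKf// E subKr.
rewrite normcM normcV normcX mulrC ler_pdivrMr//.
apply: (@le_trans _ _ (th ^+ n)).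
  by rewrite lerXn2r ?nnegrE ?normc_ge0// gth.
by apply: (le_trans (ltW Hn)); rewrite ler_wpM2l// ltW.
Qed.

Lemma mono_delta (a : int) j (z : seq C) : (j < size z)%N ->
  mono (fun i => if i == j then a else 0) z = nth 0 z j ^ a.
Proof.
elim: z j => [|x z IH] [|j] //= jz; first by rewrite mono0 mulr1.
by rewrite expr0z mul1r IH.
Qed.

Lemma nth_neq0 (z : seq C) j : 0 \notin z -> (j < size z)%N -> nth 0 z j != 0.
Proof. by move=> z0 jz; apply: contraNneq z0 => <-; rewrite mem_nth. Qed.

Lemma good_coord D j (B : R) : (forall z, D z -> 0 \notin z) ->
  (forall z, D z -> (j < size z)%N) -> (forall z, D z -> normc (nth 0 z j) <= B) ->
  good D (fun z => nth 0 z j).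
Proof.
move=> D0 Dj DB.
apply: (@good_ext _ (mono (fun i => if i == j then 1 else 0))).
  by move=> z Dz; rewrite mono_delta ?Dj.
by apply: (@good_mono _ _ B) => // z Dz; rewrite mono_delta ?Dj ?DB.
Qed.

Lemma good_ratio D i j (B : R) : (forall z, D z -> 0 \notin z) ->
  (forall z, D z -> (i < size z)%N /\ (j < size z)%N) ->
  (forall z, D z -> normc (nth 0 z i) <= B * normc (nth 0 z j)) ->
  good D (fun z => nth 0 z i / nth 0 z j).
Proof.
move=> D0 Dij DB.
pose k l : int := (if l == i then 1 else 0) + (if l == j then -1 else 0).
have E z : D z -> mono k z = nth 0 z i / nth 0 z j.
  move=> Dz; have [iz jz] := Dij _ Dz.
  by rewrite monoD ?D0// !mono_delta// expr1z exprN1.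
apply: (@good_ext _ (mono k)) => //.
apply: (@good_mono _ _ B) => // z Dz; rewrite E//.
have [iz jz] := Dij _ Dz.
by rewrite normcM normcV ler_pdivrMr ?DB// normc_gt0 nth_neq0 ?D0.
Qed.

Lemma good_coordV D j (b : R) : 0 < b -> (forall z, D z -> 0 \notin z) ->
  (forall z, D z -> (j < size z)%N) -> (forall z, D z -> b <= normc (nth 0 z j)) ->
  good D (fun z => (nth 0 z j)^-1).
Proof.
move=> b0 D0 Dj DB.
have E z : D z -> mono (fun i => if i == j then -1 else 0) z = (nth 0 z j)^-1.
  by move=> Dz; rewrite mono_delta ?Dj// exprN1.
apply: (@good_ext _ (mono (fun i => if i == j then -1 else 0))) => //.
apply: (@good_mono _ _ b^-1) => // z Dz; rewrite E// normcV.
by rewrite lef_pV2 ?DB// posrE// (lt_le_trans b0) ?DB.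
Qed.

End Good.

(** * Linearity, independence of the radius and exchange of variables *)

Section IteratedIntegralTheory.
Local Open Scope classical_set_scope.
Local Open Scope ring_scope.
Local Open Scope complex_scope.
Variable R : realType.
Local Notation C := R[i].
Implicit Types (f g : seq C -> C) (rs : seq R).

Lemma torus_neq0 rs z : all (fun x : R => 0 < x) rs -> torus rs z -> 0 \notin z.
Proof.
move=> rs0 zrs; apply/negP => z0; move: rs0; rewrite -zrs all_map => /allP/(_ _ z0) H.
have : 0 < normc (0 : C) := H.
by rewrite normc0 ltxx.
Qed.

Lemma small_eq0 (x : R) (c : R) : 0 <= x -> (forall e, 0 < e -> x <= c * e) -> x = 0.
Proof.
move=> x0 H; apply/eqP; rewrite eq_le x0 andbT leNgt; apply/negP => xp.
have d0 : 0 < `|c| + 1 by rewrite ltr_wpDl.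
have x2 : 0 < x / 2 by lra.
have := H (x / 2 / (`|c| + 1)) (divr_gt0 x2 d0).
apply/negP; rewrite -ltNge.
apply: (@le_lt_trans _ _ (x / 2)); last by lra.
rewrite mulrA ler_pdivrMr// mulrC ler_pM2l//.
by rewrite (le_trans (ler_norm c))// lerDl.
Qed.

(** The common pattern of the following identities: an additive relation between exact integrals of
    arbitrarily good approximants passes to the limit. Two lists of radii allow for a change of
    torus; taking g = 0 gives plain equalities. *)
Lemma mint_eqP rs rs' f g h : all (fun x : R => 0 < x) rs -> all (fun x : R => 0 < x) rs' ->
  good (torus rs) f -> good (torus rs) g -> good (torus rs') h ->
  (forall e : R, 0 < e -> exists P, exists Q, exists S,
     [/\ forall z, torus rs z -> normc (f z - leval P z) <= e,
         forall z, torus rs z -> normc (g z - leval Q z) <= e,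
         forall z, torus rs' z -> normc (h z - leval S z) <= e &
         lres (size rs) P + lres (size rs) Q = lres (size rs') S]) ->
  mint rs f + mint rs g = mint rs' h.
Proof.
move=> rs0 rs0' gf gg gh H; apply/eqP; rewrite -subr_eq0 -normc_eq0; apply/eqP.
apply: (@small_eq0 _ (mconst rs + mconst rs + mconst rs')); first exact: normc_ge0.
move=> e e0; have [P [Q [S [HP HQ HS E]]]] := H _ e0.
have -> : mint rs f + mint rs g - mint rs' h =
  (mint rs f - lres (size rs) P) + (mint rs g - lres (size rs) Q)
  + - (mint rs' h - lres (size rs') S) by rewrite -E; ring.
rewrite !mulrDl.
apply: le_trans (le_normcD _ _) _; rewrite normcN lerD ?mint_approx//.
by apply: le_trans (le_normcD _ _) _; rewrite lerD ?mint_approx.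
Qed.

Lemma good0 rs : all (fun x : R => 0 < x) rs -> good (torus rs) (fun=> 0).
Proof. by move=> rs0; apply: good_cst => z; exact: torus_neq0. Qed.

Lemma lres_nil m : lres m [::] = 0 :> C.
Proof. by rewrite /lres big_nil. Qed.

Lemma mint0 rs : all (fun x : R => 0 < x) rs -> mint rs (fun=> 0) = 0 :> C.
Proof.
move=> rs0; apply/eqP; rewrite -normc_eq0 eq_le normc_ge0 andbT.
have := @mint_approx _ rs rs0 _ (good0 rs0) [::] 0.
rewrite mulr0 lres_nil subr0; apply => z _.
by rewrite /leval big_nil subrr normc0.
Qed.

Lemma mint_bound rs f (B : R) : all (fun x : R => 0 < x) rs -> good (torus rs) f ->
  (forall z, torus rs z -> normc (f z) <= B) -> normc (mint rs f) <= mconst rs * B.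
Proof.
move=> rs0 gf fB; have := @mint_approx _ rs rs0 _ gf [::] B.
rewrite lres_nil subr0; apply => z zrs.
by rewrite /leval big_nil subr0 fB.
Qed.

(** The same P approximates f on both tori, and [lres] of P does not see the radii. *)
Lemma mint_radius rs rs' f : size rs = size rs' ->
  all (fun x : R => 0 < x) rs -> all (fun x : R => 0 < x) rs' ->
  good (fun z => torus rs z \/ torus rs' z) f -> mint rs f = mint rs' f.
Proof.
move=> srs rs0 rs0' gf; rewrite -[LHS]addr0 -(mint0 rs0).
have g1 : good (torus rs) f by apply: good_sub gf => z; left.
have g2 : good (torus rs') f by apply: good_sub gf => z; right.
apply: mint_eqP => //; first exact: good0.
move=> e e0; have [_ _ /(_ e e0)[P HP]] := gf.
exists P, [::], P; split.
- by move=> z zrs; apply: HP; left.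
- by move=> z zrs; rewrite /leval big_nil subrr normc0 ltW.
- by move=> z zrs; apply: HP; right.
- by rewrite lres_nil addr0 srs.
Qed.

Lemma mint_ext rs f g : all (fun x : R => 0 < x) rs -> good (torus rs) f ->
  (forall z, torus rs z -> f z = g z) -> mint rs f = mint rs g.
Proof.
move=> rs0 gf fg; have gg := good_ext fg gf.
rewrite -[LHS]addr0 -(mint0 rs0); apply: mint_eqP => //; first exact: good0.
move=> e e0; have [_ _ /(_ e e0)[P HP]] := gf.
exists P, [::], P; split => //.
- by move=> z zrs; rewrite /leval big_nil subrr normc0 ltW.
- by move=> z zrs; rewrite -fg//; apply: HP.
- by rewrite lres_nil addr0.
Qed.

Lemma mintD rs f g : all (fun x : R => 0 < x) rs -> good (torus rs) f -> good (torus rs) g ->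
  mint rs (fun z => f z + g z) = mint rs f + mint rs g.
Proof.
move=> rs0 gf gg; apply/esym; apply: mint_eqP => //; first exact: goodD.
move=> e e0; have e20 : 0 < e / 2 by rewrite divr_gt0.
have e2 : e / 2 <= e by lra.
have [_ _ /(_ _ e20)[P HP]] := gf; have [_ _ /(_ _ e20)[Q HQ]] := gg.
exists P, Q, (P ++ Q); split.
- by move=> z /HP /le_trans; apply.
- by move=> z /HQ /le_trans; apply.
- move=> z zrs; rewrite /leval big_cat /= opprD addrACA.
  apply: le_trans (le_normcD _ _) _; rewrite [leRHS](splitr e).
  by rewrite lerD ?HP ?HQ.
- by rewrite /lres big_cat.
Qed.

Lemma mintZ rs c f : all (fun x : R => 0 < x) rs -> good (torus rs) f ->
  mint rs (fun z => c * f z) = c * mint rs f.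
Proof.
move=> rs0 gf; apply/eqP; rewrite -subr_eq0 -normc_eq0; apply/eqP.
apply: (@small_eq0 _ (mconst rs * normc c + normc c * mconst rs)); first exact: normc_ge0.
move=> e e0; have [_ _ /(_ _ e0)[P HP]] := gf.
pose Q : seq (C * (nat -> int)) := [seq (c * t.1, t.2) | t <- P].
have E1 z : leval Q z = c * leval P z.
  by rewrite /leval big_map mulr_sumr; apply: eq_bigr => t _; rewrite mulrA.
have E2 : lres (size rs) Q = c * lres (size rs) P.
  by rewrite /lres big_map mulr_sumr; apply: eq_bigr => t _; rewrite mulrA.
have -> : mint rs (fun z => c * f z) - c * mint rs f =
  (mint rs (fun z => c * f z) - lres (size rs) Q)
    + - (c * (mint rs f - lres (size rs) P)) by rewrite E2; ring.
apply: le_trans (le_normcD _ _) _; rewrite normcN normcM mulrDl lerD//.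
  rewrite -mulrA; apply: mint_approx => //; first exact: goodZ.
  by move=> z zrs; rewrite E1 -mulrBr normcM ler_wpM2l ?normc_ge0// HP.
by rewrite -mulrA ler_wpM2l ?normc_ge0// mint_approx.
Qed.

Lemma mint_sum rs (I : eqType) (s : seq I) (F : I -> seq C -> C) :
  all (fun x : R => 0 < x) rs -> {in s, forall i, good (torus rs) (F i)} ->
  mint rs (fun z => \sum_(i <- s) F i z) = \sum_(i <- s) mint rs (F i).
Proof.
move=> rs0; elim: s => [_|i s IH Fg].
  rewrite big_nil -[RHS](mint0 rs0); apply/esym/mint_ext => //; first exact: good0.
  by move=> z _; rewrite big_nil.
have gi : good (torus rs) (F i) by apply: Fg; rewrite inE eqxx.
have Fs : {in s, forall i, good (torus rs) (F i)}.
  by move=> j js; apply: Fg; rewrite inE js orbT.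
have gs : good (torus rs) (fun z => \sum_(j <- s) F j z).
  by apply: good_sum => // z; exact: torus_neq0.
rewrite big_cons -IH// -mintD//; apply/esym/mint_ext => //; first exact: goodD.
by move=> z _; rewrite big_cons.
Qed.

Lemma mono_eq (k l : nat -> int) (z : seq C) :
  (forall j, (j < size z)%N -> k j = l j) -> mono k z = mono l z.
Proof.
elim: z k l => //= x z IH k l kl; rewrite kl//; congr (_ * _).
by apply: IH => j jz; apply: kl.
Qed.

Lemma mono_rcons k x (z : seq C) :
  mono k (rcons z x) = mono k z * x ^ (k (size z)).
Proof.
elim: z k => [|y z IH] k /=; first by rewrite mulr1 mul1r.
by rewrite IH mulrA.
Qed.

(** This takes the place of Fubini. Rotating the exponents of an approximant does not change its
    [lres], and by the invariance of f the rotated polynomial approximates f on the rotated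
    torus. *)
Lemma mint_rcons r rs f : 0 < r -> all (fun x : R => 0 < x) rs ->
  good (torus (r :: rs)) f -> (forall x w, f (rcons w x) = f (x :: w)) ->
  mint (r :: rs) f = mint (rcons rs r) f.
Proof.
move=> r0 rs0 gf fsym.
have rs1 : all (fun x : R => 0 < x) (r :: rs) by rewrite /= r0.
have rs2 : all (fun x : R => 0 < x) (rcons rs r) by rewrite all_rcons r0.
pose rot (P : seq (C * (nat -> int))) : seq (C * (nat -> int)) :=
  [seq (t.1, fun j => if j == size rs then t.2 0%N else t.2 j.+1) | t <- P].
have Erot P x w : size w = size rs -> leval (rot P) (rcons w x) = leval P (x :: w).
  move=> sw; rewrite /leval big_map; apply: eq_bigr => t _ /=; congr (_ * _).
  rewrite mono_rcons sw eqxx mulrC; congr (_ * _); apply: mono_eq => j.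
  by rewrite sw => /ltn_eqF ->.
have Eres P : lres (size (r :: rs)) P = lres (size (rcons rs r)) (rot P).
  rewrite size_rcons /lres big_map; apply: eq_bigr => t _ /=; congr (_ * _).
  rewrite big_ord_recl big_ord_recr /= eqxx mulrC; congr (_ * _).
  by apply: eq_bigr => j _; rewrite /bump /= add1n ltn_eqF.
have Drot z : torus (rcons rs r) z ->
  exists x w, [/\ z = rcons w x, size w = size rs & torus (r :: rs) (x :: w)].
  case/lastP: z => [|w x]; first by case: (rs).
  rewrite /torus map_rcons => /rcons_inj[<- <-].
  by exists x, w; rewrite size_map.
have gf' : good (torus (rcons rs r)) f.
  have [D0 [B fB] fP] := gf; split.
  - by move=> z; exact: torus_neq0.
  - by exists B => z /Drot[x [w [-> sw Dxw]]]; rewrite fsym fB.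
  - move=> e /fP[P HP]; exists (rot P) => z /Drot[x [w [-> sw Dxw]]].
    by rewrite fsym Erot// HP.
rewrite -[LHS]addr0 -(mint0 rs1); apply: mint_eqP => //; first exact: good0.
move=> e e0; have [_ _ /(_ e e0)[P HP]] := gf.
exists P, [::], (rot P); split => //.
- by move=> z zrs; rewrite /leval big_nil subrr normc0 ltW.
- by move=> z /Drot[x [w [-> sw Dxw]]]; rewrite fsym Erot// HP.
- by rewrite lres_nil addr0.
Qed.

Lemma circle_ext r (F G : C -> C) : 0 < r ->
  (forall z, normc z = r -> F z = G z) -> circle_integral r F = circle_integral r G.
Proof.
move=> r0 FG; rewrite /circle_integral /cintegral.
have E t : F (r%:C * cis t) = G (r%:C * cis t) by apply: FG; exact: normc_circle.
by congr (_ +i* _); apply: eq_Rintegral => t _; rewrite circle_point E.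
Qed.

Lemma circle_mint r (F : C -> C) :
  circle_integral r F = mint [:: r] (fun z => F (head 0 z)).
Proof. by []. Qed.

Lemma mint_factor r rs (k : C -> C) g : 0 < r -> all (fun x : R => 0 < x) rs ->
  good (torus [:: r]) (fun z => k (head 0 z)) -> good (torus rs) g ->
  mint (r :: rs) (fun z => k (head 0 z) * g (behead z)) =
  circle_integral r k * mint rs g.
Proof.
move=> r0 rs0 gk gg; have r1 : all (fun x : R => 0 < x) [:: r] by rewrite /= r0.
have -> : circle_integral r k * mint rs g =
  mint [:: r] (fun z => mint rs g * k (head 0 z)) by rewrite mintZ// mulrC.
apply: circle_ext => // z zr; change (mint rs (fun w => k z * g w) = mint rs g * k z).
by rewrite mintZ// mulrC.
Qed.

End IteratedIntegralTheory.

(** * Moving one variable across simple poles *)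

Section SimplePole.
Local Open Scope classical_set_scope.
Local Open Scope ring_scope.
Local Open Scope complex_scope.
Variable R : realType.
Local Notation C := R[i].
Implicit Types (D : seq C -> Prop) (f g : seq C -> C) (rs : seq R).

Lemma good_subV D f g (th : R) : th < 1 -> good D f -> good D g ->
  good D (fun z => (f z)^-1) -> (forall z, D z -> f z != 0) ->
  (forall z, D z -> normc (g z) <= th * normc (f z)) ->
  good D (fun z => (f z - g z)^-1).
Proof.
move=> th1 gf gg gV f0 gth.
apply: (@good_ext _ _ (fun z => (f z)^-1 * (1 - g z * (f z)^-1)^-1)).
  by move=> z Dz; rewrite -invfM [X in X^-1]mulrC mulrBl mul1r mulfVK ?f0.
apply: goodM => //; apply: (@good_geom _ _ _ th) => //; first exact: goodM.
by move=> z Dz; rewrite normcM normcV ler_pdivrMr ?gth// normc_gt0 f0.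
Qed.

(** With chi inside, the expansion is in powers of chi / x; with chi outside, in the next lemma, it
    is in powers of x / chi. *)
Lemma good_sub_cst_in D j (chi : C) (r : R) : (forall z, D z -> 0 \notin z) ->
  (forall z, D z -> (j < size z)%N) -> (exists B, forall z, D z -> normc (nth 0 z j) <= B) ->
  normc chi < r -> (forall z, D z -> r <= normc (nth 0 z j)) ->
  good D (fun z => (nth 0 z j - chi)^-1).
Proof.
move=> D0 Dj [B DB] chir Dr.
have r0 : 0 < r by apply: le_lt_trans chir; exact: normc_ge0.
have gz := good_coord D0 Dj DB.
apply: (@good_subV _ _ _ (normc chi / r)) => //.
- by rewrite ltr_pdivrMr// mul1r.
- exact: good_cst.
- exact: (good_coordV r0).
- by move=> z Dz; rewrite nth_neq0 ?D0 ?Dj.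
- move=> z Dz; rewrite mulrAC ler_pdivlMr// ler_wpM2l ?normc_ge0//.
  exact: Dr.
Qed.

Lemma good_sub_cst_out D j (chi : C) (r : R) : (forall z, D z -> 0 \notin z) ->
  (forall z, D z -> (j < size z)%N) ->
  r < normc chi -> (forall z, D z -> normc (nth 0 z j) <= r) ->
  good D (fun z => (nth 0 z j - chi)^-1).
Proof.
move=> D0 Dj chir Dr.
have [r0|rn] := leP 0 r; last first.
  have E z : D z -> False.
    by move=> /Dr h; have := le_lt_trans (le_trans (normc_ge0 _) h) rn; rewrite ltxx.
  by split => // [|e _]; [exists 0|exists [::]] => z /E.
have chi0 : 0 < normc chi by apply: le_lt_trans chir.
have gz := good_coord D0 Dj Dr.
apply: (@good_ext _ _ (fun z => - (chi - nth 0 z j)^-1)).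
  by move=> z Dz; rewrite -invrN opprB.
apply: goodN; apply: (@good_subV _ (fun=> chi) _ (r / normc chi)) => //.
- by rewrite ltr_pdivrMr// mul1r.
- exact: good_cst.
- exact: good_cst.
- by move=> z Dz; rewrite -normc_gt0.
- by move=> z Dz; rewrite mulfVK ?gt_eqF// Dr.
Qed.

Lemma torus1 (r : R) z : torus [:: r] z -> exists2 x, z = [:: x] & normc x = r.
Proof. by case: z => [|x [|y w]] //= -[xr]; exists x. Qed.

Lemma good_simple_pole (r : R) (chi : C) : 0 < r -> normc chi != r ->
  good (torus [:: r]) (fun z => (head 0 z - chi)^-1).
Proof.
move=> r0 chir.
have D0 z : torus [:: r] z -> 0 \notin z by apply: torus_neq0; rewrite /= r0.
have Dj z : torus [:: r] z -> (0 < size z)%N by move=> /torus1[x ->].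
have Dr z : torus [:: r] z -> normc (nth 0 z 0) = r by move=> /torus1[x ->].
apply: (@good_ext _ _ (fun z => (nth 0 z 0 - chi)^-1)).
  by move=> z _; rewrite nth0.
have [h|h|h] := ltgtP (normc chi) r; last by rewrite h eqxx in chir.
- apply: (@good_sub_cst_in _ _ _ r) => //; last by move=> z /Dr ->.
  by exists r => z /Dr ->.
- by apply: (@good_sub_cst_out _ _ _ r) => // z /Dr ->.
Qed.

(** The circle can shrink to any radius s <= r, where the integral is at most 4 pi s / (|chi| -
    r). *)
Lemma circle_outer_pole (r : R) (chi : C) : 0 < r -> r < normc chi ->
  circle_integral r (fun x => (x - chi)^-1) = 0.
Proof.
move=> r0 chir; apply/eqP; rewrite -normc_eq0; apply/eqP.
apply: (@small_eq0 _ _ (4 * pi / (normc chi - r))); first exact: normc_ge0.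
move=> e e0.
pose s := Num.min r e.
have s0 : 0 < s by rewrite lt_min r0.
have sr : s <= r by rewrite ge_min lexx.
have se : s <= e by rewrite ge_min lexx orbT.
pose f := fun z : seq C => (head 0 z - chi)^-1.
have D0 z : torus [:: r] z \/ torus [:: s] z -> 0 \notin z.
  by case; apply: torus_neq0; rewrite /= ?r0 ?s0.
have gf : good (fun z => torus [:: r] z \/ torus [:: s] z) f.
  apply: (@good_ext _ _ (fun z => (nth 0 z 0 - chi)^-1)).
    by move=> z _; rewrite /f nth0.
  apply: (@good_sub_cst_out _ _ _ r) => //.
    by move=> z [] /torus1[x ->].
  by move=> z [] /torus1[x -> /= ->].
rewrite (circle_mint r) (@mint_radius _ [:: r] [:: s])//= ?r0 ?s0//.
have -> : 4 * pi / (normc chi - r) * e = 4 * pi * e * (normc chi - r)^-1 by ring.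
have := @mint_bound _ [:: s] f (normc chi - r)^-1.
rewrite /mconst big_seq1 /= s0 => /(_ isT) H; apply: le_trans (H _ _) _.
- by apply: good_sub gf => z; right.
- move=> z /torus1[x -> xs]; rewrite /f /= normcV lef_pV2 ?posrE ?subr_gt0//.
    rewrite normcB_sym; apply: le_trans (ler_normcB _ _).
    by rewrite lerD2l lerN2 xs.
  apply: (@lt_le_trans _ _ (normc chi - r)); first by rewrite subr_gt0.
  rewrite normcB_sym; apply: le_trans (ler_normcB _ _).
  by rewrite lerD2l lerN2 xs.
- rewrite ler_wpM2r ?invr_ge0 ?subr_ge0 ?(ltW chir)//.
  by rewrite ler_wpM2l// mulr_ge0 ?pi_ge0.
Qed.

(** The circle can grow to any radius s, where the integrand differs from 1/x by at most |chi| / (s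
    (s - |chi|)); the integral of 1/x is exactly 2 pi i. *)
Lemma circle_inner_pole (r : R) (chi : C) : normc chi < r ->
  circle_integral r (fun x => (x - chi)^-1) = (2 * pi)%:C * 'i.
Proof.
move=> chir; have r0 : 0 < r by apply: le_lt_trans chir; exact: normc_ge0.
apply/eqP; rewrite -subr_eq0 -normc_eq0; apply/eqP.
apply: (@small_eq0 _ _ (4 * pi * normc chi)); first exact: normc_ge0.
move=> e e0.
(* Chosen so that 1 / (s - |chi|) <= e. *)
pose s := Num.max r (normc chi + e^-1).
have rs : r <= s by rewrite le_max lexx.
have s0 : 0 < s by apply: lt_le_trans rs.
have chis : normc chi < s by apply: lt_le_trans rs.
have se : e^-1 <= s - normc chi by rewrite lerBrDl le_max lexx orbT.
pose f := fun z : seq C => (head 0 z - chi)^-1.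
have D0 z : torus [:: r] z \/ torus [:: s] z -> 0 \notin z.
  by case; apply: torus_neq0; rewrite /= ?r0 ?s0.
have gf : good (fun z => torus [:: r] z \/ torus [:: s] z) f.
  apply: (@good_ext _ _ (fun z => (nth 0 z 0 - chi)^-1)).
    by move=> z _; rewrite /f nth0.
  apply: (@good_sub_cst_in _ _ _ r) => //.
  - by move=> z [] /torus1[x ->].
  - by exists s => z [] /torus1[x -> /= ->].
  - by move=> z [] /torus1[x -> /= ->].
rewrite (circle_mint r) (@mint_radius _ [:: r] [:: s])//= ?r0 ?s0//.
have := @mint_approx _ [:: s] _ f _ [:: (1, fun=> -1)] (normc chi * e / s).
rewrite /lres big_seq1 /= big_ord_recl big_ord0 mul1r mulr1 s0.
rewrite /mconst big_seq1 => /(_ isT) H; apply: le_trans (H _ _) _.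
- by apply: good_sub gf => z; right.
- move=> z /torus1[x -> xs]; rewrite /f /leval big_seq1 /= mul1r mulr1 exprN1.
  have x0 : x != 0 by rewrite -normc_gt0 xs.
  have d0 : s - normc chi <= normc (x - chi) by rewrite -{1}xs ler_normcB.
  have d1 : 0 < normc (x - chi) by apply: lt_le_trans d0; rewrite subr_gt0.
  have d2 : x - chi != 0 by rewrite -normc_gt0.
  have -> : (x - chi)^-1 - x^-1 = chi * (x - chi)^-1 / x by field; rewrite d2 x0.
  rewrite !normcM !normcV xs ler_pM2r ?invr_gt0// ler_wpM2l ?normc_ge0//.
  by rewrite -[e]invrK lef_pV2 ?posrE ?invr_gt0// (le_trans se).
- have -> : 4 * pi * s * (normc chi * e / s) = 4 * pi * normc chi * e.
    by field; rewrite gt_eqF.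
  by [].
Qed.

End SimplePole.

(** * Products of one-body factors and pair kernels *)

Section Body.
Local Open Scope classical_set_scope.
Local Open Scope ring_scope.
Local Open Scope complex_scope.
Variable R : realType.
Local Notation C := R[i].
Variables q1 q2 : C.
Implicit Types (D : seq C -> Prop) (f g : seq C -> C) (rs : seq R).

Definition kap (z w : C) : C :=
  ((z - w) * (z - q1 * q2 * w) * ((w - z) * (w - q1 * q2 * z))) /
  (((z - q1 * w) * (z - q2 * w)) * ((w - q1 * z) * (w - q2 * z))).

Lemma kapC z w : kap z w = kap w z.
Proof. by rewrite /kap [X in X / _]mulrC [X in _ / X]mulrC. Qed.

Fixpoint body (phi : C -> C) (z : seq C) : C :=
  match z with
  | [::] => 1
  | x :: w => phi x * (\prod_(y <- w) kap x y) * body phi w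
  end.

Lemma body_mul (phi k : C -> C) z :
  body (fun x => phi x * k x) z = (\prod_(y <- z) k y) * body phi z.
Proof.
elim: z => [|x w IH] /=; first by rewrite big_nil mulr1.
by rewrite IH big_cons; ring.
Qed.

Lemma body_rcons phi w x : body phi (rcons w x) = body phi (x :: w).
Proof.
elim: w => [|y w IH] //=.
rewrite IH /= big_rcons big_cons /= (kapC x y).
by set P1 := \prod_(_ <- w) kap y _; ring.
Qed.

Lemma prod_drop (F : C -> C) k (z : seq C) :
  \prod_(y <- drop k z) F y = \prod_(k <= j < size z) F (nth 0 z j).
Proof.
rewrite (big_nth 0) size_drop -[in RHS](add0n k) big_addn.
by apply: eq_bigr => j _; rewrite nth_drop addnC.
Qed.

(** Stated for [drop k z] so that the induction can peel off variables while the domain D of full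
    lists stays fixed. *)
Lemma good_body_drop D m (phi : C -> C) k : (forall z, D z -> 0 \notin z) ->
  (forall z, D z -> size z = m) ->
  (forall j, (k <= j < m)%N -> good D (fun z => phi (nth 0 z j))) ->
  (forall i j, (k <= i < j)%N -> (j < m)%N ->
     good D (fun z => kap (nth 0 z i) (nth 0 z j))) ->
  good D (fun z => body phi (drop k z)).
Proof.
move=> D0 Dm Hphi Hkap.
have [d] := ubnP (m - k); elim: d k Hphi Hkap => // d IH k Hphi Hkap.
rewrite ltnS => dk; have [mk|km] := leqP m k.
  apply: good_ext (good_cst 1 D0) => z Dz.
  by rewrite drop_oversize ?Dm.
apply: (@good_ext _ _ (fun z => phi (nth 0 z k) *
  (\prod_(j <- index_iota k.+1 m) kap (nth 0 z k) (nth 0 z j)) * body phi (drop k.+1 z))).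
  move=> z Dz; have kz : (k < size z)%N by rewrite Dm.
  by rewrite [in RHS](drop_nth 0 kz) /= prod_drop Dm.
apply: goodM; first apply: goodM.
- by apply: Hphi; rewrite leqnn.
- apply: good_prod => // j; rewrite mem_index_iota => /andP[kj jm] _.
  by apply: Hkap => //; rewrite leqnn.
- apply: IH.
  + by move=> j /andP[kj jm]; apply: Hphi; rewrite (ltnW kj).
  + by move=> i j /andP[ki ij] jm; apply: Hkap => //; rewrite (ltnW ki).
  + by apply: leq_trans dk; rewrite ltn_sub2l.
Qed.

(** The kernel is homogeneous of degree 0, hence a function of t = z_j / z_i and s = 1 / t. The
    bounds in both directions make q_i t and q_i s at most [th] in modulus, so all four denominators
    are geometric series. *)
Lemma good_kap D i j (th : R) : q1 != 0 -> th < 1 ->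
  (forall z, D z -> 0 \notin z) ->
  (forall z, D z -> (i < size z)%N /\ (j < size z)%N) ->
  (forall z, D z ->
     [/\ normc q1 * normc (nth 0 z i) <= th * normc (nth 0 z j),
         normc q1 * normc (nth 0 z j) <= th * normc (nth 0 z i),
         normc q2 * normc (nth 0 z i) <= th * normc (nth 0 z j) &
         normc q2 * normc (nth 0 z j) <= th * normc (nth 0 z i)]) ->
  good D (fun z => kap (nth 0 z i) (nth 0 z j)).
Proof.
move=> q10 th1 D0 Dij Dq.
have Dji z : D z -> (j < size z)%N /\ (i < size z)%N by move=> /Dij[].
have nq1 : 0 < normc q1 by rewrite normc_gt0.
pose t (z : seq C) := nth 0 z j / nth 0 z i.
pose s (z : seq C) := nth 0 z i / nth 0 z j.
have gt_ : good D t.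
  apply: (@good_ratio _ _ _ _ (th / normc q1)) => // z /Dq[_ h _ _].
  by rewrite mulrAC ler_pdivlMr// mulrC.
have gs : good D s.
  apply: (@good_ratio _ _ _ _ (th / normc q1)) => // z /Dq[h _ _ _].
  by rewrite mulrAC ler_pdivlMr// mulrC.
have nz z : D z -> nth 0 z i != 0 /\ nth 0 z j != 0.
  by move=> Dz; have [a b] := Dij _ Dz; rewrite !nth_neq0 ?D0.
have bt q z : D z -> normc q * normc (nth 0 z j) <= th * normc (nth 0 z i) ->
   normc (q * t z) <= th.
  move=> Dz h; have [a b] := nz _ Dz.
  by rewrite /t !normcM normcV mulrA ler_pdivrMr ?normc_gt0.
have bs q z : D z -> normc q * normc (nth 0 z i) <= th * normc (nth 0 z j) ->
   normc (q * s z) <= th.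
  move=> Dz h; have [a b] := nz _ Dz.
  by rewrite /s !normcM normcV mulrA ler_pdivrMr ?normc_gt0.
have inv1 x : normc x <= th -> 1 - x != 0 :> C.
  move=> h; rewrite -normc_gt0; apply: lt_le_trans (ler_normcB _ _).
  by rewrite normc1 subr_gt0 (le_lt_trans h).
have g1 := good_cst 1 D0.
(* Numerator and denominator are divided by z_i^4, and 1 / (t - q_i) is rewritten as s / (1 - q_i
   s). *)
apply: (@good_ext _ _ (fun z => - ((1 - t z) ^+ 2 * (1 - q1 * q2 * t z) * (t z - q1 * q2))
  * ((1 - q1 * t z)^-1 * (1 - q2 * t z)^-1 *
    ((s z * (1 - q1 * s z)^-1) * (s z * (1 - q2 * s z)^-1))))).
  move=> z Dz; have [a b] := nz _ Dz; have [c1 c2 c3 c4] := Dq _ Dz.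
  have := inv1 _ (bt _ _ Dz c2); have := inv1 _ (bt _ _ Dz c4).
  have := inv1 _ (bs _ _ Dz c1); have := inv1 _ (bs _ _ Dz c3).
  rewrite /t /s /kap; set x := nth 0 z i in a *; set y := nth 0 z j in b *.
  move=> h1 h2 h3 h4.
  have e1 : y - q2 * x != 0.
    have -> : y - q2 * x = y * (1 - q2 * (x / y)) by field.
    by rewrite mulf_neq0.
  have e2 : y - q1 * x != 0.
    have -> : y - q1 * x = y * (1 - q1 * (x / y)) by field.
    by rewrite mulf_neq0.
  have e3 : x - q2 * y != 0.
    have -> : x - q2 * y = x * (1 - q2 * (y / x)) by field.
    by rewrite mulf_neq0.
  have e4 : x - q1 * y != 0.
    have -> : x - q1 * y = x * (1 - q1 * (y / x)) by field.
    by rewrite mulf_neq0.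
  by field; rewrite ?a ?b ?e1 ?e2 ?e3 ?e4.
have gq1t : good D (fun z => (1 - q1 * t z)^-1).
  by apply: (@good_geom _ _ _ th) => //; [exact: goodZ|move=> z Dz; have [] := Dq _ Dz; auto].
have gq2t : good D (fun z => (1 - q2 * t z)^-1).
  by apply: (@good_geom _ _ _ th) => //; [exact: goodZ|move=> z Dz; have [] := Dq _ Dz; auto].
have gq1s : good D (fun z => (1 - q1 * s z)^-1).
  by apply: (@good_geom _ _ _ th) => //; [exact: goodZ|move=> z Dz; have [] := Dq _ Dz; auto].
have gq2s : good D (fun z => (1 - q2 * s z)^-1).
  by apply: (@good_geom _ _ _ th) => //; [exact: goodZ|move=> z Dz; have [] := Dq _ Dz; auto].
apply: goodM.
  apply: goodN; apply: goodM; first apply: goodM.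
  - by apply: goodX; exact: goodB.
  - by apply: goodB => //; exact: goodZ.
  - by apply: goodB => //; exact: good_cst.
by apply: goodM; apply: goodM => //; apply: goodM.
Qed.

End Body.

(** * Divided differences and the crossing formula *)

Section Crossing.
Local Open Scope classical_set_scope.
Local Open Scope ring_scope.
Local Open Scope complex_scope.
Variable R : realType.
Local Notation C := R[i].
Implicit Types (D : seq C -> Prop) (f : seq C -> C) (g : C -> seq C -> C) (rs : seq R).

(** Quantifying over all domains and coordinates lets a statement about one variable be used for
    each variable of every torus. *)
Definition good1 (A : C -> Prop) (phi : C -> C) : Prop :=
  forall D j, (forall z, D z -> 0 \notin z) -> (forall z, D z -> (j < size z)%N) ->
    (forall z, D z -> A (nth 0 z j)) -> good D (fun z => phi (nth 0 z j)).

(** The argument x of g stands for the head of z; keeping it separate allows chi to be substituted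
    for it while the other coordinates stay as they are. The function h is the divided difference in
    x, and its goodness says that dividing by x - chi creates no pole. *)
Definition divdiff D (chi : C) (g : C -> seq C -> C) : Prop :=
  [/\ good D (fun z => g (head 0 z) z), good D (g chi) &
      exists2 h, good D h & forall z, D z ->
        g (head 0 z) z - g chi z = (head 0 z - chi) * h z].

Lemma divdiff_var D chi : (forall z, D z -> 0 \notin z) ->
  good D (head 0) -> divdiff D chi (fun x _ => x).
Proof.
move=> D0 gh; split => //; first exact: good_cst.
by exists (fun=> 1); [exact: good_cst|move=> z _; rewrite mulr1].
Qed.

Lemma divdiff_par D chi f : good D f -> divdiff D chi (fun _ z => f z).
Proof.
move=> gf; have [D0 _ _] := gf; split => //.
by exists (fun=> 0); [exact: good_cst|move=> z _; rewrite mulr0 subrr].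
Qed.

Lemma divdiffM D chi g g' : divdiff D chi g -> divdiff D chi g' ->
  divdiff D chi (fun x z => g x z * g' x z).
Proof.
move=> [g1 g2 [h gh hE]] [g1' g2' [h' gh' hE']]; split; try exact: goodM.
exists (fun z => g (head 0 z) z * h' z + g' chi z * h z).
  by apply: goodD; exact: goodM.
move=> z Dz; have -> : g (head 0 z) z * g' (head 0 z) z - g chi z * g' chi z =
  g (head 0 z) z * (g' (head 0 z) z - g' chi z)
    + g' chi z * (g (head 0 z) z - g chi z) by ring.
by rewrite hE// hE'//; ring.
Qed.

Lemma divdiffB D chi g g' : divdiff D chi g -> divdiff D chi g' ->
  divdiff D chi (fun x z => g x z - g' x z).
Proof.
move=> [g1 g2 [h gh hE]] [g1' g2' [h' gh' hE']]; split; try exact: goodB.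
exists (fun z => h z - h' z); first exact: goodB.
by move=> z Dz; rewrite mulrBr -hE// -hE'//; ring.
Qed.

Lemma divdiffV D chi g : divdiff D chi g ->
  (forall z, D z -> g (head 0 z) z != 0) -> (forall z, D z -> g chi z != 0) ->
  good D (fun z => (g (head 0 z) z)^-1) -> good D (fun z => (g chi z)^-1) ->
  divdiff D chi (fun x z => (g x z)^-1).
Proof.
move=> [g1 g2 [h gh hE]] n1 n2 v1 v2; split => //.
exists (fun z => - (h z * (g (head 0 z) z)^-1 * (g chi z)^-1)).
  by apply: goodN; apply: goodM => //; exact: goodM.
move=> z Dz; rewrite mulrN !mulrA -hE//; field.
by rewrite n1 ?n2.
Qed.

Lemma divdiff_prod D chi (s : seq nat) (G : nat -> C -> seq C -> C) :
  (forall z, D z -> 0 \notin z) -> {in s, forall i, divdiff D chi (G i)} ->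
  divdiff D chi (fun x z => \prod_(i <- s) G i x z).
Proof.
move=> D0; elim: s => [_|i s IH HG].
  have -> : (fun (x : C) (z : seq C) => \prod_(i <- [::]) G i x z) = (fun _ _ => 1).
    by apply: funext => x; apply: funext => z; rewrite big_nil.
  by apply: divdiff_par; exact: good_cst.
have -> : (fun x z => \prod_(j <- i :: s) G j x z) =
  (fun x z => G i x z * \prod_(j <- s) G j x z).
  by apply: funext => x; apply: funext => z; rewrite big_cons.
apply: divdiffM; first by apply: HG; rewrite inE eqxx.
by apply: IH => j js; apply: HG; rewrite inE js orbT.
Qed.

Variables q1 q2 : C.
Hypothesis q1_neq0 : q1 != 0.
Variables (r1 r2 th : R).
Hypotheses (r1_gt0 : 0 < r1) (r12 : r1 < r2) (th1 : th < 1).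
Hypotheses (hq1 : normc q1 * r2 <= th * r1) (hq2 : normc q2 * r2 <= th * r1).

Let r2_gt0 : 0 < r2.
Proof. exact: lt_trans r12. Qed.

Let th0 : 0 <= th.
Proof. by have := le_trans (mulr_ge0 (normc_ge0 q1) (ltW r2_gt0)) hq1; rewrite pmulr_lge0. Qed.

Lemma ring_bound (q : C) (a b : R) : normc q * r2 <= th * r1 ->
  a <= r2 -> r1 <= b -> normc q * a <= th * b.
Proof.
move=> h ar br; apply: (le_trans (ler_wpM2l (normc_ge0 q) ar)).
by apply: le_trans h _; rewrite ler_wpM2l.
Qed.

Lemma good_kap_ring D i j : (forall z, D z -> 0 \notin z) ->
  (forall z, D z -> (i < size z)%N /\ (j < size z)%N) ->
  (forall z, D z -> r1 <= normc (nth 0 z i) <= r2 /\ r1 <= normc (nth 0 z j) <= r2) ->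
  good D (fun z => kap q1 q2 (nth 0 z i) (nth 0 z j)).
Proof.
move=> D0 Dij Dr; apply: (@good_kap _ _ _ _ _ _ th) => // z /Dr[/andP[a b] /andP[c d]].
by split; apply: ring_bound.
Qed.

(** As functions of x, the poles of the kernel are q_i z_j and z_j / q_i. They stay off the ring
    between r1 and r2 by the ratio [th], uniformly in z_j, so the inverses are good both at the head
    and at chi. *)
Lemma divdiff_kap D chi j : r1 < normc chi < r2 -> (0 < j)%N ->
  (forall z, D z -> 0 \notin z) -> (forall z, D z -> (j < size z)%N) ->
  (forall z, D z -> r1 <= normc (nth 0 z 0) <= r2 /\ r1 <= normc (nth 0 z j) <= r2) ->
  divdiff D chi (fun x z => kap q1 q2 x (nth 0 z j)).
Proof.
move=> /andP[chi1 chi2] j0 D0 Dj Dr.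
have D0' z : D z -> (0 < size z)%N by move=> /Dj; exact: leq_trans.
have g0 : good D (fun z => nth 0 z 0).
  by apply: (@good_coord _ _ _ r2) => // z /Dr[/andP[]].
have gj : good D (fun z => nth 0 z j).
  by apply: (@good_coord _ _ _ r2) => // z /Dr[_ /andP[]].
have v0 : good D (fun z => (nth 0 z 0)^-1).
  by apply: (@good_coordV _ _ _ r1) => // z /Dr[/andP[]].
have vj : good D (fun z => (nth 0 z j)^-1).
  by apply: (@good_coordV _ _ _ r1) => // z /Dr[_ /andP[]].
have gc c := @good_cst _ D c D0.
have nz0 z : D z -> nth 0 z 0 != 0 by move=> Dz; rewrite nth_neq0 ?D0 ?D0'.
have nzj z : D z -> nth 0 z j != 0 by move=> Dz; rewrite nth_neq0 ?D0 ?Dj.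
have ddx : divdiff D chi (fun x _ => x).
  apply: divdiff_var => //; apply: good_ext g0 => z _; exact: nth0.
have ddy : divdiff D chi (fun _ z => nth 0 z j) by exact: divdiff_par.
have ddc c : divdiff D chi (fun _ _ => c) by exact: divdiff_par.
have chi0 : chi != 0 by rewrite -normc_gt0 (lt_trans r1_gt0).
have neq (a b : C) (q : C) : a != 0 -> normc (q * b) <= th * normc a -> a - q * b != 0.
  move=> a0 h; rewrite -normc_gt0; apply: lt_le_trans (ler_normcB _ _).
  rewrite subr_gt0; apply: le_lt_trans h _.
  by rewrite -[ltRHS]mul1r ltr_pM2r// normc_gt0.
have ddin q : normc q * r2 <= th * r1 ->
    divdiff D chi (fun x z => (x - q * nth 0 z j)^-1).
  move=> hq.
  have bx z : D z -> normc (q * nth 0 z j) <= th * normc (nth 0 z 0).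
    by move=> /Dr[/andP[a b] /andP[c d]]; rewrite normcM; apply: ring_bound.
  have bc z : D z -> normc (q * nth 0 z j) <= th * normc chi.
    by move=> /Dr[/andP[a b] /andP[c d]]; rewrite normcM; apply: ring_bound => //; exact: ltW.
  apply: divdiffV.
  - by apply: divdiffB => //; exact: divdiffM.
  - by move=> z Dz; rewrite -nth0 neq ?nz0 ?bx.
  - by move=> z Dz; rewrite neq ?bc.
  - apply: (@good_ext _ _ (fun z => (nth 0 z 0 - q * nth 0 z j)^-1)).
      by move=> z _; rewrite nth0.
    by apply: (@good_subV _ _ _ _ th) => //; exact: goodZ.
  - by apply: (@good_subV _ _ (fun=> chi) _ th) => //; exact: goodZ.
have ddout q : normc q * r2 <= th * r1 ->
    divdiff D chi (fun x z => (nth 0 z j - q * x)^-1).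
  move=> hq.
  have bx z : D z -> normc (q * nth 0 z 0) <= th * normc (nth 0 z j).
    by move=> /Dr[/andP[a b] /andP[c d]]; rewrite normcM; apply: ring_bound.
  have bc z : D z -> normc (q * chi) <= th * normc (nth 0 z j).
    by move=> /Dr[/andP[a b] /andP[c d]]; rewrite normcM; apply: ring_bound => //; exact: ltW.
  apply: divdiffV.
  - by apply: divdiffB => //; exact: divdiffM.
  - by move=> z Dz; rewrite -nth0 neq ?nzj ?bx.
  - by move=> z Dz; rewrite neq ?nzj ?bc.
  - apply: (@good_ext _ _ (fun z => (nth 0 z j - q * nth 0 z 0)^-1)).
      by move=> z _; rewrite nth0.
    by apply: (@good_subV _ _ _ _ th) => //; exact: goodZ.
  - by apply: (@good_subV _ _ _ (fun=> q * chi) th).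
have -> : (fun x z => kap q1 q2 x (nth 0 z j)) = (fun x z =>
  ((x - nth 0 z j) * (x - q1 * q2 * nth 0 z j) *
    ((nth 0 z j - x) * (nth 0 z j - q1 * q2 * x))) *
  (((x - q1 * nth 0 z j)^-1 * (x - q2 * nth 0 z j)^-1) *
    ((nth 0 z j - q1 * x)^-1 * (nth 0 z j - q2 * x)^-1))).
  by apply: funext => x; apply: funext => z; rewrite /kap !invfM.
apply: divdiffM; last by apply: divdiffM; apply: divdiffM; auto.
by apply: divdiffM; apply: divdiffM; apply: divdiffB => //; exact: divdiffM.
Qed.

(** The integrand is phi(x) K(x, w) B(w) with x the moving variable, K the product of its kernels
    and B the body of the tail w. Splitting K(x, w) = K(chi, w) + (x - chi) L in each polar term
    leaves c K(chi, w) B(w) / (x - chi), where x and w are separated and K(chi, w) B(w) is the body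
    for phi times kap(chi, .). All the rest is good on both tori at once. *)
Lemma crossing rs (phi h : C -> C) (I : eqType) (J : seq I) (chi rho : I -> C) :
  {in rs, forall r, r = r1 \/ r = r2} ->
  {in J, forall i, r1 < normc (chi i) < r2} ->
  good1 (fun x => normc x = r1 \/ normc x = r2) h ->
  (forall x, normc x = r1 \/ normc x = r2 ->
     phi x = \sum_(i <- J) rho i / ((2 * pi)%:C * 'i) / (x - chi i) + h x) ->
  good (torus (r1 :: rs)) (body q1 q2 phi) /\
  mint (r2 :: rs) (body q1 q2 phi) = mint (r1 :: rs) (body q1 q2 phi) +
    \sum_(i <- J) rho i * mint rs (body q1 q2 (fun x => phi x * kap q1 q2 (chi i) x)).
Proof.
move=> rsr chiJ gh phiE.
have rs0 : all (fun x : R => 0 < x) rs by apply/allP => r /rsr[]->.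
pose D (z : seq C) := torus (r1 :: rs) z \/ torus (r2 :: rs) z.
have D0 z : D z -> 0 \notin z.
  by case; apply: torus_neq0; rewrite /= ?r1_gt0 ?r2_gt0.
have Dsize z : D z -> size z = (size rs).+1.
  by case=> E; rewrite -(size_map (@normc R)) E.
have Dhead z : D z -> normc (nth 0 z 0) = r1 \/ normc (nth 0 z 0) = r2.
  by case: z => [[]//|x w]; case => -[xr _]; [left|right].
have Dtail z j : D z -> (j < size rs)%N -> normc (nth 0 z j.+1) = nth 0 rs j.
  case: z => [[]//|x w] H jr; have E : [seq normc y | y <- w] = rs by case: H => -[].
  by rewrite -E (nth_map 0)//; rewrite -E size_map in jr.
have rsb j : (j < size rs)%N -> nth 0 rs j = r1 \/ nth 0 rs j = r2.
  by move=> jr; apply: rsr; exact: mem_nth.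
have Dany z j : D z -> (j < (size rs).+1)%N ->
    normc (nth 0 z j) = r1 \/ normc (nth 0 z j) = r2.
  by case: j => [|j] Dz jr; [exact: Dhead|rewrite Dtail//; exact: rsb].
have r12b (x : C) : normc x = r1 \/ normc x = r2 -> r1 <= normc x <= r2.
  by case=> ->; rewrite lexx ?(ltW r12).
have gphi r : r = r1 \/ r = r2 -> good1 (fun x => normc x = r) phi.
  move=> rr E j E0 Ej Er.
  have rr' (x : C) : normc x = r -> normc x = r1 \/ normc x = r2 by move=> ->.
  apply: (@good_ext _ _ (fun z =>
    \sum_(i <- J) rho i / ((2 * pi)%:C * 'i) * (nth 0 z j - chi i)^-1 + h (nth 0 z j))).
    by move=> z Ez; rewrite phiE//; apply: rr'; exact: Er.
  apply: goodD; last by apply: gh => // z Ez; apply: rr'; exact: Er.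
  apply: good_sum => // i /chiJ/andP[c1 c2]; apply: goodZ.
  case: rr => rr.
    by apply: (@good_sub_cst_out _ _ _ _ r1) => // z Ez; rewrite -rr Er.
  apply: (@good_sub_cst_in _ _ _ _ r2) => //; last by move=> z Ez; rewrite -rr Er.
  by exists r2 => z Ez; rewrite -rr Er.
have gkap E i j : (forall z, E z -> D z) -> (i < (size rs).+1)%N -> (j < (size rs).+1)%N ->
    good E (fun z => kap q1 q2 (nth 0 z i) (nth 0 z j)).
  move=> ED ir jr; apply: good_kap_ring => z /ED Dz.
  - exact: D0.
  - by rewrite Dsize.
  - by split; apply: r12b; exact: Dany.
have gtail : good D (fun z => body q1 q2 phi (behead z)).
  apply: (@good_ext _ _ (fun z => body q1 q2 phi (drop 1 z))).
    by move=> z _; rewrite drop1.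
  apply: (@good_body_drop _ _ _ _ (size rs).+1) => //.
  - move=> [//|j] /andP[_ jr].
    apply: (gphi (nth 0 rs j)); first exact: rsb.
    + exact: D0.
    + by move=> z Dz; rewrite Dsize.
    + by move=> z Dz; rewrite Dtail.
  - by move=> i j /andP[_ ij] jr; apply: gkap => //; apply: ltn_trans jr.
have gbody r : r = r1 \/ r = r2 -> good (torus (r :: rs)) (body q1 q2 phi).
  move=> rr; have ED z : torus (r :: rs) z -> D z by case: rr => ->; [left|right].
  apply: (@good_ext _ _ (fun z => body q1 q2 phi (drop 0 z))).
    by move=> z _; rewrite drop0.
  apply: (@good_body_drop _ _ _ _ (size rs).+1) => //.
  - by move=> z /ED/D0.
  - by move=> z /ED/Dsize.
  - move=> j /andP[_ jr]; apply: (gphi (nth 0 (r :: rs) j)).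
    + by case: j jr => [|j] //= jr; exact: rsb.
    + by move=> z /ED/D0.
    + by move=> z /ED Dz; rewrite Dsize.
    + move=> z zr; rewrite -[in RHS]zr (nth_map 0)// Dsize//; exact: ED.
  - by move=> i j /andP[_ ij] jr; apply: gkap => //; apply: ltn_trans jr.
have gbody' i : i \in J ->
    good (torus rs) (body q1 q2 (fun x => phi x * kap q1 q2 (chi i) x)).
  move=> iJ; have /andP[c1 c2] := chiJ i iJ.
  have E0 z : torus rs z -> 0 \notin z by exact: torus_neq0.
  have Es z : torus rs z -> size z = size rs.
    by move=> E; rewrite -(size_map (@normc R)) E.
  have En z j : torus rs z -> (j < size rs)%N -> normc (nth 0 z j) = nth 0 rs j.
    by move=> zr jr; rewrite -[in RHS]zr (nth_map 0)// Es.
  apply: (@good_ext _ _ (fun z => body q1 q2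
     (fun x => phi x * kap q1 q2 (chi i) x) (drop 0 z))).
    by move=> z _; rewrite drop0.
  have Eb z j : torus rs z -> (j < size rs)%N -> r1 <= normc (nth 0 z j) <= r2.
    by move=> zr jr; apply: r12b; rewrite En//; exact: rsb.
  apply: (@good_body_drop _ _ _ _ (size rs)) => //.
  - move=> j /andP[_ jr]; apply: goodM.
      apply: (gphi (nth 0 rs j)); first exact: rsb.
      + exact: E0.
      + by move=> z Ez; rewrite Es.
      + by move=> z Ez; rewrite En.
    have gj : good (torus rs) (fun z => nth 0 z j).
      apply: (@good_coord _ _ _ r2) => // z zr; first by rewrite Es.
      by have /andP[] := Eb z j zr jr.
    have vj : good (torus rs) (fun z => (nth 0 z j)^-1).
      apply: (@good_coordV _ _ _ r1) => // z zr; first by rewrite Es.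
      by have /andP[] := Eb z j zr jr.
    have gc c := @good_cst _ (torus rs) c E0.
    have chi0 : chi i != 0 by rewrite -normc_gt0 (lt_trans r1_gt0).
    have nzj z : torus rs z -> nth 0 z j != 0 by move=> zr; rewrite nth_neq0 ?E0 ?Es.
    have h1 q : normc q * r2 <= th * r1 ->
        good (torus rs) (fun z => (chi i - q * nth 0 z j)^-1).
      move=> hq; apply: (@good_subV _ _ (fun=> chi i) _ th) => //; first exact: goodZ.
      move=> z zr; have /andP[a b] := Eb z j zr jr.
      by rewrite normcM; apply: ring_bound => //; exact: ltW.
    have h2 q : normc q * r2 <= th * r1 ->
        good (torus rs) (fun z => (nth 0 z j - q * chi i)^-1).
      move=> hq; apply: (@good_subV _ _ _ (fun=> q * chi i) th) => //.
      move=> z zr; have /andP[a b] := Eb z j zr jr.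
      by rewrite normcM; apply: ring_bound => //; exact: ltW.
    apply: (@good_ext _ _ (fun z =>
      ((chi i - nth 0 z j) * (chi i - q1 * q2 * nth 0 z j) *
        ((nth 0 z j - chi i) * (nth 0 z j - q1 * q2 * chi i))) *
      (((chi i - q1 * nth 0 z j)^-1 * (chi i - q2 * nth 0 z j)^-1) *
        ((nth 0 z j - q1 * chi i)^-1 * (nth 0 z j - q2 * chi i)^-1)))).
      by move=> z _; rewrite /kap !invfM.
    apply: goodM; last by apply: goodM; apply: goodM; auto.
    by apply: goodM; apply: goodM; apply: goodB => //; exact: goodZ.
  - move=> k l /andP[_ kl] lr; apply: good_kap_ring => //.
    + by move=> z zr; rewrite Es// lr (ltn_trans kl).
    + by move=> z zr; split; apply: Eb => //; apply: ltn_trans lr.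
pose K x (z : seq C) := \prod_(1 <= j < (size rs).+1) kap q1 q2 x (nth 0 z j).
have KE x z : D z -> K x z = \prod_(y <- behead z) kap q1 q2 x y.
  by move=> Dz; rewrite -drop1 prod_drop Dsize.
have ddK i : i \in J -> divdiff D (chi i) K.
  move=> iJ; apply: divdiff_prod => // j; rewrite mem_index_iota => /andP[j0 jr].
  apply: divdiff_kap => //; first exact: chiJ.
  - by move=> z Dz; rewrite Dsize.
  - by move=> z Dz; split; apply: r12b; exact: Dany.
have gK : good D (fun z => K (head 0 z) z).
  apply: good_prod => // j; rewrite mem_index_iota => /andP[j0 jr] _.
  apply: (@good_ext _ _ (fun z => kap q1 q2 (nth 0 z 0) (nth 0 z j))).
    by move=> z _; rewrite nth0.
  exact: gkap.
(* The divided differences, one for each pole, are chosen as a single family. *)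
have [L HL] : exists L : I -> seq C -> C, {in J, forall i, good D (L i) /\
    forall z, D z -> K (head 0 z) z - K (chi i) z = (head 0 z - chi i) * L i z}.
  have H i : exists l, i \in J -> good D l /\
      forall z, D z -> K (head 0 z) z - K (chi i) z = (head 0 z - chi i) * l z.
    have [iJ|_] := boolP (i \in J); last by exists (fun=> 0).
    by have [_ _ [l gl lE]] := ddK i iJ; exists l.
  by exists (fun i => xget (fun=> 0) [set l | i \in J -> good D l /\
      forall z, D z -> K (head 0 z) z - K (chi i) z = (head 0 z - chi i) * l z]) => i iJ;
    have [l Hl] := H i; case: xgetP => [l' _ /= /(_ iJ)//|/(_ l)].
pose c i := rho i / ((2 * pi)%:C * 'i).
pose G i := body q1 q2 (fun x => phi x * kap q1 q2 (chi i) x).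
(* The part without poles between the circles; its integral is the same for r1 and r2. *)
pose H z := h (nth 0 z 0) * K (head 0 z) z * body q1 q2 phi (behead z) +
  \sum_(i <- J) (c i * L i z) * body q1 q2 phi (behead z).
have gH : good D H.
  apply: goodD.
    apply: goodM => //; apply: goodM => //; apply: (gh D 0%N) => // z Dz.
    by rewrite Dsize.
  apply: good_sum => // i iJ; apply: goodM => //; apply: goodZ.
  by have [] := HL i iJ.
have bodyE z : D z -> body q1 q2 phi z = H z +
    \sum_(i <- J) (c i / (head 0 z - chi i)) * G i (behead z).
  move=> Dz; have -> : body q1 q2 phi z = phi (head 0 z) * K (head 0 z) z *
      body q1 q2 phi (behead z).
    by rewrite KE//; case: (z) Dz => [[]|].
  rewrite phiE; last by rewrite -nth0; exact: Dhead.
  rewrite /H -[X in (X + _) * _]/(\sum_(i <- J) c i / (head 0 z - chi i)).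
  move: (c) => d.
  rewrite nth0 !mulrDl addrC -addrA; congr (_ + _).
  rewrite -big_split /= !mulr_suml; rewrite [LHS]big_seq [RHS]big_seq.
  apply: eq_bigr => i iJ; have [_ /(_ z Dz) LE] := HL i iJ.
  rewrite /G body_mul -KE// [X in _ = _ + X]mulrA -mulrDl; congr (_ * _).
  have xchi : head 0 z - chi i != 0.
    rewrite subr_eq0; apply/negP => /eqP xc.
    have := Dhead z Dz; rewrite nth0 xc => -[E|E]; have := chiJ i iJ;
      by rewrite E ltxx ?andbF.
  have -> : L i z = (K (head 0 z) z - K (chi i) z) / (head 0 z - chi i).
    by rewrite LE mulrC mulKf.
  by field.
(* On either circle the polar terms factor into a one-variable integral, which is 0 on r1 and 2 pi i
   c on r2, and an integral over the remaining variables. *)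
have mainE r : r = r1 \/ r = r2 -> mint (r :: rs) (body q1 q2 phi) =
    mint (r :: rs) H + \sum_(i <- J)
      circle_integral r (fun x => c i / (x - chi i)) * mint rs (G i).
  move=> rr.
  have r0 : 0 < r by case: rr => ->.
  have rrs : all (fun x : R => 0 < x) (r :: rs) by rewrite /= r0.
  have ED z : torus (r :: rs) z -> D z by case: rr => ->; [left|right].
  have neqr i : i \in J -> normc (chi i) != r.
    by move=> /chiJ/andP[a b]; case: rr => ->; rewrite ?(gt_eqF a) ?(lt_eqF b).
  have gp i : i \in J -> good (torus [:: r]) (fun z => c i / (head 0 z - chi i)).
    by move=> iJ; apply: goodZ; apply: good_simple_pole => //; exact: neqr.
  have gterm i : i \in J -> good (torus (r :: rs))
      (fun z => (c i / (head 0 z - chi i)) * G i (behead z)).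
    move=> iJ; apply: goodM.
      apply: goodZ; apply: (@good_ext _ _ (fun z => (nth 0 z 0 - chi i)^-1)).
        by move=> z _; rewrite nth0.
      have E0 z : torus (r :: rs) z -> 0 \notin z by exact: torus_neq0.
      have Es z : torus (r :: rs) z -> (0 < size z)%N by case: z.
      have En z : torus (r :: rs) z -> normc (nth 0 z 0) = r.
        by case: z => [//|x w] [].
      have [lt|gt|eq] := ltgtP (normc (chi i)) r.
      - apply: (@good_sub_cst_in _ _ _ _ r) => //; last by move=> z /En ->.
        by exists r => z /En ->.
      - by apply: (@good_sub_cst_out _ _ _ _ r) => // z /En ->.
      - by have := neqr i iJ; rewrite eq eqxx.
    apply: (@good_ext _ _ (fun z => K (chi i) z * body q1 q2 phi (behead z))).
      by move=> z /ED Dz; rewrite /G body_mul KE.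
    apply: goodM; last exact: good_sub gtail.
    by have [_ gKc _] := ddK i iJ; exact: good_sub gKc.
  have gHr : good (torus (r :: rs)) H by exact: good_sub gH.
  rewrite (mint_ext rrs (gbody r rr) (fun z zr => bodyE z (ED z zr))).
  rewrite mintD//; last by apply: good_sum => // z; exact: torus_neq0.
  rewrite mint_sum//; congr (_ + _); rewrite [LHS]big_seq [RHS]big_seq.
  apply: eq_bigr => i iJ.
  by rewrite -(mint_factor (k := fun x => c i / (x - chi i)))//; [exact: gp|exact: gbody'].
split; first by apply: gbody; left.
rewrite (mainE r2); last by right.
rewrite (mainE r1); last by left.
rewrite -addrA; congr (_ + _).
  by apply: mint_radius => //=; rewrite ?r1_gt0 ?r2_gt0//; apply: good_sub gH => z [];
    [right|left].
rewrite -big_split /= [LHS]big_seq [RHS]big_seq; apply: eq_bigr => i iJ.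
have /andP[a b] := chiJ i iJ.
have pz r : normc (chi i) != r -> 0 < r ->
    circle_integral r (fun x => c i / (x - chi i)) =
    c i * circle_integral r (fun x => (x - chi i)^-1).
  move=> cr r0; rewrite !circle_mint; apply: mintZ; first by rewrite /= r0.
  exact: good_simple_pole.
rewrite !pz ?(gt_eqF a) ?(lt_eqF b)// (circle_outer_pole r1_gt0 a) (circle_inner_pole b).
rewrite mulr0 mul0r add0r /c; congr (_ * _).
rewrite mulfVK// mulf_neq0//.
  by rewrite fmorph_eq0 gt_eqF// twopi_gt0.
by rewrite -normc_gt0 normc_i.
Qed.

End Crossing.

(** * Arms and legs *)

Section ArmLeg.

(** Indicator functions recover multiplicities. The increments of multisets can thus be computed as
    sums in int, where terms may be subtracted. *)
Lemma perm_eq_of_sums (T : eqType) (s t : seq T) :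
  (forall g : T -> int, \sum_(e <- s) g e = \sum_(e <- t) g e) -> perm_eq s t.
Proof.
move=> H; apply/permP => a; apply/eqP.
have E (w : seq T) : \sum_(e <- w) ((a e)%:R : int) = (count a w)%:R.
  elim: w => [|e w IH]; first by rewrite big_nil.
  by rewrite big_cons IH /= natrD.
by have := H (fun e => (a e)%:R); rewrite !E => /eqP; rewrite eqr_nat.
Qed.

(** Row lengths A and column lengths At, 0-based; the Galois relation says that both describe the
    same set of boxes. The common bound n gives fixed ranges of summation. *)
Record is_shape (n : nat) (A At : nat -> nat) : Prop := IsShape {
  shape_galois : forall x y, (y < A x)%N = (x < At y)%N;
  shape_row0 : forall x, (n <= x)%N -> A x = 0%N;
  shape_row_le : forall x, (A x <= n)%N }.

(* The pairs (i, j) such that the product N_{alpha,beta} of the shapes A and B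
   has a factor 1 - (u_alpha / u_beta) q1^i q2^j; rows and columns are 0-based. *)
Definition armleg n (A At B Bt : nat -> nat) : seq (int * int) :=
  [seq ((At y)%:Z - x%:Z, y.+1%:Z - (B x)%:Z)
     | x <- index_iota 0 n, y <- index_iota 0 (A x)]
  ++ [seq (x.+1%:Z - (Bt y)%:Z, (A x)%:Z - y%:Z)
     | x <- index_iota 0 n, y <- index_iota 0 (B x)].

Variable n : nat.
Implicit Types (A At B Bt : nat -> nat) (g : int * int -> int).

Lemma sum_cat (T : Type) (s t : seq T) (h : T -> int) :
  \sum_(e <- s ++ t) h e = \sum_(e <- s) h e + \sum_(e <- t) h e.
Proof. by rewrite big_cat. Qed.

Lemma sum_nat_lt (m : nat) (F : nat -> int) : (m <= n)%N ->
  \sum_(0 <= y < m) F y = \sum_(0 <= y < n | (y < m)%N) F y.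
Proof. by move=> mn; rewrite !big_mkord (big_ord_widen n F mn). Qed.

Lemma sum_nat_upd (F' F : nat -> int) k : (k < n)%N -> (forall y, y != k -> F' y = F y) ->
  \sum_(0 <= y < n) F' y = \sum_(0 <= y < n) F y + (F' k - F k).
Proof.
move=> kn FF; rewrite !big_mkord (bigD1 (Ordinal kn))//= [in RHS](bigD1 (Ordinal kn))//=.
have -> : \sum_(i < n | i != Ordinal kn) F' i = \sum_(i < n | i != Ordinal kn) F i.
  by apply: eq_bigr => i ik; apply: FF.
by ring.
Qed.

(** The first half is summed by columns and the second by rows: a box added to A then affects a
    single column of the one and a single row of the other. *)
Lemma armlegE g A At B Bt : is_shape n A At -> is_shape n B Bt ->
  \sum_(e <- armleg n A At B Bt) g e =
  \sum_(0 <= y < n) \sum_(0 <= x < At y) g ((At y)%:Z - x%:Z, y.+1%:Z - (B x)%:Z)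
  + \sum_(0 <= x < n) \sum_(0 <= y < B x) g (x.+1%:Z - (Bt y)%:Z, (A x)%:Z - y%:Z).
Proof.
move=> sA sB; rewrite big_cat /= !big_allpairs_dep; congr (_ + _).
under eq_bigr do rewrite sum_nat_lt ?(shape_row_le sA)//.
rewrite (exchange_big_dep xpredT)//=; apply: eq_bigr => y _.
have At_le : (At y <= n)%N.
  rewrite leqNgt; apply/negP => h; move: h; rewrite -(shape_galois sA).
  by rewrite (shape_row0 sA).
by rewrite sum_nat_lt//; apply: eq_bigl => x; rewrite (shape_galois sA).
Qed.

(** The reflection e -> (1, 1) - e exchanges the two halves, so that a box added to the second shape
    reduces to a box added to the first. *)
Lemma armleg_swap g A At B Bt :
  \sum_(e <- armleg n A At B Bt) g e =
  \sum_(e <- armleg n B Bt A At) g (1 - e.1, 1 - e.2).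
Proof.
rewrite !big_cat /= !big_allpairs_dep addrC; congr (_ + _);
  apply: eq_bigr => x _; apply: eq_bigr => y _; congr (g (_, _)) => /=; lia.
Qed.

Lemma shape_colS B Bt x y : is_shape n B Bt -> (B x.+1 <= y < B x)%N -> Bt y = x.+1.
Proof.
move=> sB /andP[h1 h2]; apply/eqP; rewrite eqn_leq -(shape_galois sB) h2 andbT.
by rewrite leqNgt -(shape_galois sB) -leqNgt.
Qed.

Lemma shape_rowS B Bt x : is_shape n B Bt -> (B x.+1 <= B x)%N.
Proof.
move=> sB; rewrite leqNgt; apply/negP; rewrite (shape_galois sB) => h.
by have := ltnW h; rewrite -(shape_galois sB) ltnn.
Qed.

(* Abel summation along the boundary of the shape B. *)
Lemma boundary_sum g B Bt (i j : int) x0 : is_shape n B Bt -> (x0 <= n)%N ->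
  \sum_(0 <= x < x0.+1) g (i + 1 - x%:Z, j + 1 - (B x)%:Z)
  - \sum_(0 <= x < x0) g (i - x%:Z, j + 1 - (B x)%:Z)
  + \sum_(0 <= y < B x0) (g (i + 1 - (Bt y)%:Z, j + 1 - y%:Z)
                          - g (i + 1 - (Bt y)%:Z, j - y%:Z)) =
  \sum_(0 <= x < n.+1) g (i + 1 - x%:Z, j + 1 - (B x)%:Z)
  - \sum_(0 <= x < n) g (i - x%:Z, j + 1 - (B x)%:Z).
Proof.
move=> sB; pose c y := g (i + 1 - (Bt y)%:Z, j + 1 - y%:Z) - g (i + 1 - (Bt y)%:Z, j - y%:Z).
(* T m is the left side for x0 = m. From m to m + 1 the new row terms cancel against the columns
   B(m+1) <= y < B(m), where Bt y = m + 1 makes the differences telescope. At m = n the sum over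
   columns is empty. *)
pose T m := \sum_(0 <= x < m.+1) g (i + 1 - x%:Z, j + 1 - (B x)%:Z)
  - \sum_(0 <= x < m) g (i - x%:Z, j + 1 - (B x)%:Z) + \sum_(0 <= y < B m) c y.
have TS m : T m.+1 = T m.
  rewrite /T (big_nat_recr m.+1)//= (big_nat_recr m _ (fun x => g (i - x%:Z, _)))//=.
  rewrite (big_cat_nat (leq0n (B m.+1)) (shape_rowS m sB)) /=.
  have -> : \sum_(B m.+1 <= y < B m) c y =
      g (i - m%:Z, j + 1 - (B m.+1)%:Z) - g (i - m%:Z, j + 1 - (B m)%:Z).
    rewrite -[RHS]opprB.
    rewrite -(@GRing.telescope_sumr _ _ _ (fun y => g (i - m%:Z, j + 1 - y%:Z)))//; last first.
      exact: shape_rowS sB.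
    rewrite -sumrN; apply: eq_big_nat => y yB.
    rewrite /c (shape_colS sB yB) opprB; congr (g (_, _) - g (_, _)); lia.
  have -> : i + 1 - m.+1%:Z = i - m%:Z by lia.
  by ring.
have Tn m d : T (m + d)%N = T m by elim: d => [|d IH]; rewrite ?addn0// addnS TS.
move=> x0n; rewrite -/(T x0) -(Tn x0 (n - x0)%N) subnKC// /T.
by rewrite (shape_row0 sB (leqnn n)) [in X in _ + X]big_geq// addr0.
Qed.

(** Column y0 of the first half and row x0 of the second half are all that changes, and together
    their increment is the left side of [boundary_sum] for B. *)
Lemma armleg_addl_sum g A At A' At' B Bt x0 y0 :
  is_shape n A At -> is_shape n A' At' -> is_shape n B Bt ->
  (x0 < n)%N -> (y0 < n)%N -> A x0 = y0 -> At y0 = x0 ->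
  (forall x, A' x = A x + (x == x0))%N -> (forall y, At' y = At y + (y == y0))%N ->
  \sum_(e <- armleg n A' At' B Bt) g e = \sum_(e <- armleg n A At B Bt) g e
    + \sum_(0 <= x < n.+1) g (x0%:Z + 1 - x%:Z, y0%:Z + 1 - (B x)%:Z)
    - \sum_(0 <= x < n) g (x0%:Z - x%:Z, y0%:Z + 1 - (B x)%:Z).
Proof.
move=> sA sA' sB x0n y0n Ax0 Aty0 HA HAt.
rewrite !armlegE// -addrA -(boundary_sum g x0%:Z y0%:Z sB (ltnW x0n)).
rewrite (@sum_nat_upd _ (fun y => \sum_(0 <= x < At y) g ((At y)%:Z - x%:Z, y.+1%:Z - (B x)%:Z)) y0)//;
  last by move=> y /negbTE yy0; rewrite HAt yy0 addn0.
rewrite [X in _ + X](@sum_nat_upd _ (fun x => \sum_(0 <= y < B x) g (x.+1%:Z - (Bt y)%:Z, (A x)%:Z - y%:Z)) x0)//;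
  last by move=> x /negbTE xx0; rewrite HA xx0 addn0.
rewrite HAt HA !eqxx Aty0 Ax0 !addn1 sumrB.
have -> : x0%:Z + 1 = x0.+1%:Z by lia.
have -> : y0%:Z + 1 = y0.+1%:Z by lia.
by ring.
Qed.

Lemma armleg_addr_sum g A At B Bt B' Bt' x0 y0 :
  is_shape n A At -> is_shape n B Bt -> is_shape n B' Bt' ->
  (x0 < n)%N -> (y0 < n)%N -> B x0 = y0 -> Bt y0 = x0 ->
  (forall x, B' x = B x + (x == x0))%N -> (forall y, Bt' y = Bt y + (y == y0))%N ->
  \sum_(e <- armleg n A At B' Bt') g e = \sum_(e <- armleg n A At B Bt) g e
    + \sum_(0 <= x < n.+1) g (x%:Z - x0%:Z, (A x)%:Z - y0%:Z)
    - \sum_(0 <= x < n) g (x%:Z + 1 - x0%:Z, (A x)%:Z - y0%:Z).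
Proof.
move=> sA sB sB' x0n y0n Bx0 Bty0 HB HBt.
rewrite armleg_swap (@armleg_addl_sum _ B Bt _ _ A At x0 y0)// -armleg_swap.
congr (_ + _ - _); apply: eq_big_nat => x _; congr (g (_, _)) => /=; lia.
Qed.

Lemma armleg_addl A At A' At' B Bt x0 y0 :
  is_shape n A At -> is_shape n A' At' -> is_shape n B Bt ->
  (x0 < n)%N -> (y0 < n)%N -> A x0 = y0 -> At y0 = x0 ->
  (forall x, A' x = A x + (x == x0))%N -> (forall y, At' y = At y + (y == y0))%N ->
  perm_eq
    (armleg n A' At' B Bt ++
       [seq (x0%:Z - x%:Z, y0%:Z + 1 - (B x)%:Z) | x <- index_iota 0 n])
    (armleg n A At B Bt ++
       [seq (x0%:Z + 1 - x%:Z, y0%:Z + 1 - (B x)%:Z) | x <- index_iota 0 n.+1]).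
Proof.
move=> sA sA' sB x0n y0n Ax0 Aty0 HA HAt; apply: perm_eq_of_sums => g.
rewrite [LHS]sum_cat [RHS]sum_cat !big_map (armleg_addl_sum g sA sA' sB x0n y0n)//.
by rewrite subrK.
Qed.

Lemma armleg_addr A At B Bt B' Bt' x0 y0 :
  is_shape n A At -> is_shape n B Bt -> is_shape n B' Bt' ->
  (x0 < n)%N -> (y0 < n)%N -> B x0 = y0 -> Bt y0 = x0 ->
  (forall x, B' x = B x + (x == x0))%N -> (forall y, Bt' y = Bt y + (y == y0))%N ->
  perm_eq
    (armleg n A At B' Bt' ++
       [seq (x%:Z + 1 - x0%:Z, (A x)%:Z - y0%:Z) | x <- index_iota 0 n])
    (armleg n A At B Bt ++
       [seq (x%:Z - x0%:Z, (A x)%:Z - y0%:Z) | x <- index_iota 0 n.+1]).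
Proof.
move=> sA sB sB' x0n y0n Bx0 Bty0 HB HBt; apply: perm_eq_of_sums => g.
rewrite [LHS]sum_cat [RHS]sum_cat !big_map (armleg_addr_sum g sA sB sB' x0n y0n)//.
by rewrite subrK.
Qed.

(** The box is added to the first shape and then to the second. In the second addition row x0 is
    already longer by one: there (0, 0) becomes (0, 1) and (1, 0) becomes (1, 1). This removes the
    entry (0, 0), whose factor 1 - 1 would vanish, and leaves the three isolated entries that
    produce the constant (1 - q1 q2) / ((1 - q1)(1 - q2)). *)
Lemma armleg_add A At A' At' x0 y0 :
  is_shape n A At -> is_shape n A' At' ->
  (x0 < n)%N -> (y0 < n)%N -> A x0 = y0 -> At y0 = x0 ->
  (forall x, A' x = A x + (x == x0))%N -> (forall y, At' y = At y + (y == y0))%N ->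
  perm_eq
    (armleg n A' At' A' At' ++
       ([seq (x0%:Z - x%:Z, y0%:Z + 1 - (A x)%:Z) | x <- index_iota 0 n] ++
        [seq (x%:Z + 1 - x0%:Z, (A x)%:Z - y0%:Z) | x <- index_iota 0 n] ++
        [:: (1, 1)]))
    (armleg n A At A At ++
       ([seq (x0%:Z + 1 - x%:Z, y0%:Z + 1 - (A x)%:Z) | x <- index_iota 0 n.+1] ++
        [seq (x%:Z - x0%:Z, (A x)%:Z - y0%:Z)
           | x <- [seq x <- index_iota 0 n.+1 | x != x0]] ++
        [:: (1, 0); (0, 1)])).
Proof.
move=> sA sA' x0n y0n Ax0 Aty0 HA HAt; apply: perm_eq_of_sums => g.
rewrite [LHS]sum_cat [RHS]sum_cat [X in _ + X = _]sum_cat [X in _ = _ + X]sum_cat.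
rewrite [X in _ + (_ + X) = _]sum_cat [X in _ = _ + (_ + X)]sum_cat !big_map.
rewrite (armleg_addr_sum g sA' sA sA' x0n y0n)//.
rewrite (armleg_addl_sum g sA sA' sA x0n y0n)// big_filter.
rewrite big_seq1.
have -> : \sum_(e <- [:: (1, 0); (0, 1)]) g e = g (1, 0) + g (0, 1).
  by rewrite big_cons big_seq1.
have x0n1 : (x0 < n.+1)%N by rewrite ltnS ltnW.
have -> : \sum_(0 <= x < n.+1) g (x%:Z - x0%:Z, (A' x)%:Z - y0%:Z) = g (0, 1) +
    \sum_(0 <= x < n.+1 | x != x0) g (x%:Z - x0%:Z, (A x)%:Z - y0%:Z).
  rewrite !big_mkord (bigD1 (Ordinal x0n1))//= HA eqxx Ax0 subrr.
  have -> : (y0 + true)%:Z - y0%:Z = 1 by rewrite addn1; lia.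
  congr (_ + _); apply: eq_bigr => x; rewrite -val_eqE /= => xx0.
  by rewrite HA (negbTE xx0) addn0.
rewrite [X in _ + _ - X](@sum_nat_upd _ (fun x => g (x%:Z + 1 - x0%:Z, (A x)%:Z - y0%:Z)) x0)//;
  last by move=> x /negbTE xx0; rewrite HA xx0 addn0.
rewrite HA eqxx Ax0 subrr [x0%:Z + 1]addrC addrK PoszD [y0%:Z + 1%N%:Z]addrC addrK.
by ring.
Qed.

End ArmLeg.

(** * Young diagrams as sets of boxes *)

Section Young.
Variables r n : nat.
(** Coordinates are 0-based and below n, which loses no diagram of size at most n. Sums over tuples
    of diagrams become sums over a finite type. *)
Definition box : Type := ('I_r * 'I_n * 'I_n)%type.
Implicit Types (Y : {set box}) (a : 'I_r) (b c : box).

Definition young Y : bool :=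
  [forall b in Y, forall c : box,
     [&& c.1.1 == b.1.1, (c.1.2 <= b.1.2)%N & (c.2 <= b.2)%N] ==> (c \in Y)].

Lemma youngP Y : reflect (forall b c : box, b \in Y -> c.1.1 = b.1.1 ->
  (c.1.2 <= b.1.2)%N -> (c.2 <= b.2)%N -> c \in Y) (young Y).
Proof.
apply: (iffP forallP) => [H b c bY e1 e2 e3|H b].
  by move: (H b); rewrite bY /= => /forallP/(_ c); rewrite e1 eqxx e2 e3.
apply/implyP => bY; apply/forallP => c; apply/implyP => /and3P[/eqP e1 e2 e3].
exact: H bY e1 e2 e3.
Qed.

Definition rowlen Y a (x : nat) : nat :=
  #|[set b in Y | (b.1.1 == a) && (b.1.2 == x :> nat)]|.
Definition collen Y a (y : nat) : nat :=
  #|[set b in Y | (b.1.1 == a) && (b.2 == y :> nat)]|.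

Lemma card_ord_lt (m k : nat) : (k <= m)%N -> #|[set i : 'I_m | (i < k)%N]| = k.
Proof.
move=> km; rewrite -sum1_card; under eq_bigl do rewrite inE.
by rewrite -(big_ord_widen m (fun=> 1%N) km) sum1_card card_ord.
Qed.

Lemma downset_card (m : nat) (T : {set 'I_m}) :
  (forall i j : 'I_m, i \in T -> (j <= i)%N -> j \in T) ->
  forall i, (i \in T) = (i < #|T|)%N.
Proof.
move=> HT i; apply/idP/idP => [iT|].
  rewrite -[X in (X <= _)%N](card_ord_lt (ltn_ord i)); apply: subset_leq_card.
  by apply/fintype.subsetP => j; rewrite inE ltnS => /(HT _ _ iT).
apply: contraLR => iT; rewrite -leqNgt -[X in (_ <= X)%N](card_ord_lt (ltnW (ltn_ord i))).
apply: subset_leq_card; apply/fintype.subsetP => j jT; rewrite inE ltnNge.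
by apply: contra iT => /(HT _ _ jT).
Qed.

Lemma young_row Y a (x y : 'I_n) : young Y -> ((a, x, y) \in Y) = (y < rowlen Y a x)%N.
Proof.
move=> /youngP HY; pose T := [set y' : 'I_n | (a, x, y') \in Y].
have -> : rowlen Y a x = #|T|.
  rewrite /rowlen; have <- : #|[set (a, x, y') | y' in T]| = #|T| by apply: card_imset => ? ? [].
  apply: eq_card => -[[a' x'] y']; rewrite inE; apply/andP/imsetP => /=.
    by move=> [bY /andP[/eqP e1 /eqP/val_inj e2]]; exists y'; rewrite ?inE -e1 -e2.
  by move=> [y'']; rewrite inE => yT [-> -> ->]; rewrite yT !eqxx.
rewrite -downset_card ?inE// => i j; rewrite !inE => iT ji.
exact: HY iT _ _ _.
Qed.

Lemma young_col Y a (x y : 'I_n) : young Y -> ((a, x, y) \in Y) = (x < collen Y a y)%N.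
Proof.
move=> /youngP HY; pose T := [set x' : 'I_n | (a, x', y) \in Y].
have -> : collen Y a y = #|T|.
  rewrite /collen; have <- : #|[set (a, x', y) | x' in T]| = #|T| by apply: card_imset => ? ? [].
  apply: eq_card => -[[a' x'] y']; rewrite inE; apply/andP/imsetP => /=.
    by move=> [bY /andP[/eqP e1 /eqP/val_inj e2]]; exists x'; rewrite ?inE -e1 -e2.
  by move=> [x'']; rewrite inE => yT [-> -> ->]; rewrite yT !eqxx.
rewrite -downset_card ?inE// => i j; rewrite !inE => iT ji.
exact: HY iT _ _ _.
Qed.

Lemma rowlen_le_card Y a x : (rowlen Y a x <= #|Y|)%N.
Proof. by apply: subset_leq_card; apply/fintype.subsetP => b; rewrite inE => /andP[]. Qed.

Lemma collen_le_card Y a y : (collen Y a y <= #|Y|)%N.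
Proof. by apply: subset_leq_card; apply/fintype.subsetP => b; rewrite inE => /andP[]. Qed.

Lemma rowlen_le Y a x : (rowlen Y a x <= n)%N.
Proof.
rewrite -[X in (_ <= X)%N]card_ord /rowlen /collen.
rewrite -(card_in_imset (f := fun b : box => b.2)); first exact: max_card.
move=> [[a1 x1] y1] [[a2 x2] y2]; rewrite !inE /=.
by move=> /and3P[_ /eqP -> /eqP e1] /and3P[_ /eqP -> /eqP e2] ->;
  congr (_, _, _); apply: val_inj; rewrite /= e1 e2.
Qed.

Lemma collen_le Y a y : (collen Y a y <= n)%N.
Proof.
rewrite -[X in (_ <= X)%N]card_ord /rowlen /collen.
rewrite -(card_in_imset (f := fun b : box => b.1.2)); first exact: max_card.
move=> [[a1 x1] y1] [[a2 x2] y2]; rewrite !inE /=.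
by move=> /and3P[_ /eqP -> /eqP e1] /and3P[_ /eqP -> /eqP e2] ->;
  congr (_, _, _); apply: val_inj; rewrite /= e1 e2.
Qed.

Lemma rowlen_out Y a x : (n <= x)%N -> rowlen Y a x = 0%N.
Proof.
move=> nx; apply: eq_card0 => b; rewrite inE; apply/negP => /and3P[_ _ /eqP bx].
by have := ltn_ord b.1.2; rewrite bx ltnNge nx.
Qed.

Lemma collen_out Y a y : (n <= y)%N -> collen Y a y = 0%N.
Proof.
move=> nx; apply: eq_card0 => b; rewrite inE; apply/negP => /and3P[_ _ /eqP bx].
by have := ltn_ord b.2; rewrite bx ltnNge nx.
Qed.

Lemma young_shape Y a : young Y -> is_shape n (rowlen Y a) (collen Y a).
Proof.
move=> yY; split; [|exact: rowlen_out|exact: rowlen_le].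
move=> x y; have [xn|nx] := ltnP x n; last first.
  rewrite rowlen_out// ltn0; apply/esym/negbTE; rewrite -leqNgt.
  exact: leq_trans (collen_le _ _ _) nx.
have [yn|ny] := ltnP y n; last first.
  rewrite collen_out// ltn0; apply/negbTE; rewrite -leqNgt.
  exact: leq_trans (rowlen_le _ _ _) ny.
by rewrite -(young_row a (Ordinal xn) (Ordinal yn) yY) (young_col _ _ _ yY).
Qed.

Definition addable Y c : bool := (c \notin Y) && young (c |: Y).

Lemma rowlen_setU1 Y c a x : c \notin Y ->
  rowlen (c |: Y) a x = (rowlen Y a x + ((c.1.1 == a) && (c.1.2 == x :> nat)))%N.
Proof.
move=> cY; rewrite /rowlen; case: (boolP (_ && _)) => [cax|cax].
  set T := [set b in Y | _].
  have cT : c \notin T by rewrite inE (negbTE cY).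
  have <- : #|c |: T| = (#|T| + true)%N by rewrite cardsU1 cT addnC.
  apply: eq_card => b.
  by rewrite !inE andb_orl; case: eqP => [->|]; rewrite ?cax.
rewrite addn0; apply: eq_card => b; rewrite !inE andb_orl.
by case: eqP => [->|]//; rewrite (negbTE cax) (negbTE cY).
Qed.

Lemma collen_setU1 Y c a y : c \notin Y ->
  collen (c |: Y) a y = (collen Y a y + ((c.1.1 == a) && (c.2 == y :> nat)))%N.
Proof.
move=> cY; rewrite /collen; case: (boolP (_ && _)) => [cax|cax].
  set T := [set b in Y | _].
  have cT : c \notin T by rewrite inE (negbTE cY).
  have <- : #|c |: T| = (#|T| + true)%N by rewrite cardsU1 cT addnC.
  apply: eq_card => b.
  by rewrite !inE andb_orl; case: eqP => [->|]; rewrite ?cax.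
rewrite addn0; apply: eq_card => b; rewrite !inE andb_orl.
by case: eqP => [->|]//; rewrite (negbTE cax) (negbTE cY).
Qed.

Lemma addable_row Y c : young Y -> addable Y c -> rowlen Y c.1.1 c.1.2 = c.2.
Proof.
move=> yY /andP[cY yc]; apply/eqP; rewrite eqn_leq leqNgt.
case: c cY yc => [[a x] y] cY yc /=.
rewrite -young_row// cY /= -ltnS -[X in (_ < X)%N]addn1.
have := young_row a x y yc; rewrite !inE eqxx rowlen_setU1//= !eqxx /= => /esym ->.
by [].
Qed.

Lemma addable_col Y c : young Y -> addable Y c -> collen Y c.1.1 c.2 = c.1.2.
Proof.
move=> yY /andP[cY yc]; apply/eqP; rewrite eqn_leq leqNgt.
case: c cY yc => [[a x] y] cY yc /=.
rewrite -young_col// cY /= -ltnS -[X in (_ < X)%N]addn1.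
have := young_col a x y yc; rewrite !inE eqxx collen_setU1//= !eqxx /= => /esym ->.
by [].
Qed.

Lemma addable_corner Y a (x y : 'I_n) : young Y -> rowlen Y a x = y ->
  (forall x', x = x'.+1 :> nat -> (y < rowlen Y a x')%N) -> addable Y (a, x, y).
Proof.
move=> yY rxy Hx; rewrite /addable young_row// rxy ltnn /=.
apply/youngP => b c; rewrite !inE => /orP[/eqP ->|bY] e1 e2 e3; last first.
  by rewrite (youngP _ yY _ _ bY e1 e2 e3) orbT.
move: c e1 e2 e3 => [[a' x'] y'] /= -> x'x y'y.
have [e|xx'] := eqVneq (x' : nat) x.
  have [e'|yy'] := eqVneq (y' : nat) y.
    by rewrite (val_inj e) (val_inj e') eqxx.
  by rewrite [X in _ || X]young_row// e rxy ltn_neqAle yy' y'y orbT.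
have {xx' x'x}lt : (x' < x)%N by rewrite ltn_neqAle xx'.
have xS : x = (x : nat).-1.+1 :> nat by rewrite prednK// (leq_trans _ lt).
rewrite [X in _ || X]young_row//; apply/orP; right.
have h := Hx _ xS; apply: leq_ltn_trans y'y _; apply: (leq_trans h).
have x1n : ((x : nat).-1 < n)%N by apply: leq_ltn_trans (ltn_ord x); exact: leq_pred.
have x1 : (a, Ordinal x1n, Ordinal (leq_trans h (rowlen_le _ _ _))) \in Y.
  by rewrite young_row.
have y'n : (y < n)%N by [].
(* Row lengths decrease, so the bound on row x - 1 carries over to every earlier row. *)
elim: ((x : nat).-1 - x')%N {-2}x' (erefl ((x : nat).-1 - x')%N) lt => [|d IH] k kd klt.
  by have -> : (k : nat) = (x : nat).-1 by lia.
have k1n : (k.+1 < n)%N by have := ltn_ord x; lia.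
apply: leq_trans (IH (Ordinal k1n) _ _) _ => /=; [lia|lia|].
exact: shape_rowS (young_shape a yY).
Qed.

Lemma young0 : young finset.set0.
Proof. by apply/youngP => b c; rewrite inE. Qed.

Lemma rowlen0 a x : rowlen finset.set0 a x = 0%N.
Proof. by apply: eq_card0 => b; rewrite !inE. Qed.

(** A box maximizing the sum of its two coordinates has no other box of Y to its lower right. *)
Lemma young_remove Y : young Y -> Y != finset.set0 ->
  exists c Y', [/\ young Y', addable Y' c & Y = c |: Y'].
Proof.
move=> yY /set0Pn[b0 b0Y].
pose m (b : box) := (b.1.2 + b.2)%N.
have [c cY cmax] := @arg_maxnP _ b0 (mem Y) m b0Y.
exists c, (Y :\ c).
have yYc : young (Y :\ c).
  apply/youngP => b d; rewrite !inE => /andP[bc bY] e1 e2 e3.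
  rewrite (youngP _ yY _ _ bY e1 e2 e3) andbT.
  apply: contra_neq bc => dc; have := cmax b bY; rewrite /m -dc => h.
  case: b {bY} e1 e2 e3 h => [[a x] y]; case: d {dc} => [[a' x'] y'] /= -> e2 e3 h.
  by congr (_, _, _); apply: val_inj => /=; lia.
split => //; last by rewrite finset.setD1K.
by rewrite /addable finset.setD1K// !inE eqxx yY.
Qed.

Lemma young_ind (P : {set box} -> Prop) : P finset.set0 ->
  (forall Y c, young Y -> addable Y c -> P Y -> P (c |: Y)) ->
  forall Y, young Y -> P Y.
Proof.
move=> P0 PS Y; have [k] := ubnP #|Y|; elim: k Y => // k IH Y Yk yY.
have [->//|Y0] := eqVneq Y finset.set0.
have [c [Y' [yY' ac E]]] := young_remove yY Y0; rewrite E.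
apply: PS => //; apply: IH => //.
by have /andP[cY' _] := ac; move: Yk; rewrite E cardsU1 cY' ltnS.
Qed.

End Young.

(** * Weights of tuples of diagrams and their increments *)

Section Weights.
Variables (R : realType) (r n S : nat).
Local Notation C := R[i].
Variables (q1 q2 : C) (u : 'I_r -> C) (p : 'I_S -> C).
Implicit Types (Y : {set box r n}) (a : 'I_r) (z : C) (c : box r n).

Definition lat a (x y : nat) : C := u a * q1 ^+ x * q2 ^+ y.
Definition zbox (b : box r n) : C := lat b.1.1 b.1.2 b.2.
(** The point of the first free place in row x; these are the only candidates for poles inside. *)
Definition rowend Y a x : C := lat a x (rowlen Y a x).

Definition rowprod Y (f : C -> C) : C :=
  \prod_(i : 'I_r * 'I_n) f (rowend Y i.1 i.2).
(** There is one row more here than in [rowprod]: for empty diagrams the numerators z - q1 (u q1^x)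
    with x < n cancel the denominators of rows 1 to n and leave 1 / (z - u). *)
Definition rowprod1 Y (f : C -> C) : C :=
  \prod_(i : 'I_r * 'I_n.+1) f (rowend Y i.1 i.2).
Definition rowprod1D Y c (f : C -> C) : C :=
  \prod_(i : 'I_r * 'I_n.+1 | ~~ ((i.1 == c.1.1) && (i.2 == c.1.2 :> nat)))
     f (rowend Y i.1 i.2).

Definition Nfac Y a a' : C :=
  \prod_(e <- armleg n (rowlen Y a) (collen Y a) (rowlen Y a') (collen Y a'))
    (1 - u a / u a' * q1 ^ e.1 * q2 ^ e.2).

Definition wt Y : C :=
  (\prod_(b in Y) \prod_(m < S) (zbox b - p m)) / \prod_(a < r) \prod_(a' < r) Nfac Y a a'.

(** The kernel kap(chi, z) is split in two. Here are the factors with poles at q_i times a box,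
    which the shrinking circle can meet; [outer] has those with poles at a box divided by q_i. *)
Definition inner Y z : C :=
  (\prod_(a < r) (z - u a)^-1) * \prod_(b in Y)
     ((z - zbox b) * (z - q1 * q2 * zbox b) / ((z - q1 * zbox b) * (z - q2 * zbox b))).

Definition outer Y z : C :=
  (\prod_(a < r) (1 - q1 * q2 * z / u a)^-1) * \prod_(b in Y)
     ((zbox b - z) * (zbox b - q1 * q2 * z) / ((zbox b - q1 * z) * (zbox b - q2 * z))).

(* The residue at z = zbox c of the one-body function attached to Y, with respect
   to dz / (2 pi i). *)
Definition rho Y c : C :=
  let z := zbox c in
  (1 - q1 * q2) / ((1 - q1) * (1 - q2)) * (\prod_(m < S) (z - p m)) * z ^+ r.-1
  * (rowprod Y (fun x => z - q1 * x) / rowprod1D Y c (fun x => z - x)) * outer Y z.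

Hypotheses (q1_neq0 : q1 != 0) (q2_neq0 : q2 != 0).
Hypotheses (q1_disk : normc q1 < 1) (q2_disk : normc q2 < 1).
Hypothesis (u_neq0 : forall a, u a != 0).
Hypothesis (u_generic : forall (a b : 'I_r) (x y : int), a != b ->
     - n%:Z <= x <= n%:Z -> - n%:Z <= y <= n%:Z ->
     u a * (u b)^-1 != q1 ^ x * q2 ^ y).
Hypothesis (q_generic : forall x y : nat, (x < n)%N -> (y < n)%N ->
     q1 ^+ x != q2 ^+ y.+1 /\ q1 ^+ x.+1 != q2 ^+ y).

Lemma lat_neq0 a x y : lat a x y != 0.
Proof. by rewrite /lat !mulf_neq0 ?expf_neq0. Qed.

Lemma exprzB_nat (q : C) (x y : nat) : q != 0 -> q ^ (x%:Z - y%:Z) = q ^+ x / q ^+ y.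
Proof. by move=> q0; rewrite expfzDr// -exprz_inv -!exprnP exprVn. Qed.

Lemma lat_ratio (a b : 'I_r) x y x' y' :
  u a / u b * q1 ^ (x%:Z - x'%:Z) * q2 ^ (y%:Z - y'%:Z) = lat a x y / lat b x' y'.
Proof.
rewrite !exprzB_nat// /lat; field.
by rewrite !expf_neq0 ?u_neq0.
Qed.

Lemma q_pow_neq1 (i j : nat) : (0 < i + j)%N -> q1 ^+ i * q2 ^+ j != 1.
Proof.
move=> ij; apply/negP => /eqP E; have : normc (q1 ^+ i * q2 ^+ j) = 1 by rewrite E normc1.
rewrite normcM !normcX; apply/eqP; rewrite lt_eqF//.
have [i0|j0] : (0 < i)%N \/ (0 < j)%N by lia.
- apply: (@le_lt_trans _ _ (normc q1 ^+ i * 1)).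
    by rewrite ler_wpM2l ?exprn_ge0 ?normc_ge0// exprn_ile1 ?normc_ge0// ltW.
  by rewrite mulr1 exprn_ilt1 ?normc_ge0// -lt0n.
- apply: (@le_lt_trans _ _ (1 * normc q2 ^+ j)).
    by rewrite ler_wpM2r ?exprn_ge0 ?normc_ge0// exprn_ile1 ?normc_ge0// ltW.
  by rewrite mul1r exprn_ilt1 ?normc_ge0// -lt0n.
Qed.

(** The genericity of q1, q2 covers all exponents up to n except the pair (n, n), which is why one
    of them has to be smaller. For j = 0 the moduli decide. *)
Lemma q_pow_neq (i j : nat) : (i <= n)%N -> (j <= n)%N -> (i < n)%N || (j < n)%N ->
  (0 < i + j)%N -> q1 ^+ i != q2 ^+ j.
Proof.
move=> iN jN ij ij0.
case: j jN ij ij0 => [|j] jN ij ij0.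
  by have := @q_pow_neq1 i 0; rewrite expr0 mulr1 => -> //; rewrite addn0 in ij0 *.
have [iltn|nlei] := ltnP i n; first by have [] := q_generic iltn jN.
have jn : (j.+1 < n)%N by move: ij; rewrite ltnNge nlei.
have n0 : (0 < n)%N by apply: leq_ltn_trans jn.
have -> : i = n.-1.+1 by lia.
have n1 : (n.-1 < n)%N by lia.
by have [] := q_generic n1 jn.
Qed.

(** For a != b this is the genericity of u. For a = b, comparably ordered points differ in modulus;
    otherwise the equation reads q1^i = q2^j, and the disjunction of strict bounds excludes i = j =
    n. *)
Lemma lat_inj (a b : 'I_r) (x y x' y' : nat) :
  (x <= x' + n)%N -> (x' <= x + n)%N -> (y <= y' + n)%N -> (y' <= y + n)%N ->
  [|| ((x < x' + n)%N && (x' < x + n)%N), ((y < y' + n)%N && (y' < y + n)%N),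
      ((x <= x')%N && (y <= y')%N) | ((x' <= x)%N && (y' <= y)%N)] ->
  lat a x y = lat b x' y' -> [/\ a = b, x = x' & y = y'].
Proof.
move=> h1 h2 h3 h4 h5 E.
have [ab|ab] := eqVneq a b; last first.
  have H := @u_generic a b (x'%:Z - x%:Z) (y'%:Z - y%:Z) ab.
  have H1 : - n%:Z <= x'%:Z - x%:Z <= n%:Z by apply/andP; split; lia.
  have H2 : - n%:Z <= y'%:Z - y%:Z <= n%:Z by apply/andP; split; lia.
  exfalso; move/negP: (H H1 H2); apply.
  rewrite !exprzB_nat//; apply/eqP; move: E; rewrite /lat => E.
  have [e1 e2 e3 e4] : [/\ q1 ^+ x != 0, q2 ^+ y != 0, q1 ^+ x' != 0 & q2 ^+ y' != 0].
    by rewrite !expf_neq0.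
  apply: (mulIf e1); apply: (mulIf e2); apply: (mulIf (u_neq0 b)).
  transitivity (u a * q1 ^+ x * q2 ^+ y); first by field.
  by rewrite E; field; rewrite e1 e2.
split => //; move: E; rewrite ab /lat -!mulrA => /(mulfI (u_neq0 b)) {a ab b}.
- wlog xx : x x' y y' h1 h2 h3 h4 h5 / (x <= x')%N.
    move=> H E; have [xx|xx] := leqP x x'; first exact: (H x x' y y').
    by apply/esym; apply: (H x' x y' y _ _ _ _ _ _ (esym E)); try lia.
  have -> : x' = (x + (x' - x))%N by lia.
  rewrite exprD -mulrA => /(mulfI (expf_neq0 x q1_neq0)).
  set i := (x' - x)%N => E; suff : i = 0%N by rewrite /i; lia.
  have [yy|yy] := leqP y y'.
    move: E; have -> : y' = (y + (y' - y))%N by lia.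
    rewrite exprD mulrCA -[LHS]mulr1 => /(mulfI (expf_neq0 y q2_neq0)) E.
    apply/eqP; apply: contraT => i0; have := @q_pow_neq1 i (y' - y)%N.
    by rewrite -E eqxx => H; have /H : (0 < i + (y' - y))%N by move: i0; lia.
  move: E; have -> : y = (y' + (y - y'))%N by lia.
  rewrite exprD mulrC => /(mulIf (expf_neq0 y' q2_neq0)) E.
  have := @q_pow_neq i (y - y')%N; rewrite E eqxx => H.
  by exfalso; suff : false by []; apply: H; rewrite /i; lia.
- wlog xx : x x' y y' h1 h2 h3 h4 h5 / (x <= x')%N.
    move=> H E; have [xx|xx] := leqP x x'; first exact: (H x x' y y').
    by apply/esym; apply: (H x' x y' y _ _ _ _ _ _ (esym E)); try lia.
  have -> : x' = (x + (x' - x))%N by lia.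
  rewrite exprD -mulrA => /(mulfI (expf_neq0 x q1_neq0)).
  set i := (x' - x)%N => E.
  have [yy|yy] := leqP y y'.
    move: E; have -> : y' = (y + (y' - y))%N by lia.
    rewrite exprD mulrCA -[LHS]mulr1 => /(mulfI (expf_neq0 y q2_neq0)) E.
    have [->|i0] := eqVneq (y' - y)%N 0%N; first by rewrite addn0.
    exfalso; have := @q_pow_neq1 i (y' - y)%N.
    by rewrite -E eqxx => H; have /H : (0 < i + (y' - y))%N by move: i0; lia.
  move: E; have -> : y = (y' + (y - y'))%N by lia.
  rewrite exprD mulrC => /(mulIf (expf_neq0 y' q2_neq0)) E.
  have := @q_pow_neq i (y - y')%N; rewrite E eqxx => H.
  by exfalso; suff : false by []; apply: H; rewrite /i; lia.
Qed.

Lemma rowend_add Y c a (x : nat) : young Y -> addable Y c ->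
  rowend (c |: Y) a x =
  if (a == c.1.1) && (x == c.1.2 :> nat) then q2 * zbox c else rowend Y a x.
Proof.
move=> yY ac; have /andP[cY _] := ac; rewrite /rowend rowlen_setU1//.
rewrite [c.1.1 == a]eq_sym [(c.1.2 : nat) == x]eq_sym.
case: (altP andP) => [[/eqP -> /eqP ->]|_]; last by rewrite addn0.
by rewrite addable_row// addn1 /lat /zbox /lat exprSr mulrA mulrC.
Qed.

Lemma rowend_addable Y c : young Y -> addable Y c -> rowend Y c.1.1 c.1.2 = zbox c.
Proof. by move=> yY ac; rewrite /rowend addable_row. Qed.

Lemma prod_upd (I : finType) (F G : I -> C) (k : I) : (forall i, i != k -> F i = G i) ->
  (\prod_i F i) * G k = (\prod_i G i) * F k.
Proof.
move=> FG; rewrite (bigD1 k)//= [in RHS](bigD1 k)//=.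
have -> : \prod_(i | i != k) F i = \prod_(i | i != k) G i by apply: eq_bigr.
by ring.
Qed.

Lemma rowprod_add Y c f : young Y -> addable Y c ->
  rowprod (c |: Y) f * f (zbox c) = rowprod Y f * f (q2 * zbox c).
Proof.
move=> yY ac; rewrite /rowprod.
have := @prod_upd _ (fun i : 'I_r * 'I_n => f (rowend (c |: Y) i.1 i.2))
  (fun i : 'I_r * 'I_n => f (rowend Y i.1 i.2)) (c.1.1, c.1.2).
rewrite /= rowend_add// !eqxx /= rowend_addable//; apply => -[a x] ic.
rewrite /= rowend_add//; move: ic; rewrite xpair_eqE -[x == _]val_eqE /=.
by move=> /negbTE ->.
Qed.

Definition top_index c : 'I_r * 'I_n.+1 := (c.1.1, widen_ord (leqnSn n) c.1.2).

Lemma rowprod1_add Y c f : young Y -> addable Y c ->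
  rowprod1 (c |: Y) f * f (zbox c) = rowprod1 Y f * f (q2 * zbox c).
Proof.
move=> yY ac; rewrite /rowprod1.
have := @prod_upd _ (fun i : 'I_r * 'I_n.+1 => f (rowend (c |: Y) i.1 i.2))
  (fun i : 'I_r * 'I_n.+1 => f (rowend Y i.1 i.2)) (top_index c).
rewrite /= rowend_add// !eqxx /= rowend_addable//; apply => -[a x] ic.
rewrite /= rowend_add//; move: ic; rewrite xpair_eqE -[x == _]val_eqE /=.
by move=> /negbTE ->.
Qed.

Lemma prod_pair (I J : finType) (F : I -> J -> C) :
  \prod_i \prod_j F i j = \prod_(k : I * J) F k.1 k.2.
Proof. by rewrite pair_bigA. Qed.

Lemma rowprod_row Y f : rowprod Y f = \prod_(a < r) \prod_(0 <= x < n) f (rowend Y a x).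
Proof.
rewrite /rowprod -(prod_pair (fun a (x : 'I_n) => f (rowend Y a x))).
by apply: eq_bigr => a _; rewrite big_mkord.
Qed.

Lemma rowprod1_row Y f : rowprod1 Y f = \prod_(a < r) \prod_(0 <= x < n.+1) f (rowend Y a x).
Proof.
rewrite /rowprod1 -(prod_pair (fun a (x : 'I_n.+1) => f (rowend Y a x))).
by apply: eq_bigr => a _; rewrite big_mkord.
Qed.

Lemma rowend0 a x : rowend finset.set0 a x = u a * q1 ^+ x.
Proof. by rewrite /rowend rowlen0 /lat expr0 mulr1. Qed.

(** Adding a box replaces the row end X = [zbox c] by q2 X, in the numerator and in the denominator;
    the quotient changes by just the factor that [inner] attaches to the box. *)
Lemma inner_row Y z : young Y ->
  (forall a x y, (x <= n)%N -> (y <= n)%N -> z != lat a x y) ->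
  inner Y z = rowprod Y (fun x => z - q1 * x) / rowprod1 Y (fun x => z - x).
Proof.
move=> yY zl.
have zn a x y : (x <= n)%N -> (y <= n)%N -> z - lat a x y != 0.
  by move=> xn yn; rewrite subr_eq0 zl.
elim/young_ind: Y / yY => [|Y c yY ac IH].
  rewrite /inner [X in _ * X]big_pred0 ?mulr1; last by move=> b; rewrite inE.
  rewrite rowprod_row rowprod1_row -prodf_div; apply: eq_bigr => a _.
  rewrite [X in _ = _ / X]big_nat_recl// rowend0 expr0 mulr1.
  have E : \prod_(0 <= i < n) (z - rowend finset.set0 a i.+1) =
     \prod_(0 <= i < n) (z - q1 * rowend finset.set0 a i).
    by apply: eq_bigr => x _; rewrite !rowend0 exprS; congr (_ - _); ring.
  rewrite E invfM mulrCA divff ?mulr1// -E prodf_seq_neq0.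
  by apply/allP => x; rewrite mem_index_iota => /andP[_ xn]; rewrite /= /rowend rowlen0 zn.
have /andP[cY _] := ac.
have x0n : (c.1.2 < n)%N by [].
have y0n : (c.2 < n)%N by [].
have h1 : z - zbox c != 0 by apply: zn; exact: ltnW.
have h2 : z - q1 * zbox c != 0.
  have -> : q1 * zbox c = lat c.1.1 c.1.2.+1 c.2 by rewrite /zbox /lat exprS; ring.
  by apply: zn => //; exact: ltnW.
have h3 : z - q2 * zbox c != 0.
  have -> : q2 * zbox c = lat c.1.1 c.1.2 c.2.+1 by rewrite /zbox /lat exprS; ring.
  by apply: zn => //; exact: ltnW.
have h4 : rowprod1 Y (fun x => z - x) != 0.
  apply/prodf_neq0 => -[a x] _ /=; apply: zn; first by rewrite -ltnS.
  exact: rowlen_le.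
have e1 : rowprod (c |: Y) (fun x => z - q1 * x) =
   rowprod Y (fun x => z - q1 * x) * (z - q1 * (q2 * zbox c)) / (z - q1 * zbox c).
  by rewrite -(@rowprod_add Y c (fun x => z - q1 * x))// mulfK.
have e2 : rowprod1 (c |: Y) (fun x => z - x) =
   rowprod1 Y (fun x => z - x) * (z - q2 * zbox c) / (z - zbox c).
  by rewrite -(@rowprod1_add Y c (fun x => z - x))// mulfK.
rewrite e1 e2 /inner big_setU1//= mulrCA -/(inner Y z) IH.
by field; rewrite h1 h2 h3 h4.
Qed.

(** It suffices that b is nonzero: with 0^-1 = 0, inversion is multiplicative without conditions. *)
Lemma inv_ratio (a b c d : C) : b != 0 -> a * b = c * d -> a^-1 = c^-1 * d^-1 * b.
Proof. by move=> b0 E; rewrite -invfM -E invfM mulfVK. Qed.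

Lemma outer_row Y z : young Y ->
  (forall b, b \in Y -> [/\ q1 * z != zbox b, q2 * z != zbox b & q1 * q2 * z != zbox b]) ->
  (forall a x, (x < n)%N -> q2 * z != lat a x 0) ->
  outer Y z = rowprod Y (fun x => 1 - q2 * z / x) / rowprod1 Y (fun x => 1 - q1 * q2 * z / x).
Proof.
move=> yY + zl; elim/young_ind: Y / yY => [|Y c yY ac IH] zY.
  rewrite /outer [X in _ * X]big_pred0 ?mulr1; last by move=> b; rewrite inE.
  rewrite rowprod_row rowprod1_row -prodf_div; apply: eq_bigr => a _.
  rewrite [X in _ = _ / X]big_nat_recl// rowend0 expr0 mulr1.
  have E : \prod_(0 <= i < n) (1 - q1 * q2 * z / rowend finset.set0 a i.+1) =
     \prod_(0 <= i < n) (1 - q2 * z / rowend finset.set0 a i).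
    apply: eq_bigr => x _; rewrite !rowend0 exprS; congr (_ - _); field.
    by rewrite q1_neq0 u_neq0 expf_neq0.
  rewrite E invfM mulrCA divff ?mulr1// prodf_seq_neq0.
  apply/allP => x; rewrite mem_index_iota => /andP[_ xn]; rewrite /= /rowend rowlen0.
  rewrite subr_eq0 eq_sym; apply: contra (zl a x xn) => /eqP E1.
  by rewrite -[X in X == _](mulfVK (lat_neq0 a x 0)) E1 mul1r.
have /andP[cY _] := ac.
have [h1 h2 h3] := zY c (setU11 _ _).
have X0 : zbox c != 0 by exact: lat_neq0.
have nz t : t != zbox c -> 1 - t / zbox c != 0.
  move=> tX; rewrite subr_eq0 eq_sym; apply: contra tX => /eqP E1.
  by rewrite -[t](mulfVK X0) E1 mul1r.
have e1 : rowprod (c |: Y) (fun x => 1 - q2 * z / x) =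
   rowprod Y (fun x => 1 - q2 * z / x) * (1 - q2 * z / (q2 * zbox c)) / (1 - q2 * z / zbox c).
  by rewrite -(@rowprod_add Y c (fun x => 1 - q2 * z / x))// mulfK// nz.
have e2 := inv_ratio (nz _ h3) (@rowprod1_add Y c (fun x => 1 - q1 * q2 * z / x) yY ac).
rewrite e1 e2 /outer big_setU1//= mulrCA -/(outer Y z) IH; last first.
  by move=> b bY; apply: zY; rewrite !inE bY orbT.
have g1 : 1 - q1 * q2 * z / (q2 * zbox c) != 0.
  have -> : q1 * q2 * z / (q2 * zbox c) = q1 * z / zbox c by field; rewrite X0.
  exact: nz.
have k1 : zbox c - q1 * z != 0 by rewrite subr_eq0 eq_sym.
have k2 : zbox c - q2 * z != 0 by rewrite subr_eq0 eq_sym.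
have k3 : zbox c - q1 * q2 * z != 0 by rewrite subr_eq0 eq_sym.
move: (rowprod1 _ _)^-1 => I1.
have f1 : q2 * zbox c - q1 * q2 * z != 0.
  have -> : q2 * zbox c - q1 * q2 * z = q2 * (zbox c - q1 * z) by ring.
  by rewrite mulf_neq0.
by field; rewrite ?k1 ?k2 ?k3 ?X0 ?q2_neq0 ?f1.
Qed.

Lemma rowlen_add Y c : addable Y c ->
  forall x, rowlen (c |: Y) c.1.1 x = (rowlen Y c.1.1 x + (x == c.1.2))%N.
Proof. by move=> /andP[cY _] x; rewrite rowlen_setU1// eqxx [_ == x]eq_sym. Qed.

Lemma collen_add Y c : addable Y c ->
  forall y, collen (c |: Y) c.1.1 y = (collen Y c.1.1 y + (y == c.2))%N.
Proof. by move=> /andP[cY _] x; rewrite collen_setU1// eqxx [_ == x]eq_sym. Qed.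

Lemma rowlen_add_neq Y c a : addable Y c -> a != c.1.1 ->
  rowlen (c |: Y) a = rowlen Y a /\ collen (c |: Y) a = collen Y a.
Proof.
move=> /andP[cY _] ac; split; apply: funext => x.
- by rewrite rowlen_setU1// eq_sym (negbTE ac) addn0.
- by rewrite collen_setU1// eq_sym (negbTE ac) addn0.
Qed.

Lemma intS1 (x : nat) : x%:Z + 1 = x.+1%:Z.
Proof. by lia. Qed.

Lemma term_outer Y c a (x : nat) :
  1 - u c.1.1 / u a * q1 ^ ((c.1.2 : nat)%:Z - x%:Z) *
      q2 ^ ((c.2 : nat)%:Z + 1 - (rowlen Y a x)%:Z) =
  1 - q2 * zbox c / rowend Y a x.
Proof.
rewrite intS1 lat_ratio; congr (1 - _ / _).
by rewrite /zbox /lat exprS; ring.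
Qed.

Lemma term_outer1 Y c a (x : nat) :
  1 - u c.1.1 / u a * q1 ^ ((c.1.2 : nat)%:Z + 1 - x%:Z) *
      q2 ^ ((c.2 : nat)%:Z + 1 - (rowlen Y a x)%:Z) =
  1 - q1 * q2 * zbox c / rowend Y a x.
Proof.
rewrite !intS1 lat_ratio; congr (1 - _ / _).
by rewrite /zbox /lat !exprS; ring.
Qed.

Lemma term_inner Y c a (x : nat) :
  1 - u a / u c.1.1 * q1 ^ (x%:Z + 1 - (c.1.2 : nat)%:Z) *
      q2 ^ ((rowlen Y a x)%:Z - (c.2 : nat)%:Z) =
  1 - q1 * rowend Y a x / zbox c.
Proof.
rewrite intS1 lat_ratio; congr (1 - _ / _).
by rewrite /rowend /lat exprS; ring.
Qed.

Lemma term_inner1 Y c a (x : nat) :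
  1 - u a / u c.1.1 * q1 ^ (x%:Z - (c.1.2 : nat)%:Z) *
      q2 ^ ((rowlen Y a x)%:Z - (c.2 : nat)%:Z) =
  1 - rowend Y a x / zbox c.
Proof. by rewrite lat_ratio. Qed.

Lemma prod_cat (T : Type) (s t : seq T) (h : T -> C) :
  \prod_(e <- s ++ t) h e = (\prod_(e <- s) h e) * \prod_(e <- t) h e.
Proof. by rewrite big_cat. Qed.

Lemma Nfac_addl Y c a : young Y -> addable Y c -> a != c.1.1 ->
  Nfac (c |: Y) c.1.1 a * \prod_(0 <= x < n) (1 - q2 * zbox c / rowend Y a x) =
  Nfac Y c.1.1 a * \prod_(0 <= x < n.+1) (1 - q1 * q2 * zbox c / rowend Y a x).
Proof.
move=> yY ac aneq; have /andP[cY yc] := ac.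
have P := armleg_addl (young_shape c.1.1 yY) (young_shape c.1.1 yc) (young_shape a yY)
  (ltn_ord c.1.2) (ltn_ord c.2) (addable_row yY ac) (addable_col yY ac)
  (rowlen_add ac) (collen_add ac).
have [E1 E2] := rowlen_add_neq ac aneq; rewrite /Nfac E1 E2.
pose F (e : int * int) : C := 1 - u c.1.1 / u a * q1 ^ e.1 * q2 ^ e.2.
have := perm_big _ P (F := F) (P := xpredT) (x := 1) (op := *%R).
rewrite prod_cat big_map => H.
have G1 : \prod_(0 <= x < n) (1 - q2 * zbox c / rowend Y a x) =
  \prod_(0 <= x < n) F ((c.1.2 : nat)%:Z - x%:Z, (c.2 : nat)%:Z + 1 - (rowlen Y a x)%:Z).
  by apply: eq_bigr => x _; rewrite -term_outer.
rewrite G1 [LHS]H prod_cat big_map; congr (_ * _).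
by apply: eq_bigr => x _; rewrite -term_outer1.
Qed.

Lemma Nfac_addr Y c a : young Y -> addable Y c -> a != c.1.1 ->
  Nfac (c |: Y) a c.1.1 * \prod_(0 <= x < n) (1 - q1 * rowend Y a x / zbox c) =
  Nfac Y a c.1.1 * \prod_(0 <= x < n.+1) (1 - rowend Y a x / zbox c).
Proof.
move=> yY ac aneq; have /andP[cY yc] := ac.
have P := armleg_addr (young_shape a yY) (young_shape c.1.1 yY) (young_shape c.1.1 yc)
  (ltn_ord c.1.2) (ltn_ord c.2) (addable_row yY ac) (addable_col yY ac)
  (rowlen_add ac) (collen_add ac).
have [E1 E2] := rowlen_add_neq ac aneq; rewrite /Nfac E1 E2.
pose F (e : int * int) : C := 1 - u a / u c.1.1 * q1 ^ e.1 * q2 ^ e.2.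
have := perm_big _ P (F := F) (P := xpredT) (x := 1) (op := *%R).
rewrite prod_cat big_map => H.
have G1 : \prod_(0 <= x < n) (1 - q1 * rowend Y a x / zbox c) =
  \prod_(0 <= x < n) F (x%:Z + 1 - (c.1.2 : nat)%:Z, (rowlen Y a x)%:Z - (c.2 : nat)%:Z).
  by apply: eq_bigr => x _; rewrite -term_inner.
rewrite G1 [LHS]H prod_cat big_map; congr (_ * _).
by apply: eq_bigr => x _; rewrite -term_inner1.
Qed.

(** The index x = c.1.2 is left out because row c.1.2 ends exactly at [zbox c]; the same factor is
    removed from the denominator by taking the residue. *)
Lemma Nfac_add Y c : young Y -> addable Y c ->
  Nfac (c |: Y) c.1.1 c.1.1 *
    ((\prod_(0 <= x < n) (1 - q2 * zbox c / rowend Y c.1.1 x)) *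
     ((\prod_(0 <= x < n) (1 - q1 * rowend Y c.1.1 x / zbox c)) * (1 - q1 * q2))) =
  Nfac Y c.1.1 c.1.1 *
    ((\prod_(0 <= x < n.+1) (1 - q1 * q2 * zbox c / rowend Y c.1.1 x)) *
     ((\prod_(0 <= x < n.+1 | x != c.1.2) (1 - rowend Y c.1.1 x / zbox c)) *
      ((1 - q1) * (1 - q2)))).
Proof.
move=> yY ac; have /andP[cY yc] := ac.
have P := armleg_add (young_shape c.1.1 yY) (young_shape c.1.1 yc)
  (ltn_ord c.1.2) (ltn_ord c.2) (addable_row yY ac) (addable_col yY ac)
  (rowlen_add ac) (collen_add ac).
pose F (e : int * int) : C := 1 - u c.1.1 / u c.1.1 * q1 ^ e.1 * q2 ^ e.2.
have H := perm_big _ P (F := F) (P := xpredT) (x := 1) (op := *%R).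
have F11 : F (1, 1) = 1 - q1 * q2 by rewrite /F divff// mul1r.
have F10 : F (1, 0) = 1 - q1 by rewrite /F divff// mul1r mulr1.
have F01 : F (0, 1) = 1 - q2 by rewrite /F divff// mul1r mul1r.
have G1 : \prod_(0 <= x < n) (1 - q2 * zbox c / rowend Y c.1.1 x) =
  \prod_(0 <= x < n) F ((c.1.2 : nat)%:Z - x%:Z, (c.2 : nat)%:Z + 1 - (rowlen Y c.1.1 x)%:Z).
  by apply: eq_bigr => x _; rewrite -term_outer.
have G2 : \prod_(0 <= x < n) (1 - q1 * rowend Y c.1.1 x / zbox c) =
  \prod_(0 <= x < n) F (x%:Z + 1 - (c.1.2 : nat)%:Z, (rowlen Y c.1.1 x)%:Z - (c.2 : nat)%:Z).
  by apply: eq_bigr => x _; rewrite -term_inner.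
rewrite G1 G2 -F11.
transitivity (\prod_(e <- armleg n (rowlen (c |: Y) c.1.1) (collen (c |: Y) c.1.1)
    (rowlen (c |: Y) c.1.1) (collen (c |: Y) c.1.1) ++
  ([seq ((c.1.2 : nat)%:Z - x%:Z, (c.2 : nat)%:Z + 1 - (rowlen Y c.1.1 x)%:Z)
      | x <- index_iota 0 n] ++
   [seq (x%:Z + 1 - (c.1.2 : nat)%:Z, (rowlen Y c.1.1 x)%:Z - (c.2 : nat)%:Z)
      | x <- index_iota 0 n] ++ [:: (1, 1)])) F e).
  rewrite [RHS]prod_cat [X in _ = _ * X]prod_cat [X in _ = _ * (_ * X)]prod_cat.
  by rewrite 2!big_map big_seq1.
rewrite [LHS]H.
rewrite [LHS]prod_cat [X in _ * X = _]prod_cat [X in _ * (_ * X) = _]prod_cat.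
congr (_ * _); rewrite big_map; congr (_ * _).
  by apply: eq_bigr => x _; rewrite -term_outer1.
rewrite big_map big_filter; congr (_ * _).
  by apply: eq_bigr => x _; rewrite -term_inner1.
by rewrite big_cons big_seq1 F10 F01.
Qed.

Lemma Nprod_add Y c : young Y -> addable Y c ->
  (\prod_(a < r) \prod_(a' < r) Nfac (c |: Y) a a') *
    (rowprod Y (fun x => 1 - q2 * zbox c / x) *
     (rowprod Y (fun x => 1 - q1 * x / zbox c) * (1 - q1 * q2))) =
  (\prod_(a < r) \prod_(a' < r) Nfac Y a a') *
    (rowprod1 Y (fun x => 1 - q1 * q2 * zbox c / x) *
     (rowprod1D Y c (fun x => 1 - x / zbox c) * ((1 - q1) * (1 - q2)))).
Proof.
move=> yY ac; pose a0 := c.1.1.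
pose P1 (Z : {set box r n}) := \prod_(a | a != a0) Nfac Z a0 a.
pose P2 (Z : {set box r n}) := \prod_(a | a != a0) Nfac Z a a0.
pose P3 (Z : {set box r n}) := \prod_(a | a != a0) \prod_(a' | a' != a0) Nfac Z a a'.
pose g0 f := \prod_(0 <= x < n) f (rowend Y a0 x) : C.
pose g f := \prod_(a | a != a0) \prod_(0 <= x < n) f (rowend Y a x) : C.
pose h0 f := \prod_(0 <= x < n.+1) f (rowend Y a0 x) : C.
pose h f := \prod_(a | a != a0) \prod_(0 <= x < n.+1) f (rowend Y a x) : C.
pose f1 x := 1 - q2 * zbox c / x.
pose f2 x := 1 - q1 * x / zbox c.
pose f3 x := 1 - q1 * q2 * zbox c / x.
pose f4 x := 1 - x / zbox c.
pose k := \prod_(0 <= x < n.+1 | x != c.1.2) f4 (rowend Y a0 x).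
(* Pairs of components are sorted by whether they contain the component a0 of c: in both places, in
   the first, in the second, or in neither, where nothing changes. *)
have split_N Z : \prod_(a < r) \prod_(a' < r) Nfac Z a a' =
    (Nfac Z a0 a0 * P1 Z) * (P2 Z * P3 Z).
  rewrite (bigD1 a0)//= (bigD1 a0)//= -big_split; congr (_ * _).
  by apply: eq_bigr => a _; rewrite (bigD1 a0).
have rp f : rowprod Y f = g0 f * g f by rewrite rowprod_row (bigD1 a0).
have rp1 f : rowprod1 Y f = h0 f * h f by rewrite rowprod1_row (bigD1 a0).
have e1 : P1 (c |: Y) * g f1 = P1 Y * h f3.
  by rewrite -!big_split; apply: eq_bigr => a aa; exact: Nfac_addl.
have e2 : P2 (c |: Y) * g f2 = P2 Y * h f4.
  by rewrite -!big_split; apply: eq_bigr => a aa; exact: Nfac_addr.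
have e3 : Nfac (c |: Y) a0 a0 * (g0 f1 * (g0 f2 * (1 - q1 * q2))) =
    Nfac Y a0 a0 * (h0 f3 * (k * ((1 - q1) * (1 - q2)))) by exact: Nfac_add.
have e4 : P3 (c |: Y) = P3 Y.
  apply: eq_bigr => a aa; apply: eq_bigr => a' aa'.
  have [E1 E2] := rowlen_add_neq ac aa; have [E3 E4] := rowlen_add_neq ac aa'.
  by rewrite /Nfac E1 E2 E3 E4.
have e5 : rowprod1D Y c f4 = k * h f4.
  rewrite /rowprod1D.
  rewrite -(pair_big_dep xpredT
    (fun a (x : 'I_n.+1) => ~~ ((a == a0) && (x == c.1.2 :> nat)))
    (fun a (x : 'I_n.+1) => f4 (rowend Y a x))) /= (bigD1 a0)//=.
  congr (_ * _).
    by rewrite /k big_mkord; apply: eq_bigl => x; rewrite eqxx.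
  apply: eq_bigr => a aa; rewrite big_mkord; apply: eq_bigl => x.
  by rewrite (negbTE aa).
rewrite -/f1 -/f2 -/f3 -/f4 !split_N e4 e5 !rp rp1.
transitivity ((Nfac (c |: Y) a0 a0 * (g0 f1 * (g0 f2 * (1 - q1 * q2)))) *
  (P1 (c |: Y) * g f1) * (P2 (c |: Y) * g f2) * P3 Y).
  by clearbody P1 P2 P3 g0 g f1 f2; ring.
by rewrite e1 e2 e3; clearbody P1 P2 P3 h0 h f3 f4 k; ring.
Qed.

Lemma wt_outer_neq0 Y c : young Y -> addable Y c -> (#|Y| < n)%N ->
  rowprod Y (fun x => 1 - q2 * zbox c / x) != 0.
Proof.
move=> yY ac Yn; apply/prodf_neq0 => -[a x] _ /=; rewrite subr_eq0 eq_sym.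
apply/negP => /eqP E.
have {E} : lat c.1.1 c.1.2 c.2.+1 = lat a x (rowlen Y a x).
  rewrite -[RHS]mul1r -E mulfVK ?lat_neq0// /zbox /lat exprS; ring.
have rl := leq_ltn_trans (rowlen_le_card Y a x) Yn.
have h2 := ltn_ord c.2; have h1 := ltn_ord c.1.2; have xn := ltn_ord x.
move/lat_inj => H; case: H.
- by clear -h1; lia.
- by clear -xn; lia.
- by clear -h2; lia.
- by clear -rl; lia.
- by apply/orP; left; clear -h1 xn; lia.
move=> ea ex; rewrite -ea -ex addable_row// => /eqP.
by rewrite -[X in _ == X]addn0 -addn1 eqn_add2l.
Qed.

Lemma wt_inner_neq0 Y c : young Y -> addable Y c -> (#|Y| < n)%N ->
  rowprod Y (fun x => 1 - q1 * x / zbox c) != 0.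
Proof.
move=> yY ac Yn; apply/prodf_neq0 => -[a x] _ /=; rewrite subr_eq0 eq_sym.
apply/negP => /eqP E.
have {E} : lat a x.+1 (rowlen Y a x) = lat c.1.1 c.1.2 c.2.
  by rewrite -[RHS]mul1r -/(zbox c) -E mulfVK ?lat_neq0// /rowend /lat exprS; ring.
have rl := leq_ltn_trans (rowlen_le_card Y a x) Yn.
have h2 := ltn_ord c.2; have h1 := ltn_ord c.1.2; have xn := ltn_ord x.
move/lat_inj => H; case: H.
- by clear -xn; lia.
- by clear -h1; lia.
- by clear -rl; lia.
- by clear -h2; lia.
- by apply/orP; right; apply/orP; left; clear -h2 rl; lia.
(* A zero would mean that row x just above c ends in the column of c; but c is addable, so this row
   contains a box in that column. *)
move=> ea ex ey; have /andP[cY yc] := ac.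
have : (c.1.1, x, c.2) \in c |: Y.
  by apply: (youngP _ yc c) => //=; [exact: setU11|rewrite -ex].
rewrite !inE => /orP[/eqP E|].
  by move: ex; rewrite -E /= => /eqP; rewrite -[X in _ == X]addn0 -addn1 eqn_add2l.
by rewrite young_row// -ea ey ltnn.
Qed.

Lemma addable_lat_neq Y c b (x y : nat) : young Y -> addable Y c -> b \in Y ->
  (c.1.2 <= x <= c.1.2.+1)%N -> (c.2 <= y <= c.2.+1)%N -> lat c.1.1 x y != zbox b.
Proof.
move=> yY /andP[cY _] bY /andP[x1 x2] /andP[y1 y2]; apply/negP => /eqP.
have h1 := ltn_ord b.2; have h2 := ltn_ord b.1.2.
have h3 := ltn_ord c.2; have h4 := ltn_ord c.1.2.
have cb (x' y' : nat) : b.1.1 = c.1.1 -> x = b.1.2 -> y = b.2 -> False.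
  move=> e1 e2 e3; move/negP: cY; apply.
  by apply: (youngP _ yY _ _ bY) => //; rewrite -?e2 -?e3.
move: cb; rewrite /zbox; move: h1 h2.
move: (nat_of_ord b.2) (nat_of_ord b.1.2) (b.1.1) => by_ bx ba h1 h2 cb.
move/lat_inj => H; case: H => [|||||e1 e2 e3]; last exact: (cb 0%N 0%N).
- by clear -x2 h2 h4; lia.
- by clear -x1 h2 h4; lia.
- by clear -y2 h1 h3; lia.
- by clear -y1 h1 h3; lia.
- apply/orP; have [->|xn] := eqVneq x (c.1.2 : nat).
    by left; clear -h2 h4; lia.
  have {xn} e : x = c.1.2.+1 by clear -x1 x2 xn; lia.
  (* If b lies in row 0, the rows may differ by exactly n. Then the columns decide: they are
     strictly within n of each other, or b precedes the point in both coordinates. *)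
  rewrite e; have [b0|b0] := eqVneq bx 0%N; last first.
    by left; clear -b0 h2 h4; lia.
  right; rewrite b0; have [yb|yb] := leqP y by_; last first.
    by rewrite (ltnW yb) /= !orbT.
  by clear -y1 y2 h1 h3 yb; lia.
Qed.

Lemma addable_outer Y c : young Y -> addable Y c ->
  outer Y (zbox c) = rowprod Y (fun x => 1 - q2 * zbox c / x) /
    rowprod1 Y (fun x => 1 - q1 * q2 * zbox c / x).
Proof.
move=> yY ac.
have s1 : q1 * zbox c = lat c.1.1 c.1.2.+1 c.2 by rewrite /zbox /lat exprS; ring.
have s2 : q2 * zbox c = lat c.1.1 c.1.2 c.2.+1 by rewrite /zbox /lat exprS; ring.
have s12 : q1 * q2 * zbox c = lat c.1.1 c.1.2.+1 c.2.+1.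
  by rewrite /zbox /lat !exprS; ring.
apply: outer_row => //.
  by move=> b bY; rewrite s1 s2 s12; split; apply: (addable_lat_neq yY ac bY);
    rewrite ?leqnn ?leqnSn.
move=> a x xn; rewrite s2; apply/negP => /eqP.
have h3 := ltn_ord c.2; have h4 := ltn_ord c.1.2.
move/lat_inj => H; case: H => [|||||_ _ //].
- by clear -h4; lia.
- by clear -xn; lia.
- by clear -h3; lia.
- by [].
- by apply/orP; left; clear -xn h4; lia.
Qed.

(** Multiplying an integral by the weight of Y turns every residue into the weight of the larger
    tuple. The descent uses the explicit weights through this recursion and the value 1 for the
    vacuum. *)
Lemma wt_add Y c : young Y -> addable Y c -> (#|Y| < n)%N ->
  wt (c |: Y) = rho Y c * wt Y.
Proof.
move=> yY ac Yn; have /andP[cY yc] := ac.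
have q12 : 1 - q1 * q2 != 0.
  by rewrite subr_eq0 eq_sym; have := @q_pow_neq1 1 1 isT; rewrite !expr1.
have n1 := wt_outer_neq0 yY ac Yn.
have n2 := wt_inner_neq0 yY ac Yn.
have z0 : zbox c != 0 by exact: lat_neq0.
have outerE := addable_outer yY ac.
have E := inv_ratio (mulf_neq0 n1 (mulf_neq0 n2 q12)) (Nprod_add yY ac).
rewrite /wt big_setU1//= E /rho outerE.
have r0 : (0 < r)%N by apply: leq_ltn_trans (ltn_ord c.1.1).
have p1 : rowprod Y (fun x => zbox c - q1 * x) =
    zbox c ^+ (r * n) * rowprod Y (fun x => 1 - q1 * x / zbox c).
  rewrite /rowprod -[(r * n)%N](_ : #|{: 'I_r * 'I_n}| = _); last first.
    by rewrite card_prod !card_ord.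
  rewrite -prodr_const -big_split /=; apply: eq_bigr => i _.
  by rewrite mulrBr mulr1 [in RHS]mulrCA divff// mulr1.
have p2 : rowprod1D Y c (fun x => zbox c - x) =
    zbox c ^+ (r * n.+1).-1 * rowprod1D Y c (fun x => 1 - x / zbox c).
  rewrite /rowprod1D.
  have -> : (r * n.+1).-1 =
    #|[pred i : 'I_r * 'I_n.+1 | ~~ ((i.1 == c.1.1) && (i.2 == c.1.2 :> nat))]|.
    have -> : (r * n.+1 = #|{: 'I_r * 'I_n.+1}|)%N by rewrite card_prod !card_ord.
    rewrite (cardD1 (top_index c)) /=; apply: eq_card => i; rewrite !inE andbT.
    by case: i => a x; rewrite xpair_eqE -[x == _]val_eqE.
  rewrite -prodr_const -big_split /=; apply: eq_bigr => i _.
  by rewrite mulrBr mulr1 [in RHS]mulrCA divff// mulr1.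
(* Passing from z - X to 1 - X / z costs one power of z per row: r n above and r (n + 1) - 1 below.
   The factor z^(r-1) of the one-body function makes up the difference. *)
have p3 : zbox c ^+ r.-1 * (zbox c ^+ (r * n)) = zbox c ^+ (r * n.+1).-1.
  have r_gt0 := leq_ltn_trans (leq0n _) (ltn_ord c.1.1).
  by rewrite -exprD; congr (_ ^+ _); case: (r) r_gt0 => // k _; rewrite mulnS.
rewrite p1 p2 -p3 !invfM.
have zr : zbox c ^+ r.-1 != 0 by rewrite expf_neq0.
have zrn : zbox c ^+ (r * n) != 0 by rewrite expf_neq0.
move: (rowprod1 _ _)^-1 (rowprod1D _ _ _)^-1 (\prod_(_ < r) _)^-1 => I1 I2 I3.
have nq1 : 1 - q1 != 0.
  by rewrite subr_eq0 eq_sym; have := @q_pow_neq1 1 0 isT; rewrite expr1 expr0 mulr1.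
have nq2 : 1 - q2 != 0.
  by rewrite subr_eq0 eq_sym; have := @q_pow_neq1 0 1 isT; rewrite expr1 expr0 mul1r.
by field; rewrite nq1 nq2 zr zrn.
Qed.

End Weights.

(** * Partial fractions *)

Section PartialFractions.
Variable F : fieldType.

(** Subtracting from P the multiple of the remaining denominator that agrees with it at a leaves a
    polynomial divisible by X - a. The factor Q is never split: in the application its zeros lie
    away from the level. *)
Lemma partial_fractions (s : seq F) (P Q : {poly F}) :
  uniq s -> {in s, forall a, Q.[a] != 0} ->
  exists P' : {poly F}, forall z, z \notin s -> Q.[z] != 0 ->
    P.[z] / ((\prod_(a <- s) (z - a)) * Q.[z]) =
    \sum_(a <- s) P.[a] / ((\prod_(b <- s | b != a) (a - b)) * Q.[a]) / (z - a)
    + P'.[z] / Q.[z].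
Proof.
elim: s P => [|a s IH] P; first by exists P => z _ _; rewrite !big_nil mul1r add0r.
move=> /= /andP[ans us] Qs.
have Qa : Q.[a] != 0 by apply: Qs; rewrite inE eqxx.
have nab b : b \in s -> b != a by move=> bs; apply: contraNneq ans => <-.
pose Q1 := Q * \prod_(b <- s) ('X - b%:P).
have Q1E z : Q1.[z] = (\prod_(b <- s) (z - b)) * Q.[z].
  rewrite hornerM mulrC horner_prod; congr (_ * _).
  by apply: eq_bigr => b _; rewrite hornerXsubC.
have Ds z : z \notin s -> \prod_(b <- s) (z - b) != 0.
  move=> zs; rewrite prodf_seq_neq0; apply/allP => b bs /=; rewrite subr_eq0.
  by apply: contraNneq zs => ->.
have Q1a : Q1.[a] != 0 by rewrite Q1E mulf_neq0 ?Ds.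
pose k := P.[a] / Q1.[a].
have [P1 P1E] : exists P1, P - k *: Q1 = P1 * ('X - a%:P).
  by apply/factor_theorem; rewrite /root hornerD hornerN hornerZ /k mulfVK// subrr.
have [P' P'E] := IH P1 us (fun b bs => Qs b (mem_behead (s := a :: s) bs)).
exists P' => z; rewrite inE negb_or => /andP[za zs] Qz.
have za0 : z - a != 0 by rewrite subr_eq0.
have P1z w : P.[w] = k * Q1.[w] + P1.[w] * (w - a).
  have -> : P = k *: Q1 + P1 * ('X - a%:P) by rewrite -P1E addrC subrK.
  by rewrite hornerD hornerZ [X in _ + X]hornerM hornerXsubC.
have := P'E z zs Qz; set S := \sum_(_ <- s) _ => E.
rewrite !big_cons eqxx /=.
have -> : \prod_(b <- s | b != a) (a - b) = \prod_(b <- s) (a - b).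
  rewrite big_mkcond /= [LHS]big_seq [RHS]big_seq; apply: eq_bigr => b bs.
  by rewrite nab.
rewrite -[X in _ / X / _]Q1E -/k.
have -> : \sum_(b <- s) P.[b] / ((\prod_(b' <- a :: s | b' != b) (b - b')) * Q.[b]) / (z - b) = S.
  rewrite /S [LHS]big_seq [RHS]big_seq; apply: eq_bigr => b bs; congr (_ / _).
  rewrite big_cons eq_sym (nab b bs) P1z Q1E.
  have -> : \prod_(b' <- s) (b - b') = 0.
    by apply/eqP; rewrite prodf_seq_eq0; apply/hasP; exists b => //=; rewrite subrr eqxx.
  rewrite mul0r mulr0 add0r.
  have ba : b - a != 0 by rewrite subr_eq0 nab.
  by rewrite -[(b - a) * _ * Q.[b]]mulrA [in LHS]invfM mulrA mulfK.
rewrite -addrA -E P1z Q1E; field.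
by rewrite Qz za0 Ds.
Qed.

End PartialFractions.

(** * Closure properties for functions of one variable *)

Section OneVariableGood.
Variable R : realType.
Local Notation C := R[i].
Implicit Types (A : C -> Prop) (f g : C -> C).

Lemma good1_ext A f g : (forall x, A x -> f x = g x) -> good1 A f -> good1 A g.
Proof.
by move=> fg gf D j D0 Dj DA; apply: good_ext (gf D j D0 Dj DA) => z /DA/fg.
Qed.

Lemma good1_cst A (c : C) : good1 A (fun=> c).
Proof. by move=> D j D0 _ _; exact: good_cst. Qed.

Lemma good1M A f g : good1 A f -> good1 A g -> good1 A (fun x => f x * g x).
Proof. by move=> gf gg D j D0 Dj DA; apply: goodM; [exact: gf|exact: gg]. Qed.

Lemma good1B A f g : good1 A f -> good1 A g -> good1 A (fun x => f x - g x).
Proof. by move=> gf gg D j D0 Dj DA; apply: goodB; [exact: gf|exact: gg]. Qed.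

Lemma good1_id A (B : R) : (forall x, A x -> normc x <= B) -> good1 A id.
Proof. by move=> AB D j D0 Dj DA; apply: (@good_coord _ _ _ B) => // z /DA/AB. Qed.

Lemma good1X A f k : good1 A f -> good1 A (fun x => f x ^+ k).
Proof. by move=> gf D j D0 Dj DA; apply: goodX; exact: gf. Qed.

Lemma good1_prod A (I : eqType) (s : seq I) (P : pred I) (G : I -> C -> C) :
  (forall i, i \in s -> P i -> good1 A (G i)) ->
  good1 A (fun x => \prod_(i <- s | P i) G i x).
Proof.
by move=> HG D j D0 Dj DA; apply: good_prod => // i si Pi; exact: HG.
Qed.

Lemma good1_poly A (B : R) (P : {poly C}) : (forall x, A x -> normc x <= B) ->
  good1 A (fun x => P.[x]).
Proof.
move=> AB D j D0 Dj DA.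
apply: (@good_ext _ _ (fun z => \sum_(i < size P) P`_i * nth 0 z j ^+ i)).
  by move=> z _; rewrite horner_coef.
apply: good_sum => // i _; apply: goodZ; apply: goodX.
exact: (good1_id AB).
Qed.

Lemma good1_affineV A (B th : R) (c d : C) : (forall x, A x -> normc x <= B) ->
  th < 1 -> c != 0 -> (forall x, A x -> normc (d * x) <= th * normc c) ->
  good1 A (fun x => (c - d * x)^-1).
Proof.
move=> AB th1 c0 h D j D0 Dj DA; apply: (@good_subV _ _ (fun=> c) _ th) => //.
- exact: good_cst.
- by apply: goodZ; exact: (good1_id AB).
- exact: good_cst.
- by move=> z Dz; apply: h; exact: DA.
Qed.

End OneVariableGood.

(** * Descent through the radii *)

Section Levels.
Variables (R : realType) (r n S : nat).
Local Notation C := R[i].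
Variables (q1 q2 : C) (u : 'I_r -> C) (p : 'I_S -> C).
Local Notation pt := (lat q1 q2 u).
Local Notation ptb := (zbox q1 q2 u).
Local Notation pte := (rowend q1 q2 u).
Local Notation inn := (inner q1 q2 u).
Local Notation outr := (outer q1 q2 u).
Local Notation res := (rho q1 q2 u p).
Local Notation wgt := (wt q1 q2 u p).
Local Notation T := ((2 * pi)%:C * 'i : C).
Local Notation rowidx := ('I_r * 'I_n.+1)%type.
Implicit Types (Y : {set box r n}) (a : 'I_r) (z : C) (c : box r n).

Hypotheses (q1_neq0 : q1 != 0) (q2_neq0 : q2 != 0).
Hypotheses (q1_disk : normc q1 < 1) (q2_disk : normc q2 < 1).
Hypothesis (u_neq0 : forall a, u a != 0).
Hypothesis (u_generic : forall (a b : 'I_r) (x y : int), a != b ->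
     - n%:Z <= x <= n%:Z -> - n%:Z <= y <= n%:Z ->
     u a * (u b)^-1 != q1 ^ x * q2 ^ y).
Hypothesis (q_generic : forall x y : nat, (x < n)%N -> (y < n)%N ->
     q1 ^+ x != q2 ^+ y.+1 /\ q1 ^+ x.+1 != q2 ^+ y).

(* The one-body function left after residues have been taken at the boxes of Y. *)
Definition onebody Y z : C :=
  (1 - q1 * q2) / ((1 - q1) * (1 - q2)) / T * (\prod_(m < S) (z - p m)) * z ^+ r.-1
  * (inn Y z * outr Y z).

Lemma onebody_add Y c : c \notin Y ->
  onebody (c |: Y) = (fun z => onebody Y z * kap q1 q2 (ptb c) z).
Proof.
move=> cY; apply: funext => z.
rewrite /onebody /inner /outer !big_setU1//= /kap !invfM.
by ring.
Qed.

(** The poles of the one-body function are simple. Row lengths are below n because Y has fewer than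
    n boxes; this gives the strict bound on columns in [lat_inj]. *)
Lemma rowend_inj Y : young Y -> (#|Y| < n)%N ->
  injective (fun i : 'I_r * 'I_n.+1 => pte Y i.1 i.2).
Proof.
move=> yY Yn [a x] [a' x'] /=.
have h1 := ltn_ord x; have h2 := ltn_ord x'.
have h3 := leq_ltn_trans (rowlen_le_card Y a x) Yn.
have h4 := leq_ltn_trans (rowlen_le_card Y a' x') Yn.
move/(lat_inj q1_neq0 q2_neq0 q1_disk q2_disk u_neq0 u_generic q_generic) => H.
case: H => [|||||-> e _].
- by clear -h1; lia.
- by clear -h2; lia.
- by clear -h3; lia.
- by clear -h4; lia.
- by apply/orP; right; apply/orP; left; clear -h3 h4; lia.
by congr (_, _); apply: val_inj.
Qed.

(** If row x + 1 is as long as row x, its end is q1 times the end of row x and the numerator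
    vanishes. Otherwise the row end is an addable box, and its row index is below n because Y has
    fewer than n boxes. *)
Lemma noncorner_zero Y (i : 'I_r * 'I_n.+1) : young Y -> (#|Y| < n)%N ->
  (forall c, addable Y c -> top_index c != i) ->
  \prod_(j : 'I_r * 'I_n) (pte Y i.1 i.2 - q1 * pte Y j.1 j.2) = 0.
Proof.
case: i => a x yY Yn Hc /=.
have rx := leq_ltn_trans (rowlen_le_card Y a x) Yn.
have corner (xn : (x < n)%N) :
    (forall x', x = x'.+1 :> nat -> (rowlen Y a x < rowlen Y a x')%N) -> False.
  move=> h; have := Hc (a, Ordinal xn, Ordinal rx).
  rewrite addable_corner//= => /(_ isT)/negP; apply.
  by rewrite /top_index /= xpair_eqE eqxx -val_eqE /=.
case: x rx corner {Hc} => -[|x] xlt /= rx corner.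
  by exfalso; apply: corner => //; apply: leq_ltn_trans Yn.
have sY := young_shape a yY.
have [e|ne] := eqVneq (rowlen Y a x.+1) (rowlen Y a x).
  apply/eqP; rewrite prodf_seq_eq0; apply/hasP.
  exists (a, Ordinal (xlt : x < n)%N); first by rewrite mem_index_enum.
  by rewrite /= /rowend e /lat exprS subr_eq0; apply/eqP; ring.
have lt : (rowlen Y a x.+1 < rowlen Y a x)%N.
  by rewrite ltn_neqAle ne (shape_rowS _ sY).
exfalso; apply: corner; last by move=> x' [<-].
have := leq_ltn_trans (leq0n _) lt; rewrite (shape_galois sY) => h.
exact: leq_ltn_trans (leq_trans h (collen_le_card _ _ _)) Yn.
Qed.

Variables (r1 r2 th : R).
Hypotheses (r1_gt0 : 0 < r1) (r12 : r1 < r2) (th1 : th < 1).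
Hypotheses (hq1 : normc q1 * r2 <= th * r1) (hq2 : normc q2 * r2 <= th * r1).
Hypothesis (hu : forall a, normc (q1 * q2) * r2 < normc (u a)).
Hypothesis (hlat : forall a x y, (x <= n)%N -> (y <= n)%N ->
  normc (pt a x y) != r1 /\ normc (pt a x y) != r2).

Definition in_level (x : C) : bool := r1 < normc x < r2.

(** An instance of [crossing]. Only row ends inside the level are split off as partial fractions;
    the other row ends and the outer denominators stay in Q. *)
Lemma level_crossing Y (rs : seq R) : young Y -> (#|Y| < n)%N ->
  (forall b, b \in Y -> r1 < normc (ptb b)) ->
  {in rs, forall x, x = r1 \/ x = r2} ->
  good (torus (r1 :: rs)) (body q1 q2 (onebody Y)) /\
  mint (r2 :: rs) (body q1 q2 (onebody Y)) = mint (r1 :: rs) (body q1 q2 (onebody Y)) +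
  \sum_(c : box r n | addable Y c && in_level (ptb c))
     res Y c * mint rs (body q1 q2 (onebody (c |: Y))).
Proof.
move=> yY Yn Yr rsr.
have r2_gt0 : 0 < r2 by apply: lt_trans r12.
pose A (x : C) := normc x = r1 \/ normc x = r2.
have Ar x : A x -> r1 <= normc x <= r2.
  by case=> ->; rewrite lexx ?(ltW r12).
pose X (i : rowidx) := pte Y i.1 i.2.
have Xinj : injective X by exact: rowend_inj.
pose s := [seq X i | i <- index_enum (rowidx : finType) & in_level (X i)].
have us : uniq s by rewrite map_inj_uniq// filter_uniq// index_enum_uniq.
pose k0 : C := (1 - q1 * q2) / ((1 - q1) * (1 - q2)) / T.
pose Qo : {poly C} := (\prod_(a < r) (1 - (q1 * q2 / u a) *: 'X)) *
  \prod_(b in Y) (((ptb b)%:P - q1 *: 'X) * ((ptb b)%:P - q2 *: 'X)).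
pose Q : {poly C} := Qo * \prod_(i : rowidx | ~~ in_level (X i)) ('X - (X i)%:P).
pose P : {poly C} := k0 *: (\prod_(m < S) ('X - (p m)%:P)) * 'X^(r.-1) *
  (\prod_(j : 'I_r * 'I_n) ('X - (q1 * pte Y j.1 j.2)%:P)) *
  \prod_(b in Y) (((ptb b)%:P - 'X) * ((ptb b)%:P - (q1 * q2) *: 'X)).
have QoE z : Qo.[z] = (\prod_(a < r) (1 - q1 * q2 * z / u a)) *
    \prod_(b in Y) ((ptb b - q1 * z) * (ptb b - q2 * z)).
  rewrite /Qo hornerM !horner_prod; congr (_ * _); apply: eq_bigr => i _.
    by rewrite !hornerE mulrAC.
  by rewrite !hornerE.
have QE z : Q.[z] = Qo.[z] * \prod_(i : rowidx | ~~ in_level (X i)) (z - X i).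
  rewrite /Q hornerM horner_prod; congr (_ * _); apply: eq_bigr => i _.
  by rewrite hornerXsubC.
have PE z : P.[z] = k0 * (\prod_(m < S) (z - p m)) * z ^+ r.-1 *
    rowprod q1 q2 u Y (fun x => z - q1 * x) *
    \prod_(b in Y) ((ptb b - z) * (ptb b - q1 * q2 * z)).
  rewrite /P hornerM hornerM hornerM hornerZ hornerXn !horner_prod.
  congr (_ * _ * _ * _ * _); apply: eq_bigr => i _; rewrite ?hornerXsubC//.
  by rewrite !hornerE.
have outerE z : outr Y z = (\prod_(b in Y) ((ptb b - z) * (ptb b - q1 * q2 * z))) / Qo.[z].
  by rewrite QoE invfM mulrCA /outer prodfV -prodf_div.
have Qo0 z : r1 <= normc z <= r2 -> Qo.[z] != 0.
  (* The outer poles are u_a / (q1 q2), beyond r2 by [hu], and a box divided by q_i: boxes of Y have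
     modulus above r1, while |q_i z| <= th r1. *)
  move=> /andP[z1 z2]; rewrite QoE mulf_neq0//.
    apply/prodf_neq0 => a _; rewrite subr_eq0 eq_sym; apply/negP => /eqP E.
    have : normc (q1 * q2 * z) = normc (u a) by rewrite -[q1 * q2 * z](mulfVK (u_neq0 a)) E mul1r.
    rewrite normcM => E'; have := hu a; rewrite -E' ltNge => /negP; apply.
    by rewrite ler_wpM2l ?normc_ge0.
  apply/prodf_neq0 => b bY; have bq q : normc q * r2 <= th * r1 -> ptb b - q * z != 0.
    move=> hq; rewrite subr_eq0; apply/negP => /eqP E.
    have := Yr b bY; rewrite E normcM ltNge => /negP; apply.
    apply: (@le_trans _ _ (normc q * r2)); first by rewrite ler_wpM2l ?normc_ge0.
    by apply: (le_trans hq); rewrite ger_pMl// ltW.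
  by rewrite mulf_neq0 ?bq.
have zA i z : A z -> z != X i.
  move=> Az; have [h1 h2] := hlat i.1 (ltn_ord i.2 : (i.2 <= n)%N) (rowlen_le Y i.1 i.2).
  by apply/negP => /eqP E; case: Az; rewrite E => /eqP; [move/negP: h1|move/negP: h2].
have Q0A z : A z -> Q.[z] != 0.
  move=> Az; rewrite QE mulf_neq0 ?Qo0 ?Ar//; apply/prodf_neq0 => i _.
  by rewrite subr_eq0 zA.
have Q0s z : in_level z -> Q.[z] != 0.
  move=> lz; rewrite QE mulf_neq0 ?Qo0//.
    by have /andP[a b] := lz; rewrite !ltW.
  by apply/prodf_neq0 => i li; rewrite subr_eq0; apply: contraNneq li => <-.
have ls z : z \in s -> in_level z.
  by move=> /mapP[j]; rewrite mem_filter => /andP[li _] ->.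
have [P' P'E] := partial_fractions P us (fun z zs => Q0s z (ls z zs)).
pose h z := P'.[z] / Q.[z].
pose J := [seq c <- index_enum (box r n : finType) | addable Y c && in_level (ptb c)].
have JP c : c \in J -> addable Y c /\ in_level (ptb c).
  by rewrite mem_filter => /andP[/andP[]].
have Xtop c : addable Y c -> X (top_index c) = ptb c.
  by move=> ac; rewrite /X /= rowend_addable.
have prod_s (f : C -> C) : \prod_(x <- s) f x = \prod_(i : rowidx | in_level (X i)) f (X i).
  by rewrite /s big_map big_filter.
have coefE c : c \in J ->
    P.[ptb c] / ((\prod_(b <- s | b != ptb c) (ptb c - b)) * Q.[ptb c]) = res Y c / T.
  move=> /JP[ac lc].
  have E : (\prod_(b <- s | b != ptb c) (ptb c - b)) *
      (\prod_(i : rowidx | ~~ in_level (X i)) (ptb c - X i)) =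
      rowprod1D q1 q2 u Y c (fun x => ptb c - x).
    rewrite /rowprod1D [RHS](bigID (fun i : rowidx => in_level (X i))) /=; congr (_ * _).
      rewrite /s big_map big_filter_cond; apply: eq_bigl => i.
      rewrite andbC -(Xtop c ac) (inj_eq Xinj); case: i => a x.
      by rewrite xpair_eqE -[x == _]val_eqE.
    apply: eq_bigl => i; rewrite andbC; case: (boolP (in_level (X i))) => //= li.
    apply/esym; apply: contra li => /andP[/eqP e1 /eqP e2].
    by rewrite (_ : i = top_index c) ?Xtop//; case: (i) e1 e2 => a x /= -> e2;
      congr (_, _); apply: val_inj.
  rewrite QE [X in _ / X](_ : _ = rowprod1D q1 q2 u Y c (fun x => ptb c - x) * Qo.[ptb c]);
    last by rewrite -E; ring.
  by rewrite PE /rho outerE /k0 !invfM; ring.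
have onebodyE x : A x ->
    onebody Y x = \sum_(c <- J) res Y c / T / (x - ptb c) + h x.
  move=> Ax.
  have xs : x \notin s.
    by apply/negP => /mapP[i _ E]; have := zA i x Ax; rewrite -E eqxx.
  have -> : onebody Y x = P.[x] / ((\prod_(a <- s) (x - a)) * Q.[x]).
    rewrite PE QE prod_s mulrCA.
    have E : (\prod_(i : rowidx | in_level (X i)) (x - X i)) *
        (\prod_(i : rowidx | ~~ in_level (X i)) (x - X i)) =
        rowprod1 q1 q2 u Y (fun y => x - y).
      by rewrite /rowprod1 [RHS](bigID (fun i : rowidx => in_level (X i))).
    rewrite E /onebody outerE inner_row//; last first.
      move=> a y y' yn y'n; have [h1 h2] := hlat a yn y'n.
      by apply/negP => /eqP E'; case: Ax; rewrite E' => /eqP; [move/negP: h1|move/negP: h2].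
    by rewrite /k0 !invfM; ring.
  rewrite P'E ?Q0A//; congr (_ + _).
  pose G (a : C) : C := P.[a] / ((\prod_(b <- s | b != a) (a - b)) * Q.[a]) / (x - a).
  rewrite -[LHS]/(\sum_(a <- s) G a) /s big_map.
  pose corner (i : rowidx) := [exists c, addable Y c && (top_index c == i)].
  (* Row ends that are not addable boxes drop out, as the numerator vanishes there; the remaining
     indices correspond bijectively to the list J. *)
  rewrite (bigID corner) /= [X in _ + X]big1 ?addr0; last first.
    move=> i /existsPn nc; rewrite /G PE.
    rewrite (_ : rowprod _ _ _ _ _ = 0) ?mulr0 ?mul0r//; apply: noncorner_zero => //.
    by move=> c ac; have := nc c; rewrite ac.
  rewrite -big_filter.
  rewrite (perm_big [seq top_index c | c <- J]); last first.
    apply: uniq_perm.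
    - by rewrite !filter_uniq// index_enum_uniq.
    - rewrite map_inj_in_uniq ?filter_uniq ?index_enum_uniq//.
      move=> c c' /JP[ac _] /JP[ac' _] [e1 e2].
      case: c c' e1 e2 ac ac' => [[a y] z] [[a' y'] z'] /= -> e2 ac ac'.
      have yy' : y = y' by apply: val_inj.
      move: (addable_row yY ac) (addable_row yY ac'); rewrite /= yy' => -> /val_inj.
      by move=> ->.
    - move=> i; rewrite !mem_filter mem_index_enum andbT; apply/andP/mapP.
        move=> [/existsP[c /andP[ac /eqP <-]] li]; exists c => //.
        by rewrite mem_filter ac mem_index_enum andbT -Xtop.
      move=> [c cJ ->]; have [ac lc] := JP c cJ; split.
        by apply/existsP; exists c; rewrite ac eqxx.
      by rewrite Xtop.
  rewrite big_map [LHS]big_seq [RHS]big_seq; apply: eq_bigr => c cJ.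
  by have [ac lc] := JP c cJ; rewrite Xtop// /G coefE.
have AB x : A x -> normc x <= r2 by move=> /Ar/andP[].
have gh : good1 A h.
  apply: good1M; first exact: (good1_poly _ AB).
  apply: (@good1_ext _ _ (fun x => ((\prod_(a < r) (1 - (q1 * q2 / u a) * x)^-1) *
    \prod_(b <- enum Y) ((ptb b - q1 * x)^-1 * (ptb b - q2 * x)^-1)) *
    \prod_(i : rowidx | ~~ in_level (X i)) (x - X i)^-1)).
    move=> x _; rewrite QE QoE !invfM -!prodfV big_enum /=; congr (_ * _ * _).
      by apply: eq_bigr => a _; rewrite mulrAC.
    by apply: eq_bigr => b _; rewrite invfM.
  apply: good1M; first apply: good1M.
  - apply: good1_prod => a _ _.
    apply: (good1_affineV (th := normc (q1 * q2) * r2 / normc (u a)) AB).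
    + by rewrite ltr_pdivrMr ?normc_gt0// mul1r.
    + exact: oner_neq0.
    + move=> x Ax; rewrite normc1 mulr1 normcM normcM normcV mulrAC.
      rewrite ler_pM2r ?invr_gt0 ?normc_gt0//.
      by rewrite ler_wpM2l ?normc_ge0// AB.
  - apply: good1_prod => b; rewrite mem_enum => bY _.
    have bn : ptb b != 0 by exact: lat_neq0.
    have bq q : normc q * r2 <= th * r1 -> good1 A (fun x => (ptb b - q * x)^-1).
      move=> hq; apply: (good1_affineV (th := th) AB) => // x Ax.
      rewrite normcM; apply: (@le_trans _ _ (normc q * r2)).
        by rewrite ler_wpM2l ?normc_ge0// AB.
      apply: (le_trans hq); rewrite ler_wpM2l ?(ltW (Yr b bY))//.
      have := le_trans (mulr_ge0 (normc_ge0 q1) (ltW r2_gt0)) hq1.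
      by rewrite pmulr_lge0.
    by apply: good1M; apply: bq.
  - apply: good1_prod => i _ li D j D0 Dj DA.
    have [h1 h2] := hlat i.1 (ltn_ord i.2 : (i.2 <= n)%N) (rowlen_le Y i.1 i.2).
    have [lt|ge] := ltP (normc (X i)) r1.
      apply: (good_sub_cst_in (r := r1)) => //.
        by exists r2 => z /DA/AB.
      by move=> z /DA/Ar/andP[].
    apply: (good_sub_cst_out (r := r2)) => //; last by move=> z /DA/AB.
    rewrite lt_neqAle eq_sym h2 leNgt; apply: contra li => lt.
    by rewrite /in_level lt lt_neqAle eq_sym h1 ge.
have [gb] := crossing q1_neq0 r1_gt0 r12 th1 hq1 hq2 rsr (fun c cJ => (JP c cJ).2) gh onebodyE.
rewrite /J big_filter => ->; split => //; congr (_ + _).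
by apply: eq_bigr => c /andP[/andP[cY _] _]; rewrite onebody_add.
Qed.

End Levels.

(** * Descent from the given radius to radius zero *)

Section Recursion.
Variables (R : realType) (r n S : nat).
Local Notation C := R[i].
Variables (q1 q2 : C) (u : 'I_r -> C) (p : 'I_S -> C).
Local Notation pt := (lat q1 q2 u).
Local Notation ptb := (zbox q1 q2 u).
Local Notation wgt := (wt q1 q2 u p).
Local Notation onebody := (onebody q1 q2 u p).
Local Notation body := (body q1 q2).
Implicit Types (Y : {set box r n}) (a : 'I_r) (c : box r n).

Hypotheses (q1_neq0 : q1 != 0) (q2_neq0 : q2 != 0).
Hypotheses (q1_disk : normc q1 < 1) (q2_disk : normc q2 < 1).
Hypothesis (u_neq0 : forall a, u a != 0).
Hypothesis (u_generic : forall (a b : 'I_r) (x y : int), a != b ->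
     - n%:Z <= x <= n%:Z -> - n%:Z <= y <= n%:Z ->
     u a * (u b)^-1 != q1 ^ x * q2 ^ y).
Hypothesis (q_generic : forall x y : nat, (x < n)%N -> (y < n)%N ->
     q1 ^+ x != q2 ^+ y.+1 /\ q1 ^+ x.+1 != q2 ^+ y).

Lemma torus_nseq (m : nat) (s : R) z : torus (nseq m s) z ->
  size z = m /\ forall j, (j < m)%N -> normc (nth 0 z j) = s.
Proof.
move=> E; have sz : size z = m by rewrite -(size_map (@normc R)) E size_nseq.
split => // j jm; have := congr1 (fun t => nth 0 t j) E.
by rewrite nth_nseq jm (nth_map 0)// sz.
Qed.

Lemma good1_onebody_disk Y (r0 : R) :
  (forall a x y, (x <= n)%N -> (y <= n)%N -> r0 < normc (pt a x y)) ->
  good1 (fun x => normc x <= r0) (onebody Y).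
Proof.
move=> hr; have AB x : normc x <= r0 -> normc x <= r0 by [].
have lin (c d : C) : r0 < normc c -> normc d <= 1 ->
    good1 (fun x => normc x <= r0) (fun x => (c - d * x)^-1).
  move=> rc d1 D j D0 Dj DA.
  have [r0n|r0p] := ltP r0 0.
    have DF z : D z -> False.
      by move=> /DA h; have := le_lt_trans (le_trans (normc_ge0 _) h) r0n; rewrite ltxx.
    by split => // [|e _]; [exists 0|exists [::]] => z /DF.
  have cp : 0 < normc c by apply: le_lt_trans rc.
  have := @good1_affineV R (fun x => normc x <= r0) r0 (r0 / normc c) c d AB; apply => //.
  - by rewrite ltr_pdivrMr// mul1r.
  - by rewrite -normc_gt0.
  - move=> x xr; rewrite mulfVK ?gt_eqF// normcM.
    by apply: le_trans xr; rewrite ler_piMl ?normc_ge0.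
have lin' (c : C) : r0 < normc c ->
    good1 (fun x => normc x <= r0) (fun x => (x - c)^-1).
  move=> rc; apply: (@good1_ext _ _ (fun x => -1 * (c - 1 * x)^-1)).
    by move=> x _; rewrite mulN1r mul1r -invrN opprB.
  apply: good1M; first exact: good1_cst.
  by apply: lin => //; rewrite normc1.
have gid : good1 (fun x : C => normc x <= r0) id by exact: (good1_id AB).
have gc (c : C) := @good1_cst R (fun x : C => normc x <= r0) c.
have hb (b : box r n) : [/\ r0 < normc (ptb b), r0 < normc (q1 * ptb b) &
    r0 < normc (q2 * ptb b)].
  have bx := ltn_ord b.1.2; have by_ := ltn_ord b.2; split.
  - by apply: hr; exact: ltnW.
  - rewrite (_ : q1 * ptb b = pt b.1.1 b.1.2.+1 b.2).
      by apply: hr => //; exact: ltnW.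
    by rewrite /zbox /lat exprS; ring.
  - rewrite (_ : q2 * ptb b = pt b.1.1 b.1.2 b.2.+1).
      by apply: hr => //; exact: ltnW.
    by rewrite /zbox /lat exprS; ring.
have hua a : r0 < normc (u a) by have := hr a 0%N 0%N isT isT; rewrite /lat !expr0 !mulr1.
apply: good1M; first apply: good1M; first apply: good1M.
- exact: good1_cst.
- by apply: good1_prod => m _ _; exact: good1B.
- exact: good1X.
rewrite /inner /outer; apply: good1M; apply: good1M.
- by apply: good1_prod => a _ _; exact: lin'.
- apply: good1_prod => b _ _; have [h1 h2 h3] := hb b.
  apply: (@good1_ext _ _ (fun x => ((x - ptb b) * (x - q1 * q2 * ptb b)) *
     ((x - q1 * ptb b)^-1 * (x - q2 * ptb b)^-1))).
    by move=> x _; rewrite invfM.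
  by apply: good1M; apply: good1M; do ?[exact: good1B|exact: lin'].
- apply: good1_prod => a _ _.
  apply: (@good1_ext _ _ (fun x => u a * (u a - (q1 * q2) * x)^-1)).
    move=> x _; have -> : u a - q1 * q2 * x = u a * (1 - q1 * q2 * x / u a) by field.
    by rewrite invfM mulVKf.
  apply: good1M => //; apply: lin => //.
  by rewrite normcM mulr_ile1 ?normc_ge0// ltW.
- apply: good1_prod => b _ _; have [h1 h2 h3] := hb b.
  apply: (@good1_ext _ _ (fun x => ((ptb b - x) * (ptb b - q1 * q2 * x)) *
     ((ptb b - q1 * x)^-1 * (ptb b - q2 * x)^-1))).
    by move=> x _; rewrite invfM.
  apply: good1M; apply: good1M; do ?[exact: good1B].
  + by apply: good1B => //; apply: good1M.
  + by apply: lin => //; exact: ltW.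
  + by apply: lin => //; exact: ltW.
Qed.

(** All radii shrink together. The kernels depend only on ratios and stay bounded, the one-body
    function has no pole in the disk, and the volume of the torus tends to 0. *)
Lemma mint_small_radius Y (m : nat) (r0 : R) : 0 < r0 ->
  (forall a x y, (x <= n)%N -> (y <= n)%N -> r0 < normc (pt a x y)) ->
  mint (nseq m.+1 r0) (body (onebody Y)) = 0.
Proof.
move=> r0p hr.
(* All the tori are gathered in one domain, so that one bound B serves for every s. *)
pose D (z : seq C) := exists2 s : R, 0 < s <= r0 & torus (nseq m.+1 s) z.
have D0 z : D z -> 0 \notin z.
  by move=> [s /andP[s0 _]]; apply: torus_neq0; rewrite all_nseq s0 orbT.
have Ds z : D z -> size z = m.+1 by move=> [s _ /torus_nseq[]].
have gD : good D (body (onebody Y)).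
  apply: (@good_ext _ _ (fun z => body (onebody Y) (drop 0 z))).
    by move=> z _; rewrite drop0.
  apply: (good_body_drop (m := m.+1)) => //.
    move=> j jm; apply: (good1_onebody_disk Y hr) => //.
      by move=> z Dz; rewrite Ds.
    by move=> z [s /andP[s0 sr] /torus_nseq[_ h]]; rewrite h.
  move=> i j /andP[_ ij] jm; have im : (i < m.+1)%N by apply: ltn_trans jm.
  apply: (good_kap (th := Num.max (normc q1) (normc q2))) => //.
  - by rewrite gt_max q1_disk.
  - by move=> z Dz; rewrite Ds// im jm.
  - move=> z [s /andP[s0 sr] /torus_nseq[_ h]]; rewrite !h//.
    by split; (apply: ler_wpM2r; [exact: ltW|rewrite le_max lexx ?orbT]).
have [_ [B HB] _] := gD.
apply/eqP; rewrite -normc_eq0; apply/eqP.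
apply: (@small_eq0 _ _ (4 * pi * (mconst (nseq m r0) * `|B|))); first exact: normc_ge0.
move=> e e0; pose s := Num.min r0 e.
have s0 : 0 < s by rewrite lt_min r0p.
have sr : s <= r0 by rewrite ge_min lexx.
have se : s <= e by rewrite ge_min lexx orbT.
have all0 k (t : R) : 0 < t -> all (fun x : R => 0 < x) (nseq k t).
  by move=> t0; rewrite all_nseq t0 orbT.
rewrite (@mint_radius _ (nseq m.+1 r0) (nseq m.+1 s)) ?size_nseq ?all0//; last first.
  apply: good_sub gD => z [h|h]; first by exists r0; rewrite ?r0p ?lexx.
  by exists s; rewrite ?s0.
apply: (@le_trans _ _ (mconst (nseq m.+1 s) * `|B|)).
  apply: mint_bound; first exact: all0.
    by apply: good_sub gD => z h; exists s; rewrite ?s0.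
  move=> z h; apply: le_trans (ler_norm B); apply: HB; exists s => //.
  by rewrite s0.
have -> : mconst (nseq m.+1 s) = 4 * pi * s * mconst (nseq m s).
  by rewrite /mconst big_cons.
have -> : 4 * pi * (mconst (nseq m r0) * `|B|) * e = 4 * pi * e * mconst (nseq m r0) * `|B|.
  by ring.
have pi4 : 0 <= 4 * pi :> R by rewrite mulr_ge0// pi_ge0.
rewrite ler_wpM2r// ler_pM//.
- by rewrite mulr_ge0// ltW.
- by rewrite mconst_ge0// all0.
- by rewrite ler_wpM2l.
rewrite /mconst !big_nseq !iter_mulr_1 lerXn2r ?nnegrE ?ler_wpM2l//.
  by apply: mulr_ge0 => //; exact: ltW.
by apply: mulr_ge0 => //; exact: ltW.
Qed.

(** The final tuples still reachable: the boxes missing from Y must come from poles inside the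
    current circle. *)
Definition targets Y (r0 : R) : {set {set box r n}} :=
  [set Z : {set box r n} | [&& young Z, Y \subset Z, #|Z| == n &
     [forall b in Z :\: Y, normc (ptb b) < r0]]].

Lemma targetsP Y (r0 : R) Z : reflect
  [/\ young Z, Y \subset Z, #|Z| = n & forall b, b \in Z -> b \notin Y -> normc (ptb b) < r0]
  (Z \in targets Y r0).
Proof.
rewrite inE; apply: (iffP and4P) => [[h1 h2 /eqP h3 /forallP h4]|[h1 h2 h3 h4]]; split => //.
- by move=> b bZ bY; have := h4 b; rewrite !inE bZ bY.
- exact/eqP.
- by apply/forallP => b; apply/implyP; rewrite inE => /andP[bY bZ]; exact: h4.
Qed.

Definition in_gap (r1 : R) Y (Z : {set box r n}) : {set box r n} :=
  [set b in Z :\: Y | r1 < normc (ptb b)].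

Lemma ffact_succ (a k : nat) : (a.+1 ^_ k = a ^_ k + k * a ^_ k.-1)%N.
Proof.
case: k => [|k]; first by rewrite !ffactn0.
rewrite ffactSS ffactnSr /=.
have [ka|ak] := leqP k a.
  rewrite -[X in (X * _)%N = _](_ : (a - k + k.+1 = a.+1)%N); last by lia.
  by rewrite mulnDl mulnC.
by rewrite ffact_small// !muln0.
Qed.

Section Step.
Variables (r1 r2 : R).
Hypotheses (r1_gt0 : 0 < r1) (r12 : r1 < r2).
Hypotheses (hq1 : normc q1 * r2 < r1) (hq2 : normc q2 * r2 < r1).
Hypothesis (hu : forall a, normc (q1 * q2) * r2 < normc (u a)).
Hypothesis (hlat : forall a x y, (x <= n)%N -> (y <= n)%N ->
  normc (pt a x y) != r1 /\ normc (pt a x y) != r2).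

(** The induction hypothesis of the descent: the formula at the smaller radius. *)
Hypothesis (claim1 : forall Y m, young Y -> (#|Y| + m)%N = n ->
  (forall b, b \in Y -> r1 < normc (ptb b)) ->
  wgt Y * mint (nseq m r1) (body (onebody Y)) =
  (m`!)%:R * \sum_(Z in targets Y r1) wgt Z).

Let r2_gt0 : 0 < r2.
Proof. exact: lt_trans r12. Qed.

(* A box of modulus above r1 outside Y whose complement boxes lie below r2 is
   addable, since moving one step towards the corner multiplies the modulus by
   at least r2 / r1. *)
Lemma gap_addable Y Z c : young Y -> Z \in targets Y r2 -> c \in in_gap r1 Y Z ->
  addable Y c.
Proof.
move=> yY /targetsP[yZ YZ _ hZ]; rewrite !inE => /andP[/andP[cY cZ] cr].
rewrite /addable cY /=; apply/youngP => b d; rewrite !inE => /orP[/eqP ->|bY] e1 e2 e3;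
  last by rewrite (youngP _ yY _ _ bY e1 e2 e3) orbT.
have [//|dc] := eqVneq d c => /=.
have dZ : d \in Z by exact: (youngP _ yZ _ _ cZ).
apply/negPn/negP => dY; have := hZ d dZ dY; apply/negP; rewrite -leNgt.
have zE : ptb c = ptb d * (q1 ^+ (c.1.2 - d.1.2) * q2 ^+ (c.2 - d.2)).
  rewrite /zbox /lat e1 -[in LHS](subnK e2) -[in LHS](subnK e3) !exprD; ring.
have d0 : (0 < c.1.2 - d.1.2)%N \/ (0 < c.2 - d.2)%N.
  have [h|h] := eqVneq (d.1.2 : nat) c.1.2; last by left; rewrite subn_gt0 ltn_neqAle h.
  right; rewrite subn_gt0 ltn_neqAle e3 andbT; apply: contra dc => /eqP h'.
  apply/eqP; case: (c) (d) e1 h h' {e2 e3 zE dZ dY cY cZ} => [[a x] y] [[a' x'] y'] /= -> h h'.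
  by rewrite (val_inj h) (val_inj h').
move: cr; rewrite zE; move: (ptb d) => w; rewrite normcM [X in _ * X]normcM !normcX.
move: (normc w) (normc_ge0 w) => t t0 cr.
rewrite leNgt; apply/negP => tr.
have bound q (k l : nat) q' : normc q * r2 < r1 -> normc q' < 1 -> normc q < 1 -> (0 < k)%N ->
    t * (normc q ^+ k * normc q' ^+ l) < r1.
  move=> hq q'1 q1' k0; case: k k0 => // k _.
  apply: le_lt_trans hq; rewrite mulrC; apply: ler_pM => //; last exact: ltW.
    by rewrite mulr_ge0// exprn_ge0// normc_ge0.
  rewrite exprS -mulrA ler_piMr ?normc_ge0// mulr_ile1 ?exprn_ge0 ?normc_ge0//.
    by rewrite exprn_ile1 ?normc_ge0// ltW.
  by rewrite exprn_ile1 ?normc_ge0// ltW.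
case: d0 => d0.
  by have := bound q1 _ (c.2 - d.2)%N q2 hq1 q2_disk q1_disk d0; rewrite ltNge (ltW cr).
have := bound q2 _ (c.1.2 - d.1.2)%N q1 hq2 q1_disk q2_disk d0.
by rewrite [normc q2 ^+ _ * _]mulrC ltNge (ltW cr).
Qed.

(** Boxes in the gap can be picked up only by the a variables still on the outer circle: a falling
    factorial of choices. The remaining variables are matched with the remaining boxes in any
    order. *)
Lemma mixed_level (a b : nat) Y : young Y -> (#|Y| + (a + b))%N = n ->
  (forall c, c \in Y -> r1 < normc (ptb c)) ->
  wgt Y * mint (nseq a r2 ++ nseq b r1) (body (onebody Y)) =
  \sum_(Z in targets Y r2)
    (a ^_ #|in_gap r1 Y Z| * (a + b - #|in_gap r1 Y Z|)`!)%:R * wgt Z.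
Proof.
elim: a b Y => [|a IH] b Y yY Yn Yr.
  rewrite /= claim1// mulr_sumr.
  (* With no variable on the outer circle, a tuple with a box in the gap gets the coefficient 0^_k =
     0. *)
  rewrite [RHS](bigID (fun Z => #|in_gap r1 Y Z| == 0%N)) /= [X in _ + X]big1 ?addr0; last first.
    by move=> Z /andP[_ h]; rewrite ffact_small ?lt0n// mul0n mul0r.
  apply: eq_big => Z.
    apply/idP/andP => [/targetsP[h1 h2 h3 h4]|[/targetsP[h1 h2 h3 h4] h5]].
      split.
        by apply/targetsP; split => // c cZ cY; apply: lt_trans (h4 c cZ cY) r12.
      rewrite cards_eq0; apply/eqP/finset.setP => c; rewrite !inE; apply/negP.
      by move=> /andP[/andP[cY cZ]]; rewrite ltNge (ltW (h4 c cZ cY)).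
    apply/targetsP; split => // c cZ cY.
    have cn : (c.1.2 <= n)%N /\ (c.2 <= n)%N by split; exact: ltnW.
    have [ne _] := hlat c.1.1 cn.1 cn.2.
    rewrite lt_neqAle ne /= leNgt; apply/negP => cr.
    move: h5; rewrite cards_eq0 => /eqP/finset.setP/(_ c).
    by rewrite !inE cY cZ cr.
  move=> /targetsP[h1 h2 h3 h4].
  have -> : in_gap r1 Y Z = finset.set0.
    apply/finset.setP => c; rewrite !inE; apply/negP => /andP[/andP[cY cZ]].
    by rewrite ltNge (ltW (h4 c cZ cY)).
  by rewrite finset.cards0 ffactn0 mul1n subn0.
have Yltn : (#|Y| < n)%N by rewrite -[X in (_ < X)%N]Yn addSn addnS ltnS leq_addr.
pose th := Num.max (normc q1 * r2 / r1) (normc q2 * r2 / r1).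
have th1 : th < 1 by rewrite gt_max !ltr_pdivrMr// !mul1r hq1.
have hth1 : normc q1 * r2 <= th * r1 by rewrite -ler_pdivrMr// le_max lexx.
have hth2 : normc q2 * r2 <= th * r1 by rewrite -ler_pdivrMr// le_max lexx orbT.
pose rs := nseq a r2 ++ nseq b r1.
have rsr : {in rs, forall x, x = r1 \/ x = r2}.
  by move=> x; rewrite mem_cat !mem_nseq => /orP[/andP[_ /eqP]|/andP[_ /eqP]]; auto.
have rs0 : all (fun x : R => 0 < x) rs by apply/allP => x /rsr[]->.
have [gb E] := level_crossing p q1_neq0 q2_neq0 q1_disk q2_disk u_neq0 u_generic
  q_generic r1_gt0 r12 th1 hth1 hth2 hu hlat yY Yltn Yr rsr.
have -> : nseq a.+1 r2 ++ nseq b r1 = r2 :: rs by [].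
(* The variable just moved goes to the end, so that the next one on the outer circle comes first. *)
rewrite E mulrDr mint_rcons//; last by move=> x w; exact: body_rcons.
have -> : rcons rs r1 = nseq a r2 ++ nseq b.+1 r1.
  by rewrite /rs rcons_cat; congr (_ ++ _); elim: (b) => //= k ->.
rewrite IH//; last by rewrite -[RHS]Yn; clear; lia.
have -> : wgt Y * (\sum_(c | addable Y c && in_level r1 r2 (ptb c))
      rho q1 q2 u p Y c * mint rs (body (onebody (c |: Y)))) =
    \sum_(c | addable Y c && in_level r1 r2 (ptb c))
      \sum_(Z in targets (c |: Y) r2)
        (a ^_ #|in_gap r1 Y Z|.-1 * (a.+1 + b - #|in_gap r1 Y Z|)`!)%:R * wgt Z.
  rewrite mulr_sumr; apply: eq_bigr => c /andP[ac /andP[lc1 lc2]].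
  have /andP[cY yc] := ac.
  rewrite mulrA [wgt Y * _]mulrC -(wt_add p q1_neq0 q2_neq0 q1_disk q2_disk u_neq0
    u_generic q_generic yY ac Yltn) IH//; last first.
  - by move=> d; rewrite !inE => /orP[/eqP ->//|]; exact: Yr.
  - by rewrite cardsU1 cY -[RHS]Yn; clear; lia.
  apply: eq_bigr => Z /targetsP[yZ YZ _ _].
  have cg : c \in in_gap r1 Y Z.
    by rewrite !inE cY lc1 andbT (fintype.subsetP YZ)// setU11.
  have -> : in_gap r1 (c |: Y) Z = in_gap r1 Y Z :\ c.
    by apply/finset.setP => d; rewrite !inE negb_or -!andbA.
  have := cardsD1 c (in_gap r1 Y Z); rewrite cg add1n => ->.
  by rewrite /= addSn subSS.
(* For a fixed Z the first box c ranges over the whole gap, by [gap_addable]; each choice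
   contributes the same term. *)
rewrite (exchange_big_dep (fun Z => Z \in targets Y r2)) /=; last first.
  move=> c Z /andP[ac /andP[_ lc2]] /targetsP[yZ cYZ Zn hZ]; apply/targetsP; split => //.
    by apply: fintype.subset_trans cYZ; exact: finset.subsetUr.
  move=> d dZ dY; have [->//|dc] := eqVneq d c.
  by apply: hZ => //; rewrite !inE negb_or dc.
rewrite -big_split; apply: eq_bigr => Z ZT; have /targetsP[yZ YZ Zn hZ] := ZT.
have -> : \sum_(c | (addable Y c && in_level r1 r2 (ptb c)) && (Z \in targets (c |: Y) r2))
      (a ^_ #|in_gap r1 Y Z|.-1 * (a.+1 + b - #|in_gap r1 Y Z|)`!)%:R * wgt Z =
    \sum_(c in in_gap r1 Y Z)
      (a ^_ #|in_gap r1 Y Z|.-1 * (a.+1 + b - #|in_gap r1 Y Z|)`!)%:R * wgt Z.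
  apply: eq_bigl => c; apply/andP/idP.
    move=> [/andP[ac /andP[lc1 _]] /targetsP[_ cYZ _ _]].
    have /andP[cY _] := ac.
    by rewrite !inE cY lc1 andbT (fintype.subsetP cYZ)// setU11.
  move=> cg; have ac := gap_addable yY ZT cg.
  move: cg; rewrite !inE => /andP[/andP[cY cZ] cr].
  rewrite ac /in_level cr hZ//; split => //; apply/and4P; split => //.
  - by apply/fintype.subsetP => d; rewrite !inE => /orP[/eqP ->//|]; exact: (fintype.subsetP YZ).
  - exact/eqP.
  - apply/forallP => d; apply/implyP; rewrite !inE negb_or => /andP[/andP[_ dY] dZ].
    exact: hZ.
rewrite /= sumr_const -[(_ * wgt Z) *+ _]mulr_natl mulrA -natrM addnS -addSn -mulrDl -natrD.
congr (_%:R * _); rewrite ffact_succ mulnDl; congr (_ + _)%N.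
by rewrite mulnA.
Qed.

(** For b = 0 the coefficients m^_k (m - k)! all equal m!. *)
Lemma level_step Y m : young Y -> (#|Y| + m)%N = n ->
  (forall b, b \in Y -> r1 < normc (ptb b)) ->
  wgt Y * mint (nseq m r2) (body (onebody Y)) =
  (m`!)%:R * \sum_(Z in targets Y r2) wgt Z.
Proof.
move=> yY Yn Yr; have := @mixed_level m 0 Y yY; rewrite /= cats0 addn0 => -> //.
rewrite mulr_sumr; apply: eq_bigr => Z /targetsP[yZ YZ Zn _].
rewrite ffact_fact//.
have : #|in_gap r1 Y Z| = #|in_gap r1 Y Z| by [].
have -> : m = #|Z :\: Y|.
  by rewrite (finset.cardsDS YZ) Zn -[X in (X - _)%N]Yn addKn.
move=> _; apply: subset_leq_card; apply/fintype.subsetP => b; rewrite !inE => /andP[].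
by move=> /andP[-> ->].
Qed.

End Step.

Lemma exists_avoid (s : seq R) (x y : R) : x < y -> exists2 t, x < t < y & t \notin s.
Proof.
elim: s x y => [|w s IH] x y xy.
  by exists ((x + y) / 2) => //; apply/andP; split; lra.
pose m := (x + y) / 2; have m1 : x < m by rewrite /m; lra.
have m2 : m < y by rewrite /m; lra.
have [wm|mw] := leP w m.
  have [t /andP[t1 t2] ts] := IH m y m2; exists t; first by rewrite t2 (lt_trans m1 t1).
  by rewrite inE negb_or ts andbT gt_eqF// (le_lt_trans wm).
have [t /andP[t1 t2] ts] := IH x m m1; exists t; first by rewrite t1 (lt_trans t2 m2).
by rewrite inE negb_or ts andbT lt_eqF// (lt_trans t2).
Qed.

Lemma exists_lower (s : seq R) : all (fun x : R => 0 < x) s ->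
  exists2 d : R, 0 < d & {in s, forall x, d < x}.
Proof.
elim: s => [_|x s IH] /=; first by exists 1.
move=> /andP[x0 /IH[d d0 ds]]; exists (Num.min d (x / 2)).
  by rewrite lt_min d0 divr_gt0.
move=> y; rewrite inE => /orP[/eqP ->|/ds dy]; last by rewrite gt_min dy.
by rewrite gt_min; apply/orP; right; lra.
Qed.

Definition moduli : seq R :=
  [seq normc (pt i.1.1 i.1.2 i.2) | i : 'I_r * 'I_n.+1 * 'I_n.+1].

Lemma mem_moduli a x y : (x <= n)%N -> (y <= n)%N -> normc (pt a x y) \in moduli.
Proof.
move=> xn yn; apply/mapP.
by exists (a, Ordinal (xn : x < n.+1)%N, Ordinal (yn : y < n.+1)%N); rewrite ?mem_enum.
Qed.

(** Induction on the number k of contractions by [th] that bring r0 below all lattice points. The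
    next radius lies between qm r0 and th r0: large enough to meet no pole of a kernel, small enough
    for k to decrease. *)
Lemma level_recursion (r0 : R) Y m : 0 < r0 -> r0 \notin moduli ->
  (forall a, normc (q1 * q2) * r0 < normc (u a)) ->
  young Y -> (#|Y| + m)%N = n -> (forall b, b \in Y -> r0 < normc (ptb b)) ->
  wgt Y * mint (nseq m r0) (body (onebody Y)) =
  (m`!)%:R * \sum_(Z in targets Y r0) wgt Z.
Proof.
have [|d d0 dmod] := @exists_lower moduli.
  by apply/allP => x /mapP[i' _ ->]; rewrite normc_gt0; exact: lat_neq0.
pose qm := Num.max (normc q1) (normc q2).
have qm0 : 0 < qm by rewrite lt_max normc_gt0 q1_neq0.
have qm1 : qm < 1 by rewrite gt_max q1_disk.
pose th := (1 + qm) / 2.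
have th1 : th < 1 by rewrite /th; lra.
have qth : qm < th by rewrite /th; lra.
have th0 : 0 < th by apply: lt_trans qth.
move=> r0p; have [k kr] : exists k, r0 * th ^+ k < d.
  have [||k hk] := @exists_expr_lt R th (d / r0); first by rewrite ltW.
    by rewrite divr_gt0.
  by exists k; rewrite mulrC -ltr_pdivlMr.
elim: k r0 Y m r0p kr => [|k IH] r0 Y m r0p kr r0m hu yY Yn Yr.
  have hr a x y : (x <= n)%N -> (y <= n)%N -> r0 < normc (pt a x y).
    move=> xn yn; apply: lt_trans (dmod _ (mem_moduli a xn yn)).
    by rewrite -[r0]mulr1.
  case: m Yn => [|m] Yn.
    rewrite /= fact0 mul1r mulr1 (bigD1 Y)/=; last first.
      by apply/targetsP; split => //; [rewrite -[RHS]Yn addn0|move=> b ->].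
    rewrite big1 ?addr0// => Z /andP[/targetsP[yZ YZ Zn _]].
    move: YZ; rewrite finset.subEproper eq_sym => /orP[->//|/fintype.proper_card].
    by rewrite Zn -[X in (_ < X)%N]Yn addn0 ltnn.
  (* Variables are left but no lattice point is inside: the integral is 0, and no tuple can be
     completed either. *)
  rewrite mint_small_radius// mulr0 [X in _ * X]big1 ?mulr0// => Z /targetsP[yZ YZ Zn hZ].
  have [c] : exists c, c \in Z :\: Y.
    apply/set0Pn; rewrite finset.setD_eq0; apply/negP => /subset_leq_card.
    by rewrite Zn -[X in (X <= _)%N]Yn addnS ltnNge leq_addr.
  rewrite inE => /andP[cY cZ]; have := hZ c cZ cY; rewrite ltNge ltW//.
  by apply: hr; exact: ltnW.
have qr : qm * r0 < th * r0 by rewrite ltr_pM2r.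
have [r1 /andP[h1 h2] r1m] := exists_avoid moduli qr.
have r1p : 0 < r1 by apply: le_lt_trans h1; rewrite mulr_ge0// ltW.
have r10 : r1 < r0 by apply: lt_trans h2 _; rewrite gtr_pMl.
have hlat a x y : (x <= n)%N -> (y <= n)%N ->
    normc (pt a x y) != r1 /\ normc (pt a x y) != r0.
  move=> xn yn; have h := mem_moduli a xn yn.
  by split; [apply: contraNneq r1m => <-|apply: contraNneq r0m => <-].
apply: (@level_step r1 r0) => //.
- by apply: le_lt_trans h1; rewrite ler_wpM2r ?(ltW r0p)// le_max lexx.
- by apply: le_lt_trans h1; rewrite ler_wpM2r ?(ltW r0p)// le_max lexx orbT.
- move=> Y' m' yY' Yn' Yr'; apply: IH => //.
    apply: lt_trans kr; rewrite exprS mulrA ltr_pM2r ?exprn_gt0//.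
    by rewrite mulrC.
  move=> a; apply: le_lt_trans (hu a).
  by rewrite ler_wpM2l ?normc_ge0// ltW.
- by move=> b bY; apply: lt_trans r10 (Yr b bY).
Qed.

Lemma wt0 : wgt (finset.set0 : {set box r n}) = 1.
Proof.
have N1 a a' : Nfac q1 q2 u (finset.set0 : {set box r n}) a a' = 1.
  have E b : rowlen (finset.set0 : {set box r n}) b = fun=> 0%N.
    by apply: funext => x; exact: rowlen0.
  rewrite /Nfac /armleg !E big_cat !big_allpairs_dep.
  rewrite [X in _ X _ = _]big1; last by move=> x _; rewrite big_nil.
  by rewrite big1 /= ?mulr1// => x _; rewrite big_nil.
rewrite /wt big_pred0; last by move=> b; rewrite inE.
by rewrite big1 ?divr1// => a _; rewrite big1.
Qed.

Lemma mint_eq_sum_young (r0 : R) : 0 < r0 ->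
  (forall a, normc (q1 * q2) * r0 < normc (u a)) -> (forall a, normc (u a) < r0) ->
  mint (nseq n r0) (body (onebody (finset.set0 : {set box r n}))) =
  (n`!)%:R * \sum_(Z : {set box r n} | young Z && (#|Z| == n)) wgt Z.
Proof.
move=> r0p hu1 hu2.
have hlat a x y : normc (pt a x y) < r0.
  apply: le_lt_trans (hu2 a); rewrite /lat !normcM !normcX -mulrA.
  rewrite ler_piMr ?normc_ge0// mulr_ile1 ?exprn_ge0 ?normc_ge0//;
  by rewrite exprn_ile1 ?normc_ge0// ltW.
have := @level_recursion r0 finset.set0 n r0p.
rewrite wt0 mul1r => -> //.
- congr (_ * _); apply: eq_bigl => Z; apply/targetsP/andP => [[h1 _ h2 _]|[h1 /eqP h2]].
    by rewrite h1 h2.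
  by split => //; [exact: finset.sub0set|move=> b _ _; exact: hlat].
- by apply/negP => /mapP[j _ E]; have := hlat j.1.1 j.1.2 j.2; rewrite -E ltxx.
- exact: young0.
- by rewrite finset.cards0.
- by move=> b; rewrite inE.
Qed.

End Recursion.

(** * The integrand of Zn *)

Section IntegrandForm.
Variables (R : realType) (r S : nat).
Local Notation C := R[i].
Variables (q1 q2 : C) (u : 'I_r -> C) (p : 'I_S -> C).
Hypotheses (r_gt0 : (0 < r)%N) (q1_neq0 : q1 != 0).
Hypotheses (q1_disk : normc q1 < 1) (q2_disk : normc q2 < 1).
Hypothesis u_neq0 : forall a, u a != 0.
Variable r0 : R.
Hypotheses (r0_gt0 : 0 < r0).
Hypotheses (hu1 : forall a, normc (q1 * q2) * r0 < normc (u a)).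
Hypotheses (hu2 : forall a, normc (u a) < r0).

Local Notation c0 := ((1 - q1 * q2) / ((1 - q1) * (1 - q2))).
Local Notation phi n := (onebody q1 q2 u p (finset.set0 : {set box r n})).

Lemma torus_integral_mint (m : nat) (s : R) (F : m.-tuple C -> C) (G : seq C -> C) :
  0 < s -> (forall z : m.-tuple C, torus (nseq m s) z -> F z = G z) ->
  torus_integral s F = mint (nseq m s) G.
Proof.
move=> s0; elim: m F G => [|m IH] F G FG /=; first by rewrite FG.
apply: circle_ext => // z zs; apply: IH => w hw.
by rewrite FG//=; exact: torus_cons.
Qed.

Lemma good_body_onebody0 n :
  good (torus (nseq n r0)) (body q1 q2 (phi n)).
Proof.
have all0 : all (fun x : R => 0 < x) (nseq n r0) by rewrite all_nseq r0_gt0 orbT.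
have D0 z : torus (nseq n r0) z -> 0 \notin z by exact: torus_neq0.
apply: (@good_ext _ _ (fun z => body q1 q2 (phi n) (drop 0 z))).
  by move=> z _; rewrite drop0.
apply: (good_body_drop (m := n)) => //.
- by move=> z /torus_nseq[].
- have AB (x : C) : normc x = r0 -> normc x <= r0 by move=> ->.
  have gid : good1 (fun x : C => normc x = r0) id by exact: (good1_id AB).
  have gc (c : C) := @good1_cst R (fun x : C => normc x = r0) c.
  have g1 : good1 (fun x : C => normc x = r0) (phi n).
    apply: good1M; first apply: good1M; first apply: good1M.
    + exact: good1_cst.
    + by apply: good1_prod => m _ _; exact: good1B.
    + exact: good1X.
    rewrite /inner /outer; apply: good1M; apply: good1M.
    + apply: good1_prod => a _ _ D j' D0' Dj DA.
      apply: (@good_sub_cst_in _ _ _ _ r0) => //; first by exists r0 => z /DA ->.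
      by move=> z /DA ->.
    + by apply: good1_prod => b _; rewrite inE.
    + apply: good1_prod => a _ _.
      apply: (@good1_ext _ _ (fun x => (1 - (q1 * q2 / u a) * x)^-1)).
        by move=> x _; rewrite mulrAC.
      have ua : 0 < normc (u a) by rewrite normc_gt0.
      apply: (@good1_affineV _ _ r0 (normc (q1 * q2) * r0 / normc (u a))) => //.
        by rewrite ltr_pdivrMr// mul1r.
      by move=> x xr; rewrite normc1 mulr1 !normcM normcV ?u_neq0// xr mulrAC.
    + by apply: good1_prod => b _; rewrite inE.
  move=> k kn; apply: g1 => //.
    by move=> z /torus_nseq[-> _].
  by move=> z /torus_nseq[_ ->].
move=> k j /andP[_ kj] jn; have kn := ltn_trans kj jn.
apply: (good_kap (th := Num.max (normc q1) (normc q2))) => //.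
- by rewrite gt_max q1_disk.
- by move=> z /torus_nseq[-> _].
- move=> z /torus_nseq[_ h]; rewrite !h//.
  by split; (apply: ler_wpM2r; [exact: ltW|rewrite le_max lexx ?orbT]).
Qed.

Let f (z w : C) : C := (z - w) * (z - q1 * q2 * w) / ((z - q1 * w) * (z - q2 * w)).

(** The kernel is f x y times f y x, so a product over unordered pairs becomes one over ordered
    pairs. *)
Lemma body_prod_pairs (psi : C -> C) (z : seq C) :
  body q1 q2 psi z = (\prod_(x <- z) psi x) *
  \prod_(j < size z) \prod_(k < size z | j != k) f (nth 0 z j) (nth 0 z k).
Proof.
elim: z => [|x z IH] /=; first by rewrite big_nil big_ord0 mulr1.
rewrite IH big_cons big_ord_recl /=.
have -> : \prod_(k < (size z).+1 | ord0 != k) f x (nth 0 (x :: z) k) = \prod_(y <- z) f x y.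
  by rewrite big_mkcond big_ord_recl /= mul1r (big_nth 0) big_mkord.
rewrite [X in _ = _ * (_ * X)](_ : _ = (\prod_(y <- z) f y x) *
   \prod_(j < size z) \prod_(k < size z | j != k) f (nth 0 z j) (nth 0 z k)); last first.
  rewrite (big_nth 0) big_mkord -big_split; apply: eq_bigr => j _ /=.
  rewrite big_mkcond big_ord_recl /=; congr (_ * _).
  by rewrite [RHS]big_mkcond.
have -> : \prod_(y <- z) kap q1 q2 x y = (\prod_(y <- z) f x y) * \prod_(y <- z) f y x.
  rewrite -big_split; apply: eq_bigr => y _; rewrite /kap /f invfM /=; ring.
ring.
Qed.

(** Dividing by -u_a turns each fraction into x / ((x - u_a)(1 - q1 q2 x / u_a)). One of the r
    powers of x cancels the 1/x of the measure, whence x^(r-1). *)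
Lemma onebody0_fraction n x : x != 0 ->
  phi n x = c0 * ((2 * pi%:C * 'i * x)^-1 * (\prod_(m < S) (x - p m)) *
    \prod_(a < r) (- u a * x / ((x - u a) * (q1 * q2 * x - u a)))).
Proof.
move=> x0; rewrite /onebody /inner /outer.
rewrite !finset.big_set0 !mulr1 -big_split /=.
have -> : \prod_(a < r) (- u a * x / ((x - u a) * (q1 * q2 * x - u a))) =
   \prod_(a < r) (x * ((x - u a)^-1 * (1 - q1 * q2 * x / u a)^-1)).
  apply: eq_bigr => a _; have ua := u_neq0 a.
  have -> : q1 * q2 * x - u a = - u a * (1 - q1 * q2 * x / u a) by field.
  rewrite [((x - u a) * _)^-1]invfM [(- u a * _)^-1]invfM.
  by move: (x - u a)^-1 (1 - _)^-1 => v w; field.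
rewrite [X in _ = _ * (_ * X)]big_split /= prodr_const card_ord.
have -> : x ^+ r = x * x ^+ r.-1 by rewrite -exprS prednK.
have -> : (2 * pi)%:C = 2 * pi%:C :> C by rewrite rmorphM /= rmorph_nat.
rewrite [(_ * 'i * x)^-1]invfM.
move: (2 * pi%:C * 'i)^-1 (\prod_(m < S) _) (\prod_(a < r) _) (_ ^+ _) c0 => A B D E F.
by field.
Qed.

Lemma Zn_mint n : Zn q1 q2 u p r0 n =
  (n`!)%:R^-1 * mint (nseq n r0) (body q1 q2 (phi n)).
Proof.
have all0 : all (fun x : R => 0 < x) (nseq n r0) by rewrite all_nseq r0_gt0 orbT.
have c_neq0 : c0 != 0.
  have nz (q : C) : normc q < 1 -> 1 - q != 0.
    by move=> h; rewrite subr_eq0; apply/eqP => E; move: h; rewrite -E normc1 ltxx.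
  rewrite mulf_neq0 ?invr_eq0 ?mulf_neq0 ?nz//.
  by rewrite normcM mulr_ilt1 ?normc_ge0.
rewrite /Zn (@torus_integral_mint n r0 _ (fun z => c0 ^- n * body q1 q2 (phi n) z))//.
  rewrite mintZ//; last exact: good_body_onebody0.
  by rewrite -!mulrA [_ ^+ n * _]mulrA divff ?mul1r// expf_neq0.
move=> z hz; have z0 := torus_neq0 all0 hz.
have zE x (xz : x \in (z : seq C)) := onebody0_fraction n (memPn z0 x xz).
rewrite body_prod_pairs (eq_big_seq _ zE).
rewrite big_split /= big_const_seq count_predT size_tuple iter_mulr_1 !mulrA mulVf ?expf_neq0// mul1r.
rewrite /Z_integrand !big_split /= !big_tuple; congr (_ * _ * _ * _).
apply: eq_bigr => j _; apply: eq_bigr => k _; rewrite /f !(tnth_nth 0).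
by [].
Qed.

End IntegrandForm.

(** * Partitions and sets of boxes *)

Section Partitions.
Implicit Types (P Q : int_partition) (x y : nat).

(** Lengths of rows and columns are compared through the boxes they contain, which is the form in
    which transposition is known. *)
Lemma ltn_ext (k l : nat) : (forall y, (y < k)%N = (y < l)%N) -> k = l.
Proof. by move=> h; apply/eqP; rewrite eqn_leq leqNgt h ltnn leqNgt -h ltnn. Qed.

Lemma part_transpose P x y : (y < part P x.+1)%N = (x < part (transpose P) y.+1)%N.
Proof. by have := mem_diagram_transpose P x.+1 y.+1; rewrite !mem_diagram /= => ->. Qed.

Lemma part_out P x : (size P <= x)%N -> part P x.+1 = 0%N.
Proof. exact: nth_default. Qed.

Lemma part_gt0 P x : (0 < part P x.+1)%N = (x < size P)%N.
Proof.
have [xs|sx] := ltnP x (size P); last by rewrite part_out.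
have /andP[_ P0] := valP P; rewrite lt0n.
by apply: contraNneq P0 => E; rewrite -[X in X \in _]E mem_nth.
Qed.

Lemma size_le_psize P : (size P <= psize P)%N.
Proof.
rewrite /psize; case: P => s /= /andP[_]; elim: s => //= k s IH.
by rewrite inE negb_or eq_sym -lt0n => /andP[k0 /IH h]; rewrite -add1n leq_add.
Qed.

Lemma big_nat_trunc (T : Type) (idx : T) (op : Monoid.law idx) m n (F : nat -> T) :
  (m <= n)%N -> (forall x, (m <= x)%N -> F x = idx) ->
  \big[op/idx]_(0 <= x < n) F x = \big[op/idx]_(0 <= x < m) F x.
Proof.
move=> mn F0; rewrite (big_cat_nat (leq0n m) mn) /= [X in op _ X]big1_seq ?Monoid.mulm1//.
by move=> x; rewrite mem_index_iota => /andP[_ /andP[mx _]]; exact: F0.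
Qed.

Lemma psize_sum P n : (size P <= n)%N -> psize P = \sum_(0 <= x < n) part P x.+1.
Proof.
move=> Pn; rewrite (big_nat_trunc _ Pn); last exact: part_out.
by rewrite /psize sumnE (big_nth 0%N).
Qed.

Lemma part_le_psize P x : (part P x.+1 <= psize P)%N.
Proof.
have [xs|sx] := ltnP x (size P); last by rewrite part_out.
by rewrite (psize_sum (leqnn _)) big_mkord (bigD1 (Ordinal xs))//= leq_addr.
Qed.

Lemma part_inj P Q : (forall x, part P x.+1 = part Q x.+1) -> P = Q.
Proof.
move=> PQ; apply: val_inj.
have size_le P' Q' : (forall x, part P' x.+1 = part Q' x.+1) -> (size P' <= size Q')%N.
  move=> PQ'; rewrite leqNgt; apply/negP => h; have := part_gt0 P' (size Q').
  by rewrite h PQ' part_out.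
apply: (@eq_from_nth _ 0%N) => [|x _]; last exact: PQ.
by apply: anti_leq; rewrite !size_le.
Qed.

Lemma big_diagram (T : Type) (idx : T) (op : Monoid.law idx) P n (f : nat * nat -> T) :
  (size P <= n)%N -> \big[op/idx]_(b <- diagram P) f b =
  \big[op/idx]_(0 <= x < n) \big[op/idx]_(0 <= y < part P x.+1) f (x.+1, y.+1).
Proof.
move=> Pn; have iota1 m : iota 1 m = index_iota 1 m.+1 by rewrite /index_iota subSS subn0.
rewrite big_allpairs_dep iota1 big_add1 (big_nat_trunc _ Pn).
  by apply: eq_bigr => x _; rewrite iota1 big_add1.
by move=> x sx; rewrite part_out// big_geq.
Qed.

Lemma transposeK : involutive transpose.
Proof.
move=> P; apply: part_inj => x; apply: ltn_ext => y.
by rewrite -2!part_transpose.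
Qed.

End Partitions.

Section Boxes.
Variables (r n : nat).
Implicit Types (Y : {ffun 'I_r -> int_partition}) (Z : {set box r n}).

Definition boxes Y : {set box r n} :=
  [set b : box r n | (b.2 < part (Y b.1.1) b.1.2.+1)%N].

Lemma big_boxes (T : Type) (idx : T) (op : Monoid.com_law idx) Z
    (f : 'I_r -> nat -> nat -> T) : young Z ->
  \big[op/idx]_(b in Z) f b.1.1 b.1.2 b.2 =
  \big[op/idx]_(a < r) \big[op/idx]_(0 <= x < n) \big[op/idx]_(0 <= y < rowlen Z a x) f a x y.
Proof.
move=> yZ.
rewrite [RHS](eq_bigr (fun a => \big[op/idx]_(x < n) \big[op/idx]_(y < n | (y < rowlen Z a x)%N) f a x y)).
  rewrite (pair_big xpredT xpredT) /= pair_big_dep /=.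
  by apply: eq_bigl => -[[a x] y]; rewrite young_row.
move=> a _; rewrite big_mkord; apply: eq_bigr => x _; rewrite big_mkord.
by rewrite (big_ord_widen n _ (rowlen_le Z a x)).
Qed.

Lemma ltn_ext_le (k l : nat) : (k <= n)%N -> (l <= n)%N ->
  (forall y, (y < n)%N -> (y < k)%N = (y < l)%N) -> k = l.
Proof.
move=> kn ln h; apply: ltn_ext => y; have [yn|ny] := ltnP y n; first exact: h.
by rewrite !ltnNge (leq_trans kn ny) (leq_trans ln ny).
Qed.

Section Bounded.
Variable Y : {ffun 'I_r -> int_partition}.
Hypothesis Yn : forall a, (psize (Y a) <= n)%N.

Let part_n a x : (part (Y a) x.+1 <= n)%N.
Proof. exact: leq_trans (part_le_psize _ _) (Yn a). Qed.

Let size_n a : (size (Y a) <= n)%N.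
Proof. exact: leq_trans (size_le_psize _) (Yn a). Qed.

Let partT_n a y : (part (transpose (Y a)) y.+1 <= n)%N.
Proof.
rewrite leqNgt -part_transpose -leqNgt part_out//.
Qed.

Lemma young_boxes : young (boxes Y).
Proof.
apply/youngP => b c; rewrite !inE => bY e1 e2 e3; rewrite e1.
rewrite part_transpose (leq_ltn_trans e2)// -part_transpose.
exact: leq_ltn_trans bY.
Qed.

Lemma rowlen_boxes a x : rowlen (boxes Y) a x = part (Y a) x.+1.
Proof.
have [xn|nx] := ltnP x n; last by rewrite rowlen_out// part_out// (leq_trans (size_n a)).
apply: ltn_ext_le; [exact: rowlen_le|exact: part_n|] => y yn.
by have := young_row a (Ordinal xn) (Ordinal yn) young_boxes; rewrite inE => <-.
Qed.

Lemma collen_boxes a y : collen (boxes Y) a y = part (transpose (Y a)) y.+1.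
Proof.
have [yn|ny] := ltnP y n; last first.
  rewrite collen_out//; apply/esym/eqP; rewrite -leqn0 leqNgt -part_transpose -leqNgt.
  exact: leq_trans ny.
apply: ltn_ext_le; [exact: collen_le|exact: partT_n|] => x xn.
by have := young_col a (Ordinal xn) (Ordinal yn) young_boxes; rewrite inE /= part_transpose => <-.
Qed.

Lemma card_boxes : #|boxes Y| = (\sum_(a < r) psize (Y a))%N.
Proof.
rewrite -sum1_card (@big_boxes _ _ _ _ (fun _ _ _ => 1%N) young_boxes).
apply: eq_bigr => a _; rewrite (psize_sum (size_n a)); apply: eq_bigr => x _.
by rewrite sum_nat_const_nat rowlen_boxes muln1 subn0.
Qed.

End Bounded.

Lemma tuple_psize_le Y m : (\sum_(a < r) psize (Y a) = m)%N -> forall a, (psize (Y a) <= m)%N.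
Proof. by move=> <- a; rewrite (bigD1 a)//= leq_addr. Qed.

Lemma boxes_inj Y Y' : (forall a, (psize (Y a) <= n)%N) -> (forall a, (psize (Y' a) <= n)%N) ->
  boxes Y = boxes Y' -> Y = Y'.
Proof.
move=> Yn Yn' E; apply/ffunP => a; apply: part_inj => x.
by rewrite -!rowlen_boxes// E.
Qed.

Lemma rows_subproof Z a : young Z ->
  sorted geq (mkseq (rowlen Z a) (collen Z a 0)) &&
  (0%N \notin mkseq (rowlen Z a) (collen Z a 0)).
Proof.
move=> yZ; have [sh _ _] := young_shape a yZ; apply/andP; split.
  apply: (homo_sorted (e := leq)); last exact: iota_sorted.
  move=> x x' /= xx'; rewrite leqNgt; apply/negP => h.
  by move: (h); rewrite sh => /(leq_ltn_trans xx'); rewrite -sh ltnn.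
apply/mapP => -[x]; rewrite mem_iota /= add0n -sh => h e.
by rewrite -e in h.
Qed.

Lemma boxes_surj Z : young Z -> exists2 Y, boxes Y = Z & (\sum_(a < r) psize (Y a))%N = #|Z|.
Proof.
move=> yZ; pose Y := [ffun a => IntPartition (rows_subproof a yZ)].
have YE a x : part (Y a) x.+1 = rowlen Z a x.
  have [sh _ _] := young_shape a yZ.
  rewrite ffunE /part /=; have [xc|cx] := ltnP x (collen Z a 0); first by rewrite nth_mkseq.
  rewrite nth_default ?size_mkseq//; apply/esym/eqP; rewrite -leqn0 leqNgt sh -leqNgt.
  by [].
exists Y; first by apply/finset.setP => -[[a x] y]; rewrite inE /= YE young_row.
rewrite -sum1_card (@big_boxes _ _ _ _ (fun _ _ _ => 1%N) yZ); apply: eq_bigr => a _.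
have sz : (size (Y a) <= n)%N by rewrite ffunE size_mkseq collen_le.
rewrite (psize_sum sz); apply: eq_bigr => x _.
by rewrite sum_nat_const_nat YE muln1 subn0.
Qed.

End Boxes.

(** * From sets of boxes back to tuples of partitions *)

Section Bridge.
Variables (R : realType) (r n S : nat).
Local Notation C := R[i].
Variables (q1 q2 : C) (u : 'I_r -> C) (p : 'I_S -> C).

Lemma wt_boxes (Y : {ffun 'I_r -> int_partition}) : (forall a, (psize (Y a) <= n)%N) ->
  wt q1 q2 u p (boxes n Y) =
  numer q1 q2 u p Y / \prod_(a < r) \prod_(b < r) N_ q1 q2 u Y a b.
Proof.
move=> Yn; have szn a : (size (Y a) <= n)%N := leq_trans (size_le_psize _) (Yn a).
rewrite /wt /numer; congr (_ / _).
  rewrite (@big_boxes _ _ _ _ _ _ (fun a x y => \prod_(m < S) (lat q1 q2 u a x y - p m)));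
    last exact: young_boxes.
  apply: eq_bigr => a _; rewrite (big_diagram _ _ (szn a)).
  by apply: eq_bigr => x _; rewrite rowlen_boxes.
apply: eq_bigr => a _; apply: eq_bigr => c _.
rewrite /Nfac /N_ (big_diagram _ _ (szn a)) (big_diagram _ _ (szn c)) /armleg big_cat.
rewrite !big_allpairs_dep /=; congr (_ * _); apply: eq_bigr => x _.
  rewrite rowlen_boxes//; apply: eq_bigr => y _.
  rewrite collen_boxes// /leg /arm /=.
  by congr (1 - _ * q1 ^ _ * q2 ^ _); rewrite ?rowlen_boxes//; lia.
rewrite rowlen_boxes//; apply: eq_bigr => y _.
rewrite collen_boxes// /leg /arm /=.
by congr (1 - _ * q1 ^ _ * q2 ^ _); rewrite ?rowlen_boxes//; lia.
Qed.

Lemma sum_young_partitions :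
  \sum_(Z : {set box r n} | young Z && (#|Z| == n)) wt q1 q2 u p Z =
  \sum_(Y \in tuples_of_size r n)
     (numer q1 q2 u p Y / \prod_(a < r) \prod_(b < r) N_ q1 q2 u Y a b).
Proof.
rewrite (bigfs _ (index_enum_uniq _)); last by move=> Z _; rewrite mem_index_enum.
rewrite (@reindex_fsbig _ _ _ _ _ (@boxes r n) (tuples_of_size r n)).
  apply: eq_fsbigr => Y /set_mem Yn; apply: wt_boxes.
  exact: tuple_psize_le.
split.
- move=> Y /= Yn; have Yb := tuple_psize_le Yn.
  by apply/andP; split; [exact: young_boxes|rewrite card_boxes// Yn].
- move=> Y Y' /set_mem Yn /set_mem Yn'; apply: boxes_inj; exact: tuple_psize_le.
- move=> Z /= /andP[/boxes_surj[Y YZ sY] /eqP Zn]; exists Y => //.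
  exact: etrans sY Zn.
Qed.

End Bridge.

(** * Exchange of q1 and q2 and transposition of diagrams *)

Section Swap.
Variables (R : realType) (r S : nat).
Local Notation C := R[i].
Variables (q1 q2 : C) (u : 'I_r -> C) (p : 'I_S -> C).
Implicit Type Y : {ffun 'I_r -> int_partition}.

Lemma Zn_swap (s : R) n : Zn q1 q2 u p s n = Zn q2 q1 u p s n.
Proof.
rewrite /Zn [q2 * q1]mulrC [(1 - q2) * _]mulrC; congr (_ * torus_integral _ _).
apply: funext => z; rewrite /Z_integrand [q2 * q1]mulrC; congr (_ * _).
apply: eq_bigr => j _; apply: eq_bigr => k _.
by rewrite [(_ - q2 * _) * _]mulrC.
Qed.

Definition tr Y := [ffun a => transpose (Y a)].

Lemma big_diagram_transpose (T : Type) (idx : T) (op : Monoid.com_law idx)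
    (f : nat * nat -> T) P :
  \big[op/idx]_(b <- diagram (transpose P)) f b =
  \big[op/idx]_(b <- diagram P) f (b.2, b.1).
Proof.
have uniq_d Q : uniq (diagram Q).
  apply: allpairs_uniq_dep => [|x _|]; do ?exact: iota_uniq.
  by move=> [x y] [x' y'] /= _ _ [-> ->].
rewrite -[RHS](big_map (fun b : nat * nat => (b.2, b.1)) xpredT f).
apply: perm_big; apply: uniq_perm => //.
  by rewrite map_inj_uniq// => -[x y] [x' y'] [-> ->].
move=> [y x]; rewrite mem_diagram_transpose; apply/idP/mapP => [h|[[x' y'] h [-> ->]]] //.
by exists (x, y).
Qed.

Lemma psize_transpose P : psize (transpose P) = psize P.
Proof.
have E Q : psize Q = (\sum_(b <- diagram Q) 1)%N.
  rewrite (big_diagram _ _ (leqnn _)) (psize_sum (leqnn _)).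
  by apply: eq_bigr => x _; rewrite sum_nat_const_nat muln1 subn0.
by rewrite !E big_diagram_transpose.
Qed.

Lemma numer_tr Y : numer q2 q1 u p (tr Y) = numer q1 q2 u p Y.
Proof.
apply: eq_bigr => a _; rewrite ffunE big_diagram_transpose.
by apply: eq_bigr => b _; apply: eq_bigr => m _; rewrite /box_z /= mulrAC.
Qed.

Lemma N_tr Y a c : N_ q2 q1 u (tr Y) a c = M_ q1 q2 u Y a c.
Proof.
rewrite /N_ /M_ !ffunE !big_diagram_transpose.
by congr (_ * _); apply: eq_bigr => b _; rewrite /leg /arm [LHS]/= transposeK mulrAC.
Qed.

Lemma sum_swap n :
  \sum_(Y \in tuples_of_size r n)
     (numer q2 q1 u p Y / \prod_(a < r) \prod_(b < r) N_ q2 q1 u Y a b) =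
  \sum_(Y \in tuples_of_size r n)
     (numer q1 q2 u p Y / \prod_(a < r) \prod_(b < r) M_ q1 q2 u Y a b).
Proof.
have trn Y : tuples_of_size r n Y -> tuples_of_size r n (tr Y).
  rewrite /tuples_of_size /= => Yn; rewrite -[RHS]Yn; apply: eq_bigr => a _.
  by rewrite ffunE psize_transpose.
have trK : involutive tr by move=> Y; apply/ffunP => a; rewrite !ffunE transposeK.
have bij : set_bij (tuples_of_size r n) (tuples_of_size r n) tr.
  split => // [Y Y' _ _|Y Yn]; first exact: (can_inj trK).
  by exists (tr Y); [exact: trn|rewrite trK].
rewrite [LHS](@reindex_fsbig _ _ _ _ _ tr _ _ _ bij).
apply: eq_fsbigr => Y _; rewrite numer_tr; congr (_ / _).
by apply: eq_bigr => a _; apply: eq_bigr => c _; rewrite N_tr.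
Qed.

End Swap.

Local Open Scope classical_set_scope.
Local Open Scope ring_scope.
Local Open Scope complex_scope.

Theorem theorem1 (R : realType) (r n S : nat) (hr : (0 < r)%N)
  (q1 q2 : R[i]) (u : 'I_r -> R[i]) (p : 'I_S -> R[i])
  (q1_neq0 : q1 != 0) (q2_neq0 : q2 != 0)
  (q1_disk : normc q1 < 1) (q2_disk : normc q2 < 1)
  (hq : q1 = q2^* \/ (0 < q1 < 1 /\ 0 < q2 < 1))
  (hu : forall q : R[i], q = q1 \/ q = q2 ->
     normc q * \big[Num.max/normc (u (Ordinal hr))]_(a < r) normc (u a)
     < \big[Num.min/normc (u (Ordinal hr))]_(a < r) normc (u a))
  (u_generic : forall (a b : 'I_r) (x y : int), a != b ->
     - n%:Z <= x <= n%:Z -> - n%:Z <= y <= n%:Z ->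
     u a * (u b)^-1 != q1 ^ x * q2 ^ y)
  (q_generic : forall x y : nat, (x < n)%N -> (y < n)%N ->
     q1 ^+ x != q2 ^+ y.+1 /\ q1 ^+ x.+1 != q2 ^+ y)
  (rho : R) (rho_gt0 : 0 < rho)
  (hrho : forall a : 'I_r, normc (u a) < rho /\
     rho < (normc q1)^-1 * normc (u a) /\ rho < (normc q2)^-1 * normc (u a)) :
  Zn q1 q2 u p rho n =
    \sum_(Y \in tuples_of_size r n)
      (numer q1 q2 u p Y / \prod_(a < r) \prod_(b < r) N_ q1 q2 u Y a b)
  /\
  Zn q1 q2 u p rho n =
    \sum_(Y \in tuples_of_size r n)
      (numer q1 q2 u p Y / \prod_(a < r) \prod_(b < r) M_ q1 q2 u Y a b).
Proof.
have qu_gt q a : q != 0 -> rho < (normc q)^-1 * normc (u a) -> normc q * rho < normc (u a).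
  by move=> q0; rewrite mulrC ltr_pdivlMr ?normc_gt0// mulrC.
(* The outer poles u_a / (q1 q2) lie outside the circle of integration. *)
have qq_lt a : normc (q1 * q2) * rho < normc (u a).
  have [_ [h _]] := hrho a; apply: le_lt_trans (qu_gt _ _ q1_neq0 h).
  by rewrite ler_wpM2r ?(ltW rho_gt0)// normcM ler_piMr ?normc_ge0// ltW.
have u_lt a : normc (u a) < rho by have [] := hrho a.
have u_neq0 a : u a != 0.
  rewrite -normc_gt0; apply: le_lt_trans (qq_lt a).
  by rewrite mulr_ge0 ?normc_ge0// ltW.
have fact_neq0 : (n`!)%:R != 0 :> R[i] by rewrite pnatr_eq0 -lt0n fact_gt0.
(* Stated for a general pair, to be applied to (q1, q2) and to (q2, q1). *)
have main (q q' : R[i]) : q != 0 -> q' != 0 -> normc q < 1 -> normc q' < 1 ->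
    (forall a, normc (q * q') * rho < normc (u a)) ->
    (forall (a b : 'I_r) (x y : int), a != b ->
       - n%:Z <= x <= n%:Z -> - n%:Z <= y <= n%:Z ->
       u a * (u b)^-1 != q ^ x * q' ^ y) ->
    (forall x y : nat, (x < n)%N -> (y < n)%N ->
       q ^+ x != q' ^+ y.+1 /\ q ^+ x.+1 != q' ^+ y) ->
    Zn q q' u p rho n =
    \sum_(Y \in tuples_of_size r n)
      (numer q q' u p Y / \prod_(a < r) \prod_(b < r) N_ q q' u Y a b).
  move=> q0 q0' qd qd' qq ug qg.
  by rewrite Zn_mint// mint_eq_sum_young// mulKf// sum_young_partitions.
split; first exact: main.
rewrite Zn_swap -sum_swap; apply: main => //.
- by move=> a; rewrite [q2 * q1]mulrC.
- by move=> a b x y ab hx hy; rewrite [X in _ != X]mulrC u_generic.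
- by move=> x y hx hy; have [h1 h2] := q_generic y x hy hx; rewrite eq_sym h2 eq_sym h1.
Qed.
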